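(* Let $\mu$ be a complex number with $-2\mu\neq0,1,2,\ldots$ and let $x>0$. Then $$\left.\frac{\partial \mathrm{W}_{\kappa,\mu}(x)}{\partial\kappa}\right|_{\kappa=-\mu+1/2}=e^{-x/2}x^{1/2-\mu}\left\{\psi(2\mu)+\frac{x}{2\mu}\,{}_2F_2\left(\left.\begin{array}{c}1,1\\ 2,1+2\mu\end{array}\right|-x\right)+e^{-2\pi i\mu}\,\Gamma(1-2\mu,x)\,\gamma(2\mu,-x)\right\}.$$
   Context: For $x>0$ and complex $\kappa,\mu$, the Whittaker function is $\mathrm{W}_{\kappa,\mu}(x)=e^{-x/2}x^{\mu+1/2}\,\mathrm{U}\left(\frac12+\mu-\kappa,1+2\mu,x\right)$, where $\mathrm{U}$ is the Tricomi confluent hypergeometric function. The generalized hypergeometric function is ${}_pF_q\left(\left.\begin{array}{c}a_1,\ldots,a_p\\ b_1,\ldots,b_q\end{array}\right|x\right)=\sum_{n\ge0}\frac{(a_1)_n\cdots(a_p)_n}{(b_1)_n\cdots(b_q)_n}\frac{x^n}{n!}$ with $(\alpha)_n=\Gamma(\alpha+n)/\Gamma(\alpha)$. $\psi=\Gamma'/\Gamma$ is the digamma function. The upper incomplete gamma function is $\Gamma(\nu,z)=\int_z^\infty t^{\nu-1}e^{-t}\,dt$. The lower incomplete gamma function is $\gamma(\nu,z)=\int_0^z t^{\nu-1}e^{-t}\,dt$ for $\mathrm{Re}\,\nu>0$, continued analytically in $\nu\neq0,-1,-2,\ldots$ by $\gamma(\nu,z)=\sum_{n\ge0}\frac{(-1)^n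 z^{\nu+n}}{n!(\nu+n)}$; powers are principal, with $(-x)^{\nu}=e^{i\pi\nu}x^{\nu}$ for $x>0$. *)

(* Defs.v *)
(* Stdlib reals with Coquelicot's complex numbers [C]. *)
From Stdlib Require Import Reals List ZArith ClassicalEpsilon.
From Coquelicot Require Import Coquelicot.

Open Scope C_scope.

Definition cexp (z : C) : C :=
  RtoC (exp (Re z)) * (cos (Im z), sin (Im z)).

(* Principal argument, in (-PI, PI]: the negative real axis has argument PI. *)
Definition carg (z : C) : R :=
  if Rle_dec 0 (Im z) then acos (Re z / Cmod z) else (- acos (Re z / Cmod z))%R.

(* Principal power z ^ w; meaningful for z <> 0 only. *)
Definition cpow (z w : C) : C :=
  cexp (w * (ln (Cmod z), carg z)).

Definition CSeries (u : nat -> C) : C :=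
  (Series (fun n => Re (u n)), Series (fun n => Im (u n))).

Definition CRInt_gen (f : R -> C) (Fa Fb : (R -> Prop) -> Prop) : C :=
  RInt_gen (V := C_R_CompleteNormedModule) f Fa Fb.

Definition nonpos_integer (z : C) : Prop :=
  exists n : nat, z = - RtoC (INR n).

Fixpoint rising (a : C) (n : nat) : C :=
  match n with
  | O => 1
  | S k => rising a k * (a + RtoC (INR k))
  end.

Definition Gamma_integral (z : C) : C :=
  CRInt_gen (fun t : R => cpow t (z - 1) * cexp (- RtoC t))
            (at_right 0) (Rbar_locally p_infty).

(* [Gamma_shift z] is the least n with Re z + n > 0, hence 0 when Re z > 0. *)
Definition Gamma_shift (z : C) : nat := Z.to_nat (up (- Re z)).

(* Euler's integral for Re z > 0, continued to the left by
   Gamma(z) = Gamma(z + n) / (z (z+1) ... (z+n-1)).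
   The value at the poles 0, -1, -2, ... is irrelevant. *)
Definition Gamma (z : C) : C :=
  Gamma_integral (z + RtoC (INR (Gamma_shift z))) / rising z (Gamma_shift z).

(* The entire function 1 / Gamma. *)
Definition rGamma (z : C) : C :=
  if excluded_middle_informative (nonpos_integer z) then 0 else / Gamma z.

Definition digamma (z : C) : C := C_derive Gamma z / Gamma z.

(* Gamma(a + n) / Gamma(a); at the poles of Gamma this ratio is read as its
   limit, a (a+1) ... (a+n-1). *)
Definition pochhammer (a : C) (n : nat) : C :=
  if excluded_middle_informative (nonpos_integer a) then rising a n
  else Gamma (a + RtoC (INR n)) / Gamma a.

Definition Cprod (l : list C) : C := fold_right Cmult 1 l.

Definition hypergeometric (a b : list C) (x : C) : C :=
  CSeries (fun n : nat =>
    Cprod (map (fun c => pochhammer c n) a) /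
    Cprod (map (fun c => pochhammer c n) b) *
    (x ^ n / RtoC (INR (fact n)))).

(* Integral over the half-line [z, +oo), for a real lower limit z. *)
Definition upper_gamma (nu : C) (z : R) : C :=
  CRInt_gen (fun t : R => cpow t (nu - 1) * cexp (- RtoC t))
            (at_point z) (Rbar_locally p_infty).

(* For Re nu > 0 the integral from 0 to z is taken along the segment
   t = s z, 0 < s <= 1, with principal values of t ^ (nu - 1). *)
Definition lower_gamma (nu z : C) : C :=
  if Rlt_dec 0 (Re nu) then
    CRInt_gen (fun s : R => cpow (s * z) (nu - 1) * cexp (- (s * z)) * z)
              (at_right 0) (at_point 1)
  else
    CSeries (fun n : nat =>
      RtoC ((-1) ^ n) * cpow z (nu + RtoC (INR n)) /
      (RtoC (INR (fact n)) * (nu + RtoC (INR n)))).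

(* Tricomi's definition: for b not an integer,
     U(a,b,x) = Gamma(1-b) / Gamma(a-b+1) * 1F1(a; b; x)
              + Gamma(b-1) / Gamma(a) * x^(1-b) * 1F1(a-b+1; 2-b; x),
   where each 1 / Gamma is the entire function, and U is extended to integer b
   by continuity in b. *)
Definition tricomiU_nonint (a b x : C) : C :=
  Gamma (1 - b) * rGamma (a - b + 1) * hypergeometric (a :: nil) (b :: nil) x +
  Gamma (b - 1) * rGamma a * cpow x (1 - b) *
    hypergeometric (a - b + 1 :: nil) (2 - b :: nil) x.

Definition tricomiU (a b x : C) : C :=
  if excluded_middle_informative (exists m : Z, b = RtoC (IZR m)) then
    C_lim (fun b' => tricomiU_nonint a b' x) b
  else tricomiU_nonint a b x.

Definition whittakerW (kappa mu : C) (x : R) : C :=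
  cexp (- (x / 2)) * cpow x (mu + 1 / 2) *
  tricomiU (1 / 2 + mu - kappa) (1 + 2 * mu) x.

(* Main.v *)
Require Import Defs.
From Stdlib Require Import Reals List ZArith Psatz ClassicalEpsilon.
From Coquelicot Require Import Coquelicot.

(* Write [nu = 2 mu], [h s t = sum t^n / (n! (s + n))], so that
   [x^s h s (- x)] is the lower incomplete gamma function. The point
   [kappa = 1/2 - mu] is [a = nu] in [U(a, 1 + nu, x)], where the factor
   [1 / Gamma(a - nu)] has a simple zero.

   If [nu] is not an integer, differentiating Tricomi's formula term by term gives
   [dU/da = Gamma(- nu) nu h nu x + x^(- nu) (S - psi(nu))] with
   [S = sum x^n / (n (1 - nu)_n)]. A Cauchy product with partial fractions shows
   [S + T = x * h (1 - nu) (- x) * h nu x], [T] being the 2F2 term, and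
   [Gamma(1 - nu) = x^(1 - nu) h (1 - nu) (- x) + Gamma(1 - nu, x)].

   If [nu = N] is a positive integer, put [b = 1 + N + e]. The poles at [e = 0] of
   the two summands cancel in
   [U(a, b, x) = regular + (-1)^N (a - N - e)_N Delta(a, e) / e], with
   [Delta(a, 0) = 0], and [Delta(a, e) / e] has a limit [D(a0)] as
   [(a, e) -> (a0, 0)] jointly. Hence [D] is continuous, and since [(a - N)_N]
   vanishes at [a = N] only [D(N)] enters the derivative. Joint convergence allows
   computing [D(N)] along [a = N + e], where [Delta] is given by the non-integer
   identity at [nu = N + e].

   Gamma itself is handled through the splitting of Euler's integral at [x], which
   gives its continuation, recurrence and differentiability at once. *)

Open Scope C_scope.

(** At [a = nu] the function collapses to [U(nu, 1 + nu, x) = x^(- nu)], so only first-order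
    behaviour in [a] is at stake. For integer [nu] the obstacle is that [U] is itself a limit in
    [b], which would have to be exchanged with the derivative in [a]. Splitting off the vanishing
    factor [(a - N)_N] avoids this: continuity of its cofactor [D] is then enough. The joint limit
    requires quotients such as [(f (a - e) - f a) / e] to converge while the base point [a] moves as
    well. [strict_deriv], applied to the pair [(a - e, a)], provides exactly that; this is why
    Gamma, [1 / Gamma] and the powers are shown to be strictly differentiable and not just
    differentiable. Nonvanishing of Gamma matters because [rGamma] and [pochhammer] divide by it.
    The recurrence moves the question far to the right, where Gamma is compared with its values on
    the real axis. *)

Notation C_near := (locally (T := C_UniformSpace)).
Notation C_near' := (locally' (T := C_UniformSpace)).

(** * Complex exponentials and powers of positive reals *)

Lemma C_ext (a b : C) : Re a = Re b -> Im a = Im b -> a = b.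
Proof. destruct a, b; simpl; intros; subst; reflexivity. Qed.

Lemma Cmod_sub_triangle (a b : C) : (Cmod (a - b) <= Cmod a + Cmod b)%R.
Proof.
  unfold Cminus; rewrite <- (Cmod_opp b); apply Cmod_triangle.
Qed.

Lemma Cmod_sub_sym (a b : C) : Cmod (a - b) = Cmod (b - a).
Proof. rewrite <- Cmod_opp; f_equal; ring. Qed.

Lemma Cmod_le_dist (a b : C) : (Cmod a <= Cmod b + Cmod (a - b))%R.
Proof. replace a with (b + (a - b)) at 1 by ring; apply Cmod_triangle. Qed.

Lemma Cmod_ge_dist (a b : C) : (Cmod b - Cmod (a - b) <= Cmod a)%R.
Proof. generalize (Cmod_le_dist b a); rewrite (Cmod_sub_sym b a); lra. Qed.

Lemma Im_le_Cmod (z : C) : (Rabs (Im z) <= Cmod z)%R.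
Proof. eapply Rle_trans; [|apply Rmax_Cmod]; apply Rmax_r. Qed.

Lemma Cmod_le_abs (z : C) : (Cmod z <= Rabs (Re z) + Rabs (Im z))%R.
Proof.
  replace z with (RtoC (Re z) + Ci * RtoC (Im z)) at 1
    by (destruct z; apply C_ext; simpl; ring).
  eapply Rle_trans; [apply Cmod_triangle|].
  rewrite Cmod_mult, Cmod_Ci, !Cmod_R; lra.
Qed.

Lemma cexp_plus (a b : C) : cexp (a + b) = cexp a * cexp b.
Proof.
  destruct a, b; unfold cexp; apply C_ext; simpl;
    rewrite exp_plus, ?cos_plus, ?sin_plus; ring.
Qed.

Lemma cexp_RtoC (r : R) : cexp (RtoC r) = RtoC (exp r).
Proof. unfold cexp; apply C_ext; simpl; rewrite ?cos_0, ?sin_0; ring. Qed.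

Lemma cexp_0 : cexp 0 = 1.
Proof. rewrite cexp_RtoC, exp_0; reflexivity. Qed.

Lemma Cmod_cexp (z : C) : Cmod (cexp z) = exp (Re z).
Proof.
  unfold cexp; rewrite Cmod_mult, Cmod_R, Rabs_pos_eq by (left; apply exp_pos).
  replace (Cmod _) with 1%R; [ring|].
  unfold Cmod; symmetry; rewrite <- sqrt_1; f_equal.
  cbn [fst snd]; generalize (sin2_cos2 (Im z)); unfold Rsqr; simpl; intros; nra.
Qed.

Lemma cexp_neq_0 (z : C) : cexp z <> 0.
Proof.
  apply Cmod_gt_0; rewrite Cmod_cexp; apply exp_pos.
Qed.

Lemma cexp_opp (z : C) : cexp (- z) = / cexp z.
Proof.
  assert (H : cexp (- z) * cexp z = 1).
  { rewrite <- cexp_plus, <- cexp_0; f_equal; ring. }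
  rewrite <- (Cmult_1_l (/ cexp z)), <- H; field; apply cexp_neq_0.
Qed.

Lemma carg_pos (t : R) : (0 < t)%R -> carg (RtoC t) = 0%R.
Proof.
  intros Ht; unfold carg; simpl.
  destruct (Rle_dec 0 0) as [_|n]; [|lra].
  rewrite Cmod_R, Rabs_pos_eq by lra.
  unfold Rdiv; rewrite Rinv_r by lra; apply acos_1.
Qed.

Lemma carg_neg (t : R) : (t < 0)%R -> carg (RtoC t) = PI.
Proof.
  intros Ht; unfold carg; simpl.
  destruct (Rle_dec 0 0) as [_|n]; [|lra].
  rewrite Cmod_R, Rabs_left by lra.
  replace (t / - t)%R with (Ropp 1) by (field; lra).
  rewrite acos_opp, acos_1; ring.
Qed.

Lemma cpow_pos (t : R) (s : C) :
  (0 < t)%R -> cpow t s = cexp (s * RtoC (ln t)).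
Proof.
  intros Ht; unfold cpow; rewrite carg_pos, Cmod_R, Rabs_pos_eq by lra.
  reflexivity.
Qed.

(** A negative real has principal argument [PI]; the convention [(-x)^nu = e^(i pi nu) x^nu] enters
    the proof here. *)
Lemma cpow_neg (t : R) (s : C) :
  (0 < t)%R -> cpow (- RtoC t) s = cexp (s * (Ci * RtoC PI)) * cpow t s.
Proof.
  intros Ht; rewrite cpow_pos by easy; unfold cpow.
  rewrite Cmod_opp, Cmod_R, Rabs_pos_eq by lra.
  rewrite <- RtoC_opp, carg_neg by lra.
  rewrite <- cexp_plus; f_equal.
  replace ((ln t, PI) : C) with (RtoC (ln t) + Ci * RtoC PI)
    by (apply C_ext; simpl; ring).
  ring.
Qed.

Lemma cpow_plus (t : R) (a b : C) :
  (0 < t)%R -> cpow t (a + b) = cpow t a * cpow t b.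
Proof.
  intros Ht; rewrite !cpow_pos, <- cexp_plus by easy; f_equal; ring.
Qed.

Lemma cpow_opp (t : R) (a : C) :
  (0 < t)%R -> cpow t (- a) = / cpow t a.
Proof.
  intros Ht; rewrite !cpow_pos, <- cexp_opp by easy; f_equal; ring.
Qed.

Lemma cpow_INR (t : R) (n : nat) :
  (0 < t)%R -> cpow t (INR n) = RtoC t ^ n.
Proof.
  intros Ht; rewrite cpow_pos by easy.
  rewrite <- RtoC_mult, cexp_RtoC, <- RtoC_pow; f_equal.
  rewrite <- Rpower_pow by easy; reflexivity.
Qed.

Lemma cpow_1 (t : R) : (0 < t)%R -> cpow t 1 = RtoC t.
Proof. intros Ht; generalize (cpow_INR t 1 Ht); simpl; rewrite Cmult_1_r; easy. Qed.

Lemma cpow_0_r (t : R) : (0 < t)%R -> cpow t 0 = 1.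
Proof. intros Ht; apply (cpow_INR t 0); easy. Qed.

Lemma Cmod_cpow (t : R) (s : C) :
  (0 < t)%R -> Cmod (cpow t s) = exp (Re s * ln t).
Proof.
  intros Ht; rewrite cpow_pos, Cmod_cexp by easy; f_equal.
  destruct s; simpl; ring.
Qed.

Lemma cexp_Ci_PI_INR (n : nat) : cexp (RtoC (INR n) * (Ci * RtoC PI)) = (- (1)) ^ n.
Proof.
  induction n as [|n IH].
  - simpl; rewrite <- cexp_0; f_equal; ring.
  - rewrite S_INR, RtoC_plus, Cmult_plus_distr_r, cexp_plus, IH, Cmult_1_l.
    replace (cexp (Ci * RtoC PI)) with (- (1)); [simpl; ring|].
    unfold cexp; apply C_ext; simpl.
    + replace (0 * PI - 1 * 0)%R with 0%R by ring.
      replace (0 * 0 + 1 * PI)%R with PI by ring.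
      rewrite exp_0, cos_PI, sin_PI; ring.
    + replace (0 * PI - 1 * 0)%R with 0%R by ring.
      replace (0 * 0 + 1 * PI)%R with PI by ring.
      rewrite exp_0, cos_PI, sin_PI; ring.
Qed.

(** * Limits of complex functions along arbitrary filters *)

Definition clim {T : Type} (F : (T -> Prop) -> Prop) (f : T -> C) (l : C) :=
  forall e : R, (0 < e)%R -> F (fun p => Cmod (f p - l) < e)%R.

Section Clim.
Context {T : Type} {F : (T -> Prop) -> Prop} {FF : Filter F}.

Lemma clim_ext (f g : T -> C) (l : C) :
  F (fun p => f p = g p) -> clim F f l -> clim F g l.
Proof.
  intros H Hf e He; generalize (filter_and _ _ H (Hf e He)).
  apply filter_imp; intros p [<- Hp]; exact Hp.
Qed.

Lemma clim_const (c : C) : clim F (fun _ => c) c.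
Proof.
  intros e He; apply filter_forall; intros _.
  replace (c - c) with (RtoC 0) by ring; rewrite Cmod_0; exact He.
Qed.

Lemma clim_plus (f g : T -> C) (l m : C) :
  clim F f l -> clim F g m -> clim F (fun p => f p + g p) (l + m).
Proof.
  intros Hf Hg e He.
  assert (He2 : (0 < e / 2)%R) by lra.
  generalize (filter_and _ _ (Hf _ He2) (Hg _ He2)); apply filter_imp.
  intros p [H1 H2].
  replace (f p + g p - (l + m)) with ((f p - l) + (g p - m)) by ring.
  eapply Rle_lt_trans; [apply Cmod_triangle|lra].
Qed.

Lemma clim_opp (f : T -> C) (l : C) : clim F f l -> clim F (fun p => - f p) (- l).
Proof.
  intros Hf e He; generalize (Hf e He); apply filter_imp; intros p H.
  rewrite <- Cmod_opp; replace (- (- f p - - l)) with (f p - l) by ring; exact H.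
Qed.

Lemma clim_minus (f g : T -> C) (l m : C) :
  clim F f l -> clim F g m -> clim F (fun p => f p - g p) (l - m).
Proof. intros Hf Hg; apply clim_plus; [|apply clim_opp]; easy. Qed.

Lemma clim_mult (f g : T -> C) (l m : C) :
  clim F f l -> clim F g m -> clim F (fun p => f p * g p) (l * m).
Proof.
  intros Hf Hg e He.
  assert (Hl := Cmod_ge_0 l); assert (Hm := Cmod_ge_0 m).
  set (d := Rmin 1 (e / (1 + Cmod l + Cmod m))).
  assert (Hd : (0 < d)%R).
  { apply Rmin_pos; [lra|]; apply Rdiv_lt_0_compat; lra. }
  assert (Hd1 : (d <= 1)%R) by apply Rmin_l.
  assert (Hd2 : (d * (1 + Cmod l + Cmod m) <= e)%R).
  { apply Rle_trans with (e / (1 + Cmod l + Cmod m) * (1 + Cmod l + Cmod m))%R.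
    - apply Rmult_le_compat_r; [lra|apply Rmin_r].
    - right; field; lra. }
  generalize (filter_and _ _ (Hf _ Hd) (Hg _ Hd)); apply filter_imp.
  intros p [H1 H2].
  replace (f p * g p - l * m)
    with ((f p - l) * (g p - m) + (f p - l) * m + l * (g p - m)) by ring.
  eapply Rle_lt_trans; [apply Cmod_triangle|].
  eapply Rle_lt_trans; [apply Rplus_le_compat_r, Cmod_triangle|].
  rewrite !Cmod_mult.
  assert (A1 := Cmod_ge_0 (f p - l)); assert (A2 := Cmod_ge_0 (g p - m)).
  assert (Cmod (f p - l) * Cmod (g p - m) < d * 1)%R by nra.
  assert (Cmod (f p - l) * Cmod m <= d * Cmod m)%R by nra.
  assert (Cmod l * Cmod (g p - m) <= Cmod l * d)%R by nra.
  nra.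
Qed.

Lemma clim_neq_0 (f : T -> C) (l : C) :
  l <> 0 -> clim F f l -> F (fun p => f p <> 0).
Proof.
  intros Hl Hf; apply Cmod_gt_0 in Hl.
  generalize (Hf _ Hl); apply filter_imp; intros p H Hp; rewrite Hp in H.
  rewrite Cmod_sub_sym in H; replace (l - 0) with l in H by ring; lra.
Qed.

Lemma clim_inv (f : T -> C) (l : C) :
  l <> 0 -> clim F f l -> clim F (fun p => / f p) (/ l).
Proof.
  intros Hl0 Hf e He; assert (Hl := proj1 (Cmod_gt_0 _) Hl0).
  (* The first entry keeps [Cmod (f p)] above [Cmod l / 2]; the second then bounds
     [Cmod (f p - l) / (Cmod (f p) * Cmod l)] by [e]. *)
  set (d := Rmin (Cmod l / 2) (e * (Cmod l * Cmod l) / 2)).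
  assert (Hd : (0 < d)%R).
  { apply Rmin_pos; [lra|]; apply Rmult_lt_0_compat; [|lra].
    apply Rmult_lt_0_compat; nra. }
  generalize (filter_and _ _ (Hf d Hd) (clim_neq_0 f l Hl0 Hf)); apply filter_imp.
  intros p [H Hp].
  replace (/ f p - / l) with (- ((f p - l) / (f p * l))) by (field; easy).
  rewrite Cmod_opp, Cmod_div, Cmod_mult by (apply Cmult_neq_0; easy).
  assert (H1 : (d <= Cmod l / 2)%R) by apply Rmin_l.
  assert (H2 : (d <= e * (Cmod l * Cmod l) / 2)%R) by apply Rmin_r.
  assert (H3 := Cmod_ge_dist (f p) l).
  assert (H4 : (0 < Cmod (f p))%R) by lra.
  apply Rmult_lt_reg_r with (Cmod (f p) * Cmod l)%R; [nra|].
  unfold Rdiv; rewrite Rmult_assoc, Rinv_l, Rmult_1_r by nra.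
  eapply Rlt_le_trans; [exact H|]; eapply Rle_trans; [exact H2|].
  assert (Cmod l * Cmod l / 2 <= Cmod (f p) * Cmod l)%R by nra.
  nra.
Qed.

Lemma clim_div (f g : T -> C) (l m : C) :
  m <> 0 -> clim F f l -> clim F g m -> clim F (fun p => f p / g p) (l / m).
Proof. intros Hm Hf Hg; apply clim_mult, clim_inv; easy. Qed.

Lemma clim_filterlim (f : T -> C) (l : C) :
  clim F f l -> filterlim f F (C_near l).
Proof.
  intros Hf P [e HP]; unfold filtermap.
  generalize (Hf e (cond_pos e)); apply filter_imp; intros p H.
  apply HP, C_NormedModule_mixin_compat1; exact H.
Qed.

End Clim.

Lemma clim_unique {T : Type} {F : (T -> Prop) -> Prop} {FF : ProperFilter F}
  (f : T -> C) (l m : C) : clim F f l -> clim F f m -> l = m.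
Proof.
  intros Hl Hm; apply Ceq_minus, Cmod_eq_0.
  destruct (Req_dec (Cmod (l - m)) 0) as [|Hn]; [easy|exfalso].
  assert (Hp : (0 < Cmod (l - m) / 2)%R) by (generalize (Cmod_ge_0 (l - m)); lra).
  destruct (filter_ex _ (filter_and _ _ (Hl _ Hp) (Hm _ Hp))) as [p [H1 H2]].
  assert (H : (Cmod (l - m) <= Cmod (f p - m) + Cmod (f p - l))%R); [|lra].
  replace (l - m) with ((f p - m) - (f p - l)) by ring; apply Cmod_sub_triangle.
Qed.

(** Transports limits between the filters in play: punctured neighbourhoods, ends of a half-line,
    pairs off the diagonal, pairs [(a, e)] with [e] tending to 0. *)
Lemma clim_comp {T U : Type} {F : (T -> Prop) -> Prop} {G : (U -> Prop) -> Prop}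
  (g : T -> U) (f : U -> C) (l : C) :
  filterlim g F G -> clim G f l -> clim F (fun p => f (g p)) l.
Proof. intros Hg Hf e He; apply (Hg _ (Hf e He)). Qed.

Lemma locally_C_ball (z : C) (P : C -> Prop) :
  C_near z P <->
  exists d : R, (0 < d)%R /\ forall w, (Cmod (w - z) < d)%R -> P w.
Proof.
  split.
  - intros [e He]; exists e; split; [apply cond_pos|].
    intros w Hw; apply He, C_NormedModule_mixin_compat1; exact Hw.
  - intros [d [Hd H]].
    (* Balls of the product structure are squares; the square of half-side [d / sqrt 2] fits into
       the disc of radius [d]. *)
    assert (H2 : (0 < d / sqrt 2)%R).
    { apply Rdiv_lt_0_compat; [easy|apply Rlt_sqrt2_0]. }
    exists (mkposreal _ H2); intros w Hw; apply H.
    apply C_NormedModule_mixin_compat2 in Hw; simpl in Hw.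
    eapply Rlt_le_trans; [exact Hw|right; field].
    generalize Rlt_sqrt2_0; lra.
Qed.

Lemma locally'_C_ball (z : C) (P : C -> Prop) :
  C_near' z P <->
  exists d : R, (0 < d)%R /\ forall w, w <> z -> (Cmod (w - z) < d)%R -> P w.
Proof.
  unfold locally', within; rewrite locally_C_ball; split;
    intros [d [Hd H]]; exists d; split; auto.
Qed.

Lemma small_shift (a : C) (d : R) :
  (0 < d)%R -> exists w, w <> a /\ (Cmod (w - a) < d)%R.
Proof.
  intros Hd; exists (a + RtoC (d / 2)); split.
  - intros H; assert (H0 : RtoC (d / 2) = 0).
    { replace (RtoC (d / 2)) with (a + RtoC (d / 2) - a) by ring; rewrite H; ring. }
    apply RtoC_inj in H0; lra.
  - replace (a + RtoC (d / 2) - a) with (RtoC (d / 2)) by ring.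
    rewrite Cmod_R, Rabs_pos_eq; lra.
Qed.

#[global] Instance locally'_C_proper (z : C) :
  ProperFilter (C_near' z).
Proof.
  split.
  - intros P HP; apply locally'_C_ball in HP; destruct HP as [d [Hd HP]].
    destruct (small_shift z d Hd) as [w [Hw1 Hw2]]; exists w; auto.
  - apply locally'_filter.
Qed.

Lemma is_derive_clim (f : C -> C) (z l : C) :
  clim (C_near' z) (fun w => (f w - f z) / (w - z)) l ->
  is_derive (K := C_AbsRing) (V := C_NormedModule) f z l.
Proof.
  intros H; split; [apply is_linear_scal_l|].
  intros y Hy.
  assert (Ey : z = y)
    by exact (@is_filter_lim_locally_unique C_AbsRing
      (AbsRing_NormedModule C_AbsRing) z y Hy).
  subst y; intros e.
  assert (H1 := H _ (cond_pos e)); apply locally'_C_ball in H1.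
  destruct H1 as [d [Hd H1]].
  change (locally (T := AbsRing_UniformSpace C_AbsRing) z
    (fun w => (norm (minus (minus (f w) (f z)) (scal (minus w z) l)) <=
      e * norm (minus w z))%R)).
  (* [is_derive] takes neighbourhoods from the absolute value of [C], [clim] from the product
     structure; [locally_C] identifies the two. *)
  apply locally_C, locally_C_ball; exists d; split; [easy|]; intros w Hw.
  change (Cmod ((f w - f z) - (w - z) * l) <= e * Cmod (w - z))%R.
  destruct (excluded_middle_informative (w = z)) as [->|Hn].
  - replace (f z - f z - (z - z) * l) with (RtoC 0) by ring.
    replace (z - z) with (RtoC 0) by ring; rewrite Cmod_0; lra.
  - specialize (H1 w Hn Hw).
    replace (f w - f z - (w - z) * l)
      with ((w - z) * ((f w - f z) / (w - z) - l))
      by (field; apply Cminus_eq_contra, Hn).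
    rewrite Cmod_mult; generalize (Cmod_ge_0 (w - z)); nra.
Qed.

Lemma C_lim_clim (f : C -> C) (z l : C) :
  clim (C_near' z) f l -> C_lim f z = l.
Proof. intros H; apply is_C_lim_unique, clim_filterlim, H. Qed.

(** * Absolutely convergent complex series *)

Definition asum (u : nat -> C) : Prop := ex_series (fun n => Cmod (u n)).

Fixpoint csum (u : nat -> C) (n : nat) : C :=
  match n with O => 0 | S k => csum u k + u k end.

Lemma csum_ext (u v : nat -> C) (n : nat) :
  (forall k, (k < n)%nat -> u k = v k) -> csum u n = csum v n.
Proof.
  induction n as [|n IH]; intros H; [easy|]; simpl.
  rewrite IH, H; [easy|lia|intros; apply H; lia].
Qed.

Lemma csum_plus (u v : nat -> C) (n : nat) :
  csum (fun k => u k + v k) n = csum u n + csum v n.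
Proof. induction n as [|n IH]; simpl; [|rewrite IH]; ring. Qed.

Lemma csum_scal (c : C) (u : nat -> C) (n : nat) :
  csum (fun k => c * u k) n = c * csum u n.
Proof. induction n as [|n IH]; simpl; [|rewrite IH]; ring. Qed.

Lemma csum_S (u : nat -> C) (n : nat) :
  csum u (S n) = u O + csum (fun k => u (S k)) n.
Proof.
  induction n as [|n IH]; [simpl; ring|].
  change (csum u (S (S n))) with (csum u (S n) + u (S n)); rewrite IH; simpl; ring.
Qed.

Lemma csum_rev (u : nat -> C) (n : nat) :
  csum u n = csum (fun k => u (n - S k)%nat) n.
Proof.
  induction n as [|n IH]; [easy|].
  rewrite (csum_S (fun k => u (S n - S k)%nat)).
  simpl; rewrite Nat.sub_0_r, IH; ring.
Qed.

Lemma csum_Re (u : nat -> C) (n : nat) :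
  Re (csum u (S n)) = sum_f_R0 (fun k => Re (u k)) n.
Proof.
  induction n as [|n IH]; [exact (Rplus_0_l _)|].
  change (csum u (S (S n))) with (csum u (S n) + u (S n)); simpl sum_f_R0.
  rewrite <- IH; reflexivity.
Qed.

Lemma csum_Im (u : nat -> C) (n : nat) :
  Im (csum u (S n)) = sum_f_R0 (fun k => Im (u k)) n.
Proof.
  induction n as [|n IH]; [exact (Rplus_0_l _)|].
  change (csum u (S (S n))) with (csum u (S n) + u (S n)); simpl sum_f_R0.
  rewrite <- IH; reflexivity.
Qed.

Lemma asum_le (u : nat -> C) (b : nat -> R) :
  (forall n, Cmod (u n) <= b n)%R -> ex_series b -> asum u.
Proof.
  intros H Hb; apply (ex_series_le (K := R_AbsRing) (V := R_CompleteNormedModule) _ b);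
    [|easy].
  intros n; change (Rabs (Cmod (u n)) <= b n)%R.
  rewrite Rabs_pos_eq by apply Cmod_ge_0; easy.
Qed.

Lemma asum_ext (u v : nat -> C) : (forall n, u n = v n) -> asum u -> asum v.
Proof.
  intros H; apply ex_series_ext; intros n; rewrite H; reflexivity.
Qed.

Lemma asum_Re (u : nat -> C) : asum u -> ex_series (fun n => Rabs (Re (u n))).
Proof.
  apply (ex_series_le (K := R_AbsRing) (V := R_CompleteNormedModule)).
  intros n; change (Rabs (Rabs (Re (u n))) <= Cmod (u n))%R.
  rewrite Rabs_Rabsolu; apply re_le_Cmod.
Qed.

Lemma asum_Im (u : nat -> C) : asum u -> ex_series (fun n => Rabs (Im (u n))).
Proof.
  apply (ex_series_le (K := R_AbsRing) (V := R_CompleteNormedModule)).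
  intros n; change (Rabs (Rabs (Im (u n))) <= Cmod (u n))%R.
  rewrite Rabs_Rabsolu; apply Im_le_Cmod.
Qed.

Lemma asum_plus (u v : nat -> C) : asum u -> asum v -> asum (fun n => u n + v n).
Proof.
  intros Hu Hv; apply asum_le with (fun n => Cmod (u n) + Cmod (v n))%R.
  - intros n; apply Cmod_triangle.
  - apply (ex_series_plus (K := R_AbsRing) (V := R_NormedModule)); easy.
Qed.

Lemma asum_scal (c : C) (u : nat -> C) : asum u -> asum (fun n => c * u n).
Proof.
  intros Hu; apply asum_le with (fun n => Cmod c * Cmod (u n))%R.
  - intros n; rewrite Cmod_mult; lra.
  - apply (ex_series_scal (K := R_AbsRing) (V := R_NormedModule)); easy.
Qed.

Lemma asum_shift (u : nat -> C) (N : nat) : asum u -> asum (fun k => u (N + k)%nat).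
Proof. intros H; apply (ex_series_incr_n (fun n => Cmod (u n)) N), H. Qed.

Lemma CSeries_ext (u v : nat -> C) : (forall n, u n = v n) -> CSeries u = CSeries v.
Proof.
  intros H; unfold CSeries; f_equal; apply Series_ext; intros n; rewrite H; easy.
Qed.

Lemma CSeries_plus (u v : nat -> C) :
  asum u -> asum v -> CSeries (fun n => u n + v n) = CSeries u + CSeries v.
Proof.
  intros Hu Hv; unfold CSeries; apply C_ext; simpl.
  - rewrite <- Series_plus by (apply ex_series_Rabs, asum_Re; easy).
    apply Series_ext; reflexivity.
  - rewrite <- Series_plus by (apply ex_series_Rabs, asum_Im; easy).
    apply Series_ext; reflexivity.
Qed.

Lemma CSeries_scal (c : C) (u : nat -> C) :
  asum u -> CSeries (fun n => c * u n) = c * CSeries u.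
Proof.
  intros Hu; assert (H1 := ex_series_Rabs _ (asum_Re _ Hu));
    assert (H2 := ex_series_Rabs _ (asum_Im _ Hu)).
  unfold CSeries; apply C_ext; simpl; fold (Re c) (Im c).
  - rewrite <- !Series_scal_l, <- Series_minus by
      (apply (ex_series_scal (K := R_AbsRing) (V := R_NormedModule)); easy).
    apply Series_ext; reflexivity.
  - rewrite <- !Series_scal_l, <- Series_plus by
      (apply (ex_series_scal (K := R_AbsRing) (V := R_NormedModule)); easy).
    apply Series_ext; reflexivity.
Qed.

Lemma CSeries_minus (u v : nat -> C) :
  asum u -> asum v -> CSeries (fun n => u n - v n) = CSeries u - CSeries v.
Proof.
  intros Hu Hv; replace (CSeries u - CSeries v) with (CSeries u + (- (1)) * CSeries v)
    by ring.
  rewrite <- (CSeries_scal (- (1)) v Hv), <- (CSeries_plus u _ Hu (asum_scal _ v Hv)).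
  apply CSeries_ext; intros n; ring.
Qed.

Lemma CSeries_S (u : nat -> C) :
  asum u -> CSeries u = u O + CSeries (fun k => u (S k)).
Proof.
  intros Hu; unfold CSeries; apply C_ext; simpl.
  - rewrite Series_incr_1 by (apply ex_series_Rabs, asum_Re; easy); reflexivity.
  - rewrite Series_incr_1 by (apply ex_series_Rabs, asum_Im; easy); reflexivity.
Qed.

Lemma CSeries_split (u : nat -> C) (N : nat) :
  asum u -> CSeries u = csum u N + CSeries (fun k => u (N + k)%nat).
Proof.
  intros Hu; induction N as [|N IH]; simpl csum; [symmetry; apply Cplus_0_l|].
  rewrite IH, (CSeries_S (fun k => u (N + k)%nat)) by (apply asum_shift; easy).
  rewrite Nat.add_0_r, <- Cplus_assoc; do 2 f_equal.
  apply CSeries_ext; intros k; f_equal; lia.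
Qed.

(** Real and imaginary parts are estimated separately, hence the factor 2. *)
Lemma Cmod_CSeries_le (u : nat -> C) (b : nat -> R) :
  (forall n, Cmod (u n) <= b n)%R -> ex_series b ->
  (Cmod (CSeries u) <= 2 * Series b)%R.
Proof.
  intros H Hb; assert (Hu := asum_le u b H Hb).
  eapply Rle_trans; [apply Cmod_le_abs|].
  assert (H1 : (Rabs (Re (CSeries u)) <= Series b)%R).
  { eapply Rle_trans; [apply Series_Rabs, asum_Re, Hu|].
    apply Series_le; [|easy]; intros n; split; [apply Rabs_pos|].
    eapply Rle_trans; [apply re_le_Cmod|apply H]. }
  assert (H2 : (Rabs (Im (CSeries u)) <= Series b)%R).
  { eapply Rle_trans; [apply Series_Rabs, asum_Im, Hu|].
    apply Series_le; [|easy]; intros n; split; [apply Rabs_pos|].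
    eapply Rle_trans; [apply Im_le_Cmod|apply H]. }
  lra.
Qed.

Lemma Series_tail_small (b : nat -> R) (e : R) :
  ex_series b -> (0 < e)%R -> exists N, (Series (fun k => b (N + k)%nat) < e)%R.
Proof.
  intros Hb He; assert (H := Series_correct _ Hb).
  assert (H1 := H _ (locally_ball (Series b) (mkposreal e He))).
  destruct H1 as [n Hn]; specialize (Hn n (le_n n)).
  change (Rabs (sum_n b n - Series b) < e)%R in Hn.
  exists (S n); rewrite sum_n_Reals in Hn.
  rewrite (Series_incr_n b (S n)) in Hn by (lia || easy); simpl pred in Hn.
  apply Rabs_def2 in Hn; lra.
Qed.

Lemma clim_csum {T : Type} {F : (T -> Prop) -> Prop} {FF : Filter F}
  (u : T -> nat -> C) (l : nat -> C) (N : nat) :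
  (forall n, (n < N)%nat -> clim F (fun p => u p n) (l n)) ->
  clim F (fun p => csum (u p) N) (csum l N).
Proof.
  induction N as [|N IH]; intros H; simpl; [apply clim_const|].
  apply clim_plus; [apply IH; intros n Hn|]; apply H; lia.
Qed.

Lemma clim_bound {T : Type} {F : (T -> Prop) -> Prop} {FF : ProperFilter F}
  (f : T -> C) (l : C) (M : R) :
  clim F f l -> F (fun p => Cmod (f p) <= M)%R -> (Cmod l <= M)%R.
Proof.
  intros Hf HM; apply Rnot_lt_le; intros Hn.
  assert (He : (0 < Cmod l - M)%R) by lra.
  destruct (filter_ex _ (filter_and _ _ (Hf _ He) HM)) as [p [H1 H2]].
  generalize (Cmod_ge_dist (f p) l); lra.
Qed.

(** Dominated convergence for series: a finite head converges termwise, and the common majorant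
    makes the tails uniformly small. All later interchanges of limit and sum go through this
    lemma. *)
Lemma tannery {T : Type} {F : (T -> Prop) -> Prop} {FF : ProperFilter F}
  (u : T -> nat -> C) (l : nat -> C) (M : nat -> R) :
  (forall n, clim F (fun p => u p n) (l n)) ->
  F (fun p => forall n, Cmod (u p n) <= M n)%R -> ex_series M ->
  clim F (fun p => CSeries (u p)) (CSeries l).
Proof.
  intros Hl HM Hs e He.
  (* The limit terms inherit the majorant, so the limit series converges too. *)
  assert (Hlm : forall n, (Cmod (l n) <= M n)%R).
  { intros n; apply (clim_bound (fun p => u p n)); [easy|].
    revert HM; apply filter_imp; intros p H; apply H. }
  (* Each of the two tails costs at most [2 * (e / 8)], leaving [e / 2] for the head. *)
  destruct (Series_tail_small M (e / 8)) as [N HN]; [easy|lra|].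
  assert (He2 : (0 < e / 2)%R) by lra.
  generalize (filter_and _ _ HM (clim_csum u l N (fun n _ => Hl n) _ He2)); apply filter_imp.
  intros p [H1 H2].
  assert (Hsh : ex_series (fun k => M (N + k)%nat)).
  { apply (ex_series_incr_n M N); easy. }
  rewrite (CSeries_split (u p) N) by (eapply asum_le; [apply H1|easy]).
  rewrite (CSeries_split l N) by (eapply asum_le; [apply Hlm|easy]).
  assert (T1 := Cmod_CSeries_le (fun k => u p (N + k)%nat)
    (fun k => M (N + k)%nat) (fun k => H1 _) Hsh).
  assert (T2 := Cmod_CSeries_le (fun k => l (N + k)%nat)
    (fun k => M (N + k)%nat) (fun k => Hlm _) Hsh).
  match goal with |- (Cmod (?a + ?b - (?c + ?d)) < _)%R =>
    replace (a + b - (c + d)) with ((a - c) + (b - d)) by ring end.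
  eapply Rle_lt_trans; [apply Cmod_triangle|].
  match goal with |- (_ + Cmod (?a - ?b) < _)%R =>
    generalize (Cmod_sub_triangle a b) end; lra.
Qed.

Lemma ex_series_exp_bound (A B : R) : ex_series (fun n => A * (B ^ n / INR (fact n)))%R.
Proof.
  apply (ex_series_scal (K := R_AbsRing) (V := R_NormedModule) A).
  exists (exp B); generalize (is_exp_Reals B); apply is_series_ext.
  intros n; rewrite pow_n_pow; reflexivity.
Qed.

(** Expanding real and imaginary parts gives four real products of absolutely convergent series. *)
Lemma CSeries_Cauchy_product (u v : nat -> C) :
  asum u -> asum v ->
  CSeries u * CSeries v = CSeries (fun n => csum (fun k => u k * v (n - k)%nat) (S n)).
Proof.
  intros Hu Hv.
  assert (Hur := asum_Re _ Hu); assert (Hui := asum_Im _ Hu);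
    assert (Hvr := asum_Re _ Hv); assert (Hvi := asum_Im _ Hv).
  assert (P : forall a b : nat -> R,
    ex_series (fun n => Rabs (a n)) -> ex_series (fun n => Rabs (b n)) ->
    is_series (fun n => sum_f_R0 (fun k => a k * b (n - k)%nat)%R n)
      (Series a * Series b)%R).
  { intros a b Ha Hb; apply is_series_mult; try easy;
      apply Series_correct, ex_series_Rabs; easy. }
  unfold CSeries; apply C_ext; simpl.
  - rewrite <- (is_series_unique _ _ (P _ _ Hur Hvr)),
      <- (is_series_unique _ _ (P _ _ Hui Hvi)).
    rewrite <- Series_minus
      by (eexists; first [exact (P _ _ Hur Hvr) | exact (P _ _ Hui Hvi)]).
    apply Series_ext; intros n.
    rewrite <- minus_sum; symmetry.
    exact (csum_Re (fun k => u k * v (n - k)%nat) n).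
  - rewrite <- (is_series_unique _ _ (P _ _ Hur Hvi)),
      <- (is_series_unique _ _ (P _ _ Hui Hvr)).
    rewrite <- Series_plus
      by (eexists; first [exact (P _ _ Hur Hvi) | exact (P _ _ Hui Hvr)]).
    apply Series_ext; intros n.
    rewrite <- sum_plus; symmetry.
    exact (csum_Im (fun k => u k * v (n - k)%nat) n).
Qed.

(** * Derivatives and improper integrals of complex functions of a real variable *)

(** Componentwise, so that automatic differentiation, the mean value theorem and the fundamental
    theorem of calculus for real functions apply to each component. *)
Definition dC (f : R -> C) (t : R) (l : C) : Prop :=
  is_derive (fun u => Re (f u)) t (Re l) /\ is_derive (fun u => Im (f u)) t (Im l).

Lemma dC_ext_loc (f g : R -> C) (t : R) (l : C) :
  locally t (fun u => f u = g u) -> dC f t l -> dC g t l.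
Proof.
  intros H [H1 H2]; split;
    [apply (is_derive_ext_loc (fun u => Re (f u)))
    |apply (is_derive_ext_loc (fun u => Im (f u)))]; try easy;
    revert H; apply filter_imp; intros u ->; reflexivity.
Qed.

Lemma dC_plus (f g : R -> C) (t : R) (l m : C) :
  dC f t l -> dC g t m -> dC (fun u => f u + g u) t (l + m).
Proof.
  intros [Hf1 Hf2] [Hg1 Hg2]; split;
    [exact (is_derive_plus _ _ _ _ _ Hf1 Hg1)|exact (is_derive_plus _ _ _ _ _ Hf2 Hg2)].
Qed.

Lemma dC_mult (f g : R -> C) (t : R) (l m : C) :
  dC f t l -> dC g t m -> dC (fun u => f u * g u) t (l * g t + f t * m).
Proof.
  intros [Hf1 Hf2] [Hg1 Hg2]; split.
  - evar_last.
    + exact (is_derive_minus _ _ _ _ _ (Derive.is_derive_mult _ _ _ _ _ Hf1 Hg1)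
        (Derive.is_derive_mult _ _ _ _ _ Hf2 Hg2)).
    + unfold minus, plus, opp; simpl; unfold Re, Im; ring.
  - evar_last.
    + exact (is_derive_plus _ _ _ _ _ (Derive.is_derive_mult _ _ _ _ _ Hf1 Hg2)
        (Derive.is_derive_mult _ _ _ _ _ Hf2 Hg1)).
    + unfold minus, plus, opp; simpl; unfold Re, Im; ring.
Qed.

Lemma dC_const (c : C) (t : R) : dC (fun _ => c) t 0.
Proof. split; exact (is_derive_const _ _). Qed.

Lemma dC_scal (c : C) (f : R -> C) (t : R) (l : C) :
  dC f t l -> dC (fun u => c * f u) t (c * l).
Proof.
  intros H; replace (c * l) with (0 * f t + c * l) by ring.
  apply (dC_mult (fun _ => c)); [apply dC_const|easy].
Qed.

Lemma dC_minus (f g : R -> C) (t : R) (l m : C) :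
  dC f t l -> dC g t m -> dC (fun u => f u - g u) t (l - m).
Proof.
  intros Hf Hg; replace (l - m) with (l + (- (1)) * m) by ring.
  apply dC_ext_loc with (fun u => f u + (- (1)) * g u).
  - apply filter_forall; intros; ring.
  - apply dC_plus, dC_scal; easy.
Qed.

Lemma dC_RtoC (f : R -> R) (t l : R) :
  is_derive f t l -> dC (fun u => RtoC (f u)) t (RtoC l).
Proof. intros H; split; [exact H|exact (is_derive_const _ _)]. Qed.

Lemma dC_comp_real (f : R -> C) (g : R -> R) (t k : R) (l : C) :
  dC f (g t) l -> is_derive g t k -> dC (fun u => f (g u)) t (RtoC k * l).
Proof.
  intros [H1 H2] Hg; split.
  - evar_last; [exact (is_derive_comp _ _ _ _ _ H1 Hg)|].
    unfold scal; simpl; unfold mult; simpl; unfold Re, Im; ring.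
  - evar_last; [exact (is_derive_comp _ _ _ _ _ H2 Hg)|].
    unfold scal; simpl; unfold mult; simpl; unfold Re, Im; ring.
Qed.

Lemma dC_clim (f : R -> C) (t : R) (l : C) : dC f t l -> clim (locally t) f (f t).
Proof.
  intros [H1 H2] e He.
  assert (C1 : continuous (fun u => Re (f u)) t)
    by (apply (ex_derive_continuous (fun u => Re (f u))); eexists; exact H1).
  assert (C2 : continuous (fun u => Im (f u)) t)
    by (apply (ex_derive_continuous (fun u => Im (f u))); eexists; exact H2).
  assert (He2 : (0 < e / 2)%R) by lra.
  assert (A1 : locally t (fun u => Rabs (Re (f u) - Re (f t)) < e / 2)%R)
    by exact (C1 _ (locally_ball (Re (f t)) (mkposreal _ He2))).
  assert (A2 : locally t (fun u => Rabs (Im (f u) - Im (f t)) < e / 2)%R)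
    by exact (C2 _ (locally_ball (Im (f t)) (mkposreal _ He2))).
  generalize (filter_and _ _ A1 A2); clear A1 A2; apply filter_imp; intros u [A1 A2].
  eapply Rle_lt_trans; [apply Cmod_le_abs|].
  change (Rabs (Re (f u) - Re (f t)) + Rabs (Im (f u) - Im (f t)) < e)%R; lra.
Qed.

Lemma dC_cpow (s : C) (t : R) :
  (0 < t)%R -> dC (fun u : R => cpow u s) t (s * cpow t (s - 1)).
Proof.
  intros Ht; apply dC_ext_loc with (fun u => cexp (s * RtoC (ln u))).
  { exists (mkposreal t Ht); intros u Hu; rewrite cpow_pos; [easy|].
    change (Rabs (u - t) < t)%R in Hu; apply Rabs_def2 in Hu; lra. }
  replace (s - 1) with (s + - (1)) by ring.
  rewrite cpow_plus, cpow_opp, cpow_1, cpow_pos by easy.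
  rewrite <- RtoC_inv by lra.
  destruct s as [a b]; unfold cexp; split; simpl; auto_derive; try easy;
    unfold Rminus; field; lra.
Qed.

Lemma dC_RtoC_exp (k t : R) :
  dC (fun u => RtoC (exp (k * u))) t (RtoC (k * exp (k * t))).
Proof. apply dC_RtoC; auto_derive; [easy|ring]. Qed.

Lemma real_increment_le (f g : R -> R) (df dg : R -> R) (a b : R) :
  (a <= b)%R -> (forall t, (a <= t <= b)%R -> is_derive f t (df t)) ->
  (forall t, (a <= t <= b)%R -> is_derive g t (dg t)) ->
  (forall t, (a <= t <= b)%R -> df t <= dg t)%R -> (f b - f a <= g b - g a)%R.
Proof.
  intros Hab Hf Hg H.
  destruct (MVT_gen (fun t => g t - f t)%R a b (fun t => dg t - df t)%R)
    as [c [Hc E]].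
  - rewrite Rmin_left, Rmax_right by easy; intros t Ht.
    apply (is_derive_minus g f); [apply Hg|apply Hf]; lra.
  - rewrite Rmin_left, Rmax_right by easy; intros t Ht.
    apply continuity_pt_filterlim.
    apply (ex_derive_continuous (fun t => g t - f t)%R).
    eexists; apply (is_derive_minus g f); [apply Hg|apply Hf]; lra.
  - rewrite Rmin_left, Rmax_right in Hc by easy.
    specialize (H c Hc); nra.
Qed.

(** A complex function need not have a mean value point, so each component is compared with [g] in
    turn. The resulting factor 2 reappears in later constants. *)
Lemma dC_increment_le (f df : R -> C) (g dg : R -> R) (a b : R) :
  (a <= b)%R -> (forall t, (a <= t <= b)%R -> dC f t (df t)) ->
  (forall t, (a <= t <= b)%R -> is_derive g t (dg t)) ->
  (forall t, (a <= t <= b)%R -> Cmod (df t) <= dg t)%R ->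
  (Cmod (f b - f a) <= 2 * (g b - g a))%R.
Proof.
  intros Hab Hf Hg H.
  assert (K : forall (r dr : R -> R),
    (forall t, (a <= t <= b)%R -> is_derive r t (dr t)) ->
    (forall t, (a <= t <= b)%R -> Rabs (dr t) <= dg t)%R ->
    (Rabs (r b - r a) <= g b - g a)%R).
  { intros r dr Hr Hdr; apply Rabs_le; split.
    - assert (X := real_increment_le (fun t => - r t)%R g (fun t => - dr t)%R dg a b).
      cut (- r b - - r a <= g b - g a)%R; [lra|]; apply X; try easy.
      + intros t Ht; apply (is_derive_opp r), Hr, Ht.
      + intros t Ht; specialize (Hdr t Ht); apply Rabs_le_between in Hdr; lra.
    - apply (real_increment_le r g dr dg); try easy.
      intros t Ht; specialize (Hdr t Ht); apply Rabs_le_between in Hdr; lra. }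
  eapply Rle_trans; [apply Cmod_le_abs|].
  assert (X1 := K (fun t => Re (f t)) (fun t => Re (df t))
    (fun t Ht => proj1 (Hf t Ht))
    (fun t Ht => Rle_trans _ _ _ (re_le_Cmod _) (H t Ht))).
  assert (X2 := K (fun t => Im (f t)) (fun t => Im (df t))
    (fun t Ht => proj2 (Hf t Ht))
    (fun t Ht => Rle_trans _ _ _ (Im_le_Cmod _) (H t Ht))).
  cbv beta in X1, X2.
  change (Rabs (Re (f b) - Re (f a)) + Rabs (Im (f b) - Im (f a)) <=
    2 * (g b - g a))%R; lra.
Qed.

(** Supplies the continuity on the open half-line that the fundamental theorem of calculus asks of
    an integrand. *)
Definition smooth_pos (f : R -> C) : Prop :=
  forall t, (0 < t)%R -> exists l, dC f t l.

Lemma smooth_pos_continuous (f : R -> C) (t : R) :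
  smooth_pos f -> (0 < t)%R ->
  continuous (fun u => Re (f u)) t /\ continuous (fun u => Im (f u)) t.
Proof.
  intros Hf Ht; destruct (Hf t Ht) as [l [H1 H2]]; split.
  - apply (ex_derive_continuous (fun u => Re (f u))); eexists; exact H1.
  - apply (ex_derive_continuous (fun u => Im (f u))); eexists; exact H2.
Qed.

Lemma real_antiderivative (g : R -> R) :
  (forall t, (0 < t)%R -> continuous g t) ->
  forall t, (0 < t)%R -> is_derive (fun u => RInt g 1 u) t (g t).
Proof.
  intros Hg t Ht; apply (is_derive_RInt g (fun u => RInt g 1 u) 1).
  - exists (mkposreal t Ht); intros u Hu.
    change (Rabs (u - t) < t)%R in Hu; apply Rabs_def2 in Hu.
    apply (RInt_correct g), ex_RInt_continuous; intros z Hz; apply Hg.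
    apply Rlt_le_trans with (Rmin 1 u); [apply Rmin_pos; lra|easy].
  - apply Hg, Ht.
Qed.

Lemma antiderivative_exists (f : R -> C) :
  smooth_pos f -> exists G, forall t, (0 < t)%R -> dC G t (f t).
Proof.
  intros Hf.
  exists (fun u => (RInt (fun v => Re (f v)) 1 u, RInt (fun v => Im (f v)) 1 u)).
  intros t Ht; split.
  - apply (real_antiderivative (fun v => Re (f v))); [|easy].
    intros u Hu; exact (proj1 (smooth_pos_continuous f u Hf Hu)).
  - apply (real_antiderivative (fun v => Im (f v))); [|easy].
    intros u Hu; exact (proj2 (smooth_pos_continuous f u Hf Hu)).
Qed.

Lemma is_RInt_antiderivative (f G : R -> C) (a b : R) :
  smooth_pos f -> (forall t, (0 < t)%R -> dC G t (f t)) -> (0 < a)%R -> (0 < b)%R ->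
  is_RInt (V := C_R_NormedModule) f a b (G b - G a).
Proof.
  intros Hf HG Ha Hb.
  assert (Hm : forall t, (Rmin a b <= t <= Rmax a b)%R -> (0 < t)%R).
  { intros t Ht; apply Rlt_le_trans with (Rmin a b); [apply Rmin_pos; lra|easy]. }
  apply (is_RInt_fct_extend_pair (U := R_NormedModule) (V := R_NormedModule)).
  - apply (is_RInt_derive (fun t => Re (G t))); intros t Ht; apply Hm in Ht.
    + apply HG, Ht.
    + apply (smooth_pos_continuous f t Hf Ht).
  - apply (is_RInt_derive (fun t => Im (G t))); intros t Ht; apply Hm in Ht.
    + apply HG, Ht.
    + apply (smooth_pos_continuous f t Hf Ht).
Qed.

(** Integrals over compact intervals of positive numbers are increments of [G], so only the limits
    of [G] at the two ends count. Keeping the end filters abstract treats [0+], a fixed point and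
    [+oo] alike. *)
Lemma CRInt_gen_antiderivative (f G : R -> C) (Fa Fb : (R -> Prop) -> Prop)
  {FFa : ProperFilter Fa} {FFb : ProperFilter Fb} (la lb : C) :
  smooth_pos f -> (forall t, (0 < t)%R -> dC G t (f t)) ->
  Fa (Rlt 0) -> Fb (Rlt 0) -> clim Fa G la -> clim Fb G lb ->
  is_RInt_gen (V := C_R_NormedModule) f Fa Fb (lb - la).
Proof.
  intros Hf HG HFa HFb Ha Hb P [e HP].
  assert (He : (0 < e / 2)%R) by (generalize (cond_pos e); lra).
  apply (Filter_prod _ _ _ _ _ (filter_and _ _ HFa (Ha _ He))
    (filter_and _ _ HFb (Hb _ He))).
  intros u v [Hu1 Hu2] [Hv1 Hv2]; simpl.
  exists (G v - G u); split; [apply is_RInt_antiderivative; easy|].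
  apply HP, C_NormedModule_mixin_compat1.
  change (Cmod ((G v - G u) - (lb - la)) < e)%R.
  replace ((G v - G u) - (lb - la)) with ((G v - lb) - (G u - la)) by ring.
  eapply Rle_lt_trans; [apply Cmod_sub_triangle|lra].
Qed.

#[global] Instance at_point_proper (a : R) : ProperFilter (at_point a).
Proof. apply at_point_filter. Qed.

Lemma clim_at_point (f : R -> C) (a : R) : clim (at_point a) f (f a).
Proof.
  intros e He; unfold at_point.
  replace (f a - f a) with (RtoC 0) by ring; rewrite Cmod_0; exact He.
Qed.

Lemma at_right_pos : at_right 0 (Rlt 0).
Proof. exists (mkposreal 1 Rlt_0_1); intros t _ Ht; exact Ht. Qed.

Lemma p_infty_pos : Rbar_locally p_infty (Rlt 0).
Proof. exists 0%R; intros t Ht; exact Ht. Qed.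

(* The integral of [f] over the half-line [[x, +oo)] is [l]. *)
Definition tail_int (f : R -> C) (x : R) (l : C) : Prop :=
  smooth_pos f /\ exists (G : R -> C) (L : C),
    (forall t, (0 < t)%R -> dC G t (f t)) /\
    clim (Rbar_locally p_infty) G L /\ l = L - G x.

Lemma tail_int_CRInt (f : R -> C) (x : R) (l : C) :
  (0 < x)%R -> tail_int f x l ->
  CRInt_gen f (at_point x) (Rbar_locally p_infty) = l.
Proof.
  intros Hx [Hf [G [L [HG [HL ->]]]]].
  apply (is_RInt_gen_unique (V := C_R_CompleteNormedModule)).
  apply (CRInt_gen_antiderivative f G); try easy.
  - apply at_point_proper.
  - apply Rbar_locally_filter.
  - apply p_infty_pos.
  - apply clim_at_point.
Qed.

Lemma tail_int_unique (f : R -> C) (x : R) (l m : C) :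
  (0 < x)%R -> tail_int f x l -> tail_int f x m -> l = m.
Proof.
  intros Hx Hl Hm.
  rewrite <- (tail_int_CRInt f x l), <- (tail_int_CRInt f x m) by easy; easy.
Qed.

Lemma tail_int_minus (f g : R -> C) (x : R) (l m : C) :
  tail_int f x l -> tail_int g x m -> tail_int (fun t => f t - g t) x (l - m).
Proof.
  intros [Hf [G [L [HG [HL ->]]]]] [Hg [K [M [HK [HM ->]]]]]; split.
  - intros t Ht; destruct (Hf t Ht) as [a Ha]; destruct (Hg t Ht) as [b Hb].
    exists (a - b); apply dC_minus; easy.
  - exists (fun t => G t - K t), (L - M); split; [|split; [|ring]].
    + intros t Ht; apply dC_minus; auto.
    + apply clim_minus; easy.
Qed.

Lemma tail_int_scal (c : C) (f : R -> C) (x : R) (l : C) :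
  tail_int f x l -> tail_int (fun t => c * f t) x (c * l).
Proof.
  intros [Hf [G [L [HG [HL ->]]]]]; split.
  - intros t Ht; destruct (Hf t Ht) as [a Ha]; exists (c * a); apply dC_scal; easy.
  - exists (fun t => c * G t), (c * L); split; [|split; [|ring]].
    + intros t Ht; apply dC_scal; auto.
    + apply clim_mult; [apply clim_const|easy].
Qed.

Lemma is_derive_exp_tail (A t : R) :
  is_derive (fun u => - 2 * A * exp (- u / 2))%R t (A * exp (- t / 2))%R.
Proof. auto_derive; [easy|]; unfold Rdiv; field. Qed.

Lemma bound_coef_nonneg (z : C) (A t : R) : (Cmod z <= A * exp t)%R -> (0 <= A)%R.
Proof. generalize (Cmod_ge_0 z) (exp_pos t); nra. Qed.

(** The majorant integrates to at most [2 * A * exp (- u / 2)] over [[u, v]]; the other factor 2 is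
    that of [dC_increment_le]. *)
Lemma antiderivative_tail_le (f G : R -> C) (x A u v : R) :
  (forall t, (0 < t)%R -> dC G t (f t)) -> (0 < x)%R ->
  (forall t, (x <= t)%R -> Cmod (f t) <= A * exp (- t / 2))%R ->
  (x <= u <= v)%R -> (Cmod (G v - G u) <= 4 * A * exp (- u / 2))%R.
Proof.
  intros HG Hx Hf Huv.
  assert (HA := bound_coef_nonneg _ _ _ (Hf x (Rle_refl x))).
  eapply Rle_trans;
    [apply (dC_increment_le G f _ _ u v (proj2 Huv)
      (fun t Ht => HG t ltac:(lra)) (fun t _ => is_derive_exp_tail A t));
     intros t Ht; apply Hf; lra|].
  assert (Y := exp_pos (- v / 2)); nra.
Qed.

Lemma antiderivative_tail_cvg (f G : R -> C) (x A : R) :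
  (forall t, (0 < t)%R -> dC G t (f t)) -> (0 < x)%R ->
  (forall t, (x <= t)%R -> Cmod (f t) <= A * exp (- t / 2))%R ->
  exists L, clim (Rbar_locally p_infty) G L.
Proof.
  intros HG Hx HA.
  assert (H : exists y : C_UniformSpace,
    filterlim (G : R -> C_UniformSpace) (Rbar_locally p_infty) (locally y)).
  { apply (filterlim_locally_cauchy (U := C_R_CompleteNormedModule)).
    intros e.
    assert (HA0 := bound_coef_nonneg _ _ _ (HA x (Rle_refl x))).
    (* Once [exp (- u / 2)] is below this number, [4 * A * exp (- u / 2) < e]; the [+ 1] keeps the
       denominator positive when [A = 0]. *)
    assert (He : (0 < e / (4 * A + 1))%R).
    { apply Rdiv_lt_0_compat; [apply cond_pos|lra]. }
    assert (K : forall u v, (x <= u)%R -> (u <= v)%R ->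
      (-2 * ln (e / (4 * A + 1)) < u)%R -> (Cmod (G v - G u) < e)%R).
    { intros u v Hu Huv Hl.
      eapply Rle_lt_trans;
        [apply (antiderivative_tail_le f G x A u v HG Hx HA (conj Hu Huv))|].
      assert (X : (exp (- u / 2) < e / (4 * A + 1))%R).
      { rewrite <- (exp_ln _ He); apply exp_increasing; lra. }
      apply Rlt_le_trans with ((4 * A + 1) * (e / (4 * A + 1)))%R;
        [nra|right; field; lra]. }
    exists (fun u => x < u /\ -2 * ln (e / (4 * A + 1)) < u)%R; split.
    - apply filter_and; eexists; intros u Hu; exact Hu.
    - intros u v [Hu1 Hu2] [Hv1 Hv2]; apply C_NormedModule_mixin_compat1.
      change (Cmod (G v - G u) < e)%R.
      destruct (Rle_dec u v); [apply K; lra|].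
      rewrite Cmod_sub_sym; apply K; lra. }
  destruct H as [L HL]; exists L; intros e He.
  apply (HL (fun z => Cmod (z - L) < e)%R), locally_C_ball.
  exists e; split; easy.
Qed.

Lemma tail_int_exists (f : R -> C) (x A : R) :
  smooth_pos f -> (0 < x)%R ->
  (forall t, (x <= t)%R -> Cmod (f t) <= A * exp (- t / 2))%R ->
  exists l, tail_int f x l.
Proof.
  intros Hf Hx HA; destruct (antiderivative_exists f Hf) as [G HG].
  destruct (antiderivative_tail_cvg f G x A) as [L HL]; try easy.
  exists (L - G x); split; [easy|]; exists G, L; split; easy.
Qed.

Lemma tail_int_le (f : R -> C) (x A : R) (l : C) :
  (0 < x)%R -> tail_int f x l ->
  (forall t, (x <= t)%R -> Cmod (f t) <= A * exp (- t / 2))%R ->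
  (Cmod l <= 4 * A)%R.
Proof.
  intros Hx [Hf [G [L [HG [HL ->]]]]] HA.
  apply (clim_bound (F := Rbar_locally p_infty) (fun t => G t - G x)).
  - apply clim_minus; [easy|apply clim_const].
  - exists x; intros t Ht.
    eapply Rle_trans;
      [apply (antiderivative_tail_le f G x A x t HG Hx HA); lra|].
    assert (HA0 := bound_coef_nonneg _ _ _ (HA x (Rle_refl x))).
    assert (Y : (exp (- x / 2) < exp 0)%R) by (apply exp_increasing; lra).
    rewrite exp_0 in Y; nra.
Qed.

(** * Estimates for the exponential *)

Lemma exp_le (a b : R) : (a <= b)%R -> (exp a <= exp b)%R.
Proof.
  intros [H| ->]; [left; apply exp_increasing, H|apply Rle_refl].
Qed.

Lemma dC_cexp_line (w : C) (t : R) :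
  dC (fun u => cexp (RtoC u * w)) t (w * cexp (RtoC t * w)).
Proof.
  destruct w as [a b]; unfold cexp; split; simpl; auto_derive; try easy;
    unfold Rminus; ring.
Qed.

Lemma Cmod_cexp_le (w : C) : (Cmod (cexp w) <= exp (Cmod w))%R.
Proof.
  rewrite Cmod_cexp; apply exp_le.
  eapply Rle_trans; [apply Rle_abs|apply re_le_Cmod].
Qed.

Lemma Cmod_cexp_line_le (w : C) (t : R) :
  (0 <= t <= 1)%R -> (Cmod (cexp (RtoC t * w)) <= exp (Cmod w))%R.
Proof.
  intros Ht; eapply Rle_trans; [apply Cmod_cexp_le|]; apply exp_le.
  rewrite Cmod_mult, Cmod_R, Rabs_pos_eq by lra.
  generalize (Cmod_ge_0 w); nra.
Qed.

Lemma cexp_sub_1_line (w : C) (t : R) :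
  (0 <= t <= 1)%R -> (Cmod (cexp (RtoC t * w) - 1) <= 2 * (Cmod w * exp (Cmod w)))%R.
Proof.
  intros Ht.
  assert (X := dC_increment_le (fun u => cexp (RtoC u * w))
    (fun u => w * cexp (RtoC u * w))
    (fun u => Cmod w * exp (Cmod w) * u)%R
    (fun u => Cmod w * exp (Cmod w))%R 0 t (proj1 Ht)); cbv beta in X.
  replace (RtoC 0 * w) with (RtoC 0) in X by ring; rewrite cexp_0 in X.
  assert (P : (0 <= Cmod w * exp (Cmod w))%R).
  { apply Rmult_le_pos; [apply Cmod_ge_0|left; apply exp_pos]. }
  eapply Rle_trans; [apply X|nra].
  - intros u _; apply dC_cexp_line.
  - intros u _; auto_derive; [easy|ring].
  - intros u Hu; rewrite Cmod_mult; apply Rmult_le_compat_l; [apply Cmod_ge_0|].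
    apply Cmod_cexp_line_le; lra.
Qed.

Lemma cexp_sub_1_le (w : C) : (Cmod (cexp w - 1) <= 2 * (Cmod w * exp (Cmod w)))%R.
Proof.
  replace w with (RtoC 1 * w) at 1 by ring; apply cexp_sub_1_line; lra.
Qed.

(** The increment bound on [[0, 1]] for [u -> exp (u w) - u w], whose derivative [w (exp (u w) - 1)]
    is controlled by [cexp_sub_1_line]. *)
Lemma cexp_taylor_le (w : C) :
  (Cmod (cexp w - 1 - w) <= 4 * (Cmod w * Cmod w * exp (Cmod w)))%R.
Proof.
  assert (X := dC_increment_le (fun u => cexp (RtoC u * w) - RtoC u * w)
    (fun u => w * cexp (RtoC u * w) - 1 * w)
    (fun u => 2 * (Cmod w * Cmod w * exp (Cmod w)) * u)%R
    (fun u => 2 * (Cmod w * Cmod w * exp (Cmod w)))%R 0 1 ltac:(lra)).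
  cbv beta in X.
  replace (cexp (RtoC 1 * w) - RtoC 1 * w - (cexp (RtoC 0 * w) - RtoC 0 * w))
    with (cexp w - 1 - w) in X
    by (replace (RtoC 0 * w) with (RtoC 0) by ring;
        replace (RtoC 1 * w) with w by ring; rewrite cexp_0; ring).
  eapply Rle_trans; [apply X|lra].
  - intros u _; apply dC_minus; [apply dC_cexp_line|].
    replace (1 * w) with (1 * w + RtoC u * 0) by ring.
    apply (dC_mult (fun u => RtoC u) (fun _ => w)); [|apply dC_const].
    apply dC_RtoC; auto_derive; easy.
  - intros u _; auto_derive; [easy|ring].
  - intros u Hu.
    replace (w * cexp (RtoC u * w) - 1 * w) with (w * (cexp (RtoC u * w) - 1)) by ring.
    rewrite Cmod_mult; generalize (cexp_sub_1_line w u Hu) (Cmod_ge_0 w); nra.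
Qed.

Lemma le_exp_self (r : R) : (r <= exp r)%R.
Proof. generalize (exp_ineq1_le r); lra. Qed.

(** The extra factor [Cmod p + Cmod q] makes the quotient of [exp (s L)] over pairs [(p, q)] tending
    to [(0, 0)] converge to [L]. With [L = ln t] the weight [exp (5 |L|)] is still integrable
    against [e^(-t)] away from 0. Of the exponent 5, one unit comes from [exp (q L)], two from
    [l * l], and two from [exp (D l)] with [D <= 2]. The argument gives 6 where 18 is stated. *)
Lemma cexp_strict_le (p q : C) (L : R) :
  (Cmod p <= 1)%R -> (Cmod q <= 1)%R ->
  (Cmod (cexp (p * RtoC L) - cexp (q * RtoC L) - (p - q) * RtoC L) <=
   18 * Cmod (p - q) * (Cmod p + Cmod q) * exp (5 * Rabs L))%R.
Proof.
  intros Hp Hq; set (l := Rabs L); assert (Hl : (0 <= l)%R) by apply Rabs_pos.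
  replace (cexp (p * RtoC L) - cexp (q * RtoC L) - (p - q) * RtoC L)
    with (cexp (q * RtoC L) * (cexp ((p - q) * RtoC L) - 1 - (p - q) * RtoC L)
      + (p - q) * RtoC L * (cexp (q * RtoC L) - 1)).
  2: { replace (cexp (p * RtoC L)) with (cexp (q * RtoC L) * cexp ((p - q) * RtoC L))
         by (rewrite <- cexp_plus; f_equal; ring).
       ring. }
  eapply Rle_trans; [apply Cmod_triangle|]; rewrite !Cmod_mult.
  assert (A1 := Cmod_cexp_le (q * RtoC L)).
  assert (A2 := cexp_taylor_le ((p - q) * RtoC L)).
  assert (A3 := cexp_sub_1_le (q * RtoC L)).
  rewrite !Cmod_mult, !Cmod_R in *; fold l in A1, A2, A3 |- *.
  assert (Hpq := Cmod_sub_triangle p q).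
  set (P := Cmod p) in *; set (Q := Cmod q) in *; set (D := Cmod (p - q)) in *.
  assert (HP : (0 <= P)%R) by apply Cmod_ge_0.
  assert (HQ : (0 <= Q)%R) by apply Cmod_ge_0.
  assert (HD : (0 <= D)%R) by apply Cmod_ge_0.
  assert (E1 : (exp (Q * l) <= exp l)%R) by (apply exp_le; nra).
  assert (E2 : (exp (D * l) <= exp (2 * l))%R) by (apply exp_le; nra).
  assert (E0 : (l <= exp l)%R) by apply le_exp_self.
  assert (E5 : (exp (5 * l) = exp l * exp l * (exp l * exp (2 * l)))%R).
  { rewrite <- !exp_plus; f_equal; ring. }
  assert (E21 : (exp l <= exp (2 * l))%R) by (apply exp_le; nra).
  assert (E11 : (1 <= exp l)%R) by (rewrite <- exp_0; apply exp_le; easy).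
  assert (B1 : (Cmod (cexp (q * RtoC L)) *
      Cmod (cexp ((p - q) * RtoC L) - 1 - (p - q) * RtoC L) <=
      exp l * (4 * (D * l * (D * l) * exp (2 * l))))%R).
  { apply Rmult_le_compat; try apply Cmod_ge_0; [lra|].
    eapply Rle_trans; [apply A2|]; apply Rmult_le_compat_l; [lra|].
    apply Rmult_le_compat_l; [|easy]; nra. }
  assert (B2 : (D * l * Cmod (cexp (q * RtoC L) - 1) <=
      D * l * (2 * (Q * l * exp l)))%R).
  { apply Rmult_le_compat_l; [nra|]; eapply Rle_trans; [apply A3|].
    apply Rmult_le_compat_l; [lra|]; apply Rmult_le_compat_l; [nra|easy]. }
  assert (L2 : (l * l <= exp l * exp l)%R) by (apply Rmult_le_compat; lra).
  set (X := (exp l * exp (2 * l))%R) in *.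
  assert (HX : (exp l <= X)%R) by (unfold X; nra).
  assert (C1 : (exp l * (4 * (D * l * (D * l) * exp (2 * l))) =
    4 * (D * D) * (l * l * X))%R) by (unfold X; ring).
  assert (F1 : (4 * (D * D) * (l * l * X) <= 4 * (D * (P + Q)) * exp (5 * l))%R).
  { apply Rmult_le_compat; nra. }
  assert (F2 : (2 * (D * Q) * (l * l * exp l) <= 2 * (D * (P + Q)) * exp (5 * l))%R).
  { apply Rmult_le_compat; nra. }
  assert (0 <= D * (P + Q) * exp (5 * l))%R by (apply Rmult_le_pos; nra).
  nra.
Qed.

(** [exp (M |ln t|)] dominates every power of [t] with exponent of modulus at most [M]. Half of the
    decay of [e^(-t)] absorbs it, and the other half remains for integration. *)
Lemma exp_log_le (x M : R) :
  (0 < x)%R -> (0 < M)%R -> exists A, (0 <= A)%R /\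
  forall t, (x <= t)%R -> (exp (M * Rabs (ln t)) * exp (- t) <= A * exp (- t / 2))%R.
Proof.
  intros Hx HM; exists (exp (M * Rabs (ln (2 * M)) + M * Rabs (ln x))).
  split; [left; apply exp_pos|]; intros t Ht.
  rewrite <- !exp_plus; apply exp_le.
  assert (H1 := Rabs_pos (ln (2 * M))); assert (H2 := Rabs_pos (ln x)).
  destruct (Rle_dec 1 t) as [H|H].
  - assert (Hl : (0 <= ln t)%R) by (rewrite <- ln_1; apply ln_le; lra).
    rewrite (Rabs_pos_eq (ln t)) by easy.
    (* From [y <= e^y] at [y = ln (t / (2 M))]; multiplied by [M] it costs exactly [t / 2]. *)
    assert (K : (ln t <= t / (2 * M) + ln (2 * M))%R).
    { assert (Hd : (0 < t / (2 * M))%R) by (apply Rdiv_lt_0_compat; lra).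
      replace t with (t / (2 * M) * (2 * M))%R at 1 by (field; lra).
      rewrite ln_mult by lra.
      assert (Y := le_exp_self (ln (t / (2 * M)))); rewrite exp_ln in Y by easy; lra. }
    assert (K2 := Rle_abs (ln (2 * M))).
    assert (K3 : (M * ln t <= M * (t / (2 * M) + Rabs (ln (2 * M))))%R)
      by (apply Rmult_le_compat_l; lra).
    replace (M * (t / (2 * M) + Rabs (ln (2 * M))))%R
      with (t / 2 + M * Rabs (ln (2 * M)))%R in K3 by (field; lra).
    nra.
  - assert (Hl : (ln t <= 0)%R) by (rewrite <- ln_1; apply ln_le; lra).
    assert (Hl2 : (ln x <= ln t)%R) by (apply ln_le; lra).
    rewrite (Rabs_left1 (ln t)), (Rabs_left1 (ln x)) by lra.
    nra.
Qed.

(** * Euler's integrand and the upper incomplete gamma function *)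

Definition euler_integrand (s : C) (t : R) : C := cpow t (s - 1) * cexp (- RtoC t).

Lemma cexp_opp_RtoC (t : R) : cexp (- RtoC t) = RtoC (exp (- t)).
Proof. rewrite <- RtoC_opp; apply cexp_RtoC. Qed.

Lemma dC_cexp_opp (t : R) : dC (fun u => cexp (- RtoC u)) t (- cexp (- RtoC t)).
Proof.
  rewrite cexp_opp_RtoC, <- RtoC_opp.
  apply dC_ext_loc with (fun u => RtoC (exp (- u))).
  { apply filter_forall; intros u; symmetry; apply cexp_opp_RtoC. }
  apply dC_RtoC; auto_derive; [easy|ring].
Qed.

Lemma smooth_pos_euler_integrand (s : C) : smooth_pos (euler_integrand s).
Proof.
  intros t Ht; eexists; apply dC_mult; [apply dC_cpow; easy|apply dC_cexp_opp].
Qed.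

Lemma smooth_pos_ln_euler_integrand (s : C) :
  smooth_pos (fun t => RtoC (ln t) * euler_integrand s t).
Proof.
  intros t Ht; destruct (smooth_pos_euler_integrand s t Ht) as [l Hl].
  eexists; apply dC_mult; [apply (dC_RtoC ln t (/ t))|exact Hl].
  auto_derive; [easy|ring].
Qed.

Lemma Cmod_euler_integrand_le (s : C) (t : R) :
  (0 < t)%R ->
  (Cmod (euler_integrand s t) <= exp ((Cmod s + 1) * Rabs (ln t)) * exp (- t))%R.
Proof.
  intros Ht; unfold euler_integrand.
  rewrite Cmod_mult, Cmod_cpow, cexp_opp_RtoC, Cmod_R, Rabs_pos_eq
    by (easy || left; apply exp_pos).
  apply Rmult_le_compat_r; [left; apply exp_pos|]; apply exp_le.
  eapply Rle_trans; [apply Rle_abs|]; rewrite Rabs_mult.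
  apply Rmult_le_compat_r; [apply Rabs_pos|].
  eapply Rle_trans; [apply re_le_Cmod|].
  eapply Rle_trans; [apply Cmod_sub_triangle|]; rewrite Cmod_1; lra.
Qed.

Lemma euler_integrand_bound (s : C) (x : R) :
  (0 < x)%R -> exists A,
  forall t, (x <= t)%R -> (Cmod (euler_integrand s t) <= A * exp (- t / 2))%R.
Proof.
  intros Hx; assert (Hs := Cmod_ge_0 s).
  destruct (exp_log_le x (Cmod s + 1)) as [A [_ HA]]; [easy|lra|].
  exists A; intros t Ht; eapply Rle_trans; [|apply HA, Ht].
  apply Cmod_euler_integrand_le; lra.
Qed.

(** Together with [tail_int_unique] this reduces identities for [upper_gamma] to exhibiting an
    antiderivative and its limit at infinity. *)
Lemma tail_int_upper_gamma (s : C) (x : R) :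
  (0 < x)%R -> tail_int (euler_integrand s) x (upper_gamma s x).
Proof.
  intros Hx; destruct (euler_integrand_bound s x Hx) as [A HA].
  destruct (tail_int_exists (euler_integrand s) x A) as [l Hl]; try easy.
  { apply smooth_pos_euler_integrand. }
  unfold upper_gamma; fold (euler_integrand s).
  rewrite (tail_int_CRInt (euler_integrand s) x l); easy.
Qed.

(** [D] selects the admissible pairs: off the diagonal for strict derivatives, nonzero second
    coordinate for joint limits in [(a, e)]. *)
Definition nearby (a b : C) (D : C -> C -> Prop) (P : C * C -> Prop) : Prop :=
  exists d : R, (0 < d)%R /\
  forall p q, (Cmod (p - a) < d)%R -> (Cmod (q - b) < d)%R -> D p q -> P (p, q).

#[global] Instance nearby_filter (a b : C) (D : C -> C -> Prop) : Filter (nearby a b D).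
Proof.
  split.
  - exists 1%R; split; [lra|easy].
  - intros P Q [d [Hd HP]] [e [He HQ]]; exists (Rmin d e); split.
    + apply Rmin_pos; easy.
    + intros p q Hp Hq HD; assert (X := Rmin_l d e); assert (Y := Rmin_r d e).
      split; [apply HP|apply HQ]; try easy; lra.
  - intros P Q H [d [Hd HP]]; exists d; split; [easy|auto].
Qed.

Lemma Cmod_sub_diag (a : C) : Cmod (a - a) = 0%R.
Proof. replace (a - a) with (RtoC 0) by ring; apply Cmod_0. Qed.

Definition offdiag (s : C) : (C * C -> Prop) -> Prop := nearby s s (fun p q => p <> q).

#[global] Instance offdiag_proper (s : C) : ProperFilter (offdiag s).
Proof.
  split; [|apply nearby_filter]; intros P [d [Hd HP]].
  destruct (small_shift s d Hd) as [w [Hw1 Hw2]].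
  exists (w, s); apply HP; try easy; rewrite Cmod_sub_diag; easy.
Qed.

(* Strict differentiability at [s], which for holomorphic functions amounts to
   differentiability near [s]. *)
Definition strict_deriv (f : C -> C) (s l : C) : Prop :=
  clim (offdiag s) (fun pq => (f (fst pq) - f (snd pq)) / (fst pq - snd pq)) l.

Lemma strict_deriv_derive (f : C -> C) (s l : C) :
  strict_deriv f s l ->
  clim (C_near' s) (fun w => (f w - f s) / (w - s)) l.
Proof.
  intros H e He; destruct (H e He) as [d [Hd HP]].
  apply locally'_C_ball; exists d; split; [easy|]; intros w Hw1 Hw2.
  apply (HP w s); try easy; rewrite Cmod_sub_diag; easy.
Qed.

Lemma derive_clim (f : C -> C) (s l : C) :
  clim (C_near' s) (fun w => (f w - f s) / (w - s)) l ->
  clim (C_near s) f (f s).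
Proof.
  intros H.
  assert (X : clim (C_near' s) f (f s + l * (s - s))).
  { apply clim_ext with (fun w => f s + (f w - f s) / (w - s) * (w - s)).
    - apply locally'_C_ball; exists 1%R; split; [lra|]; intros w Hw _.
      field; apply Cminus_eq_contra, Hw.
    - apply clim_plus; [apply clim_const|]; apply clim_mult; [easy|].
      apply clim_minus; [|apply clim_const].
      intros e He; apply locally'_C_ball; exists e; split; easy. }
  replace (f s + l * (s - s)) with (f s) in X by ring.
  intros e He; destruct (proj1 (locally'_C_ball _ _) (X e He)) as [d [Hd HP]].
  apply locally_C_ball; exists d; split; [easy|]; intros w Hw.
  destruct (excluded_middle_informative (w = s)) as [->|Hn]; [|auto].
  rewrite Cmod_sub_diag; easy.
Qed.

Lemma strict_deriv_plus (f g : C -> C) (s l m : C) :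
  strict_deriv f s l -> strict_deriv g s m -> strict_deriv (fun z => f z + g z) s (l + m).
Proof.
  intros Hf Hg; eapply clim_ext; [|apply (clim_plus _ _ _ _ Hf Hg)].
  apply filter_forall; intros pq; unfold Cdiv; ring.
Qed.

Lemma strict_deriv_ext_loc (f g : C -> C) (s l : C) :
  C_near s (fun z => f z = g z) ->
  strict_deriv f s l -> strict_deriv g s l.
Proof.
  intros H; apply clim_ext; apply locally_C_ball in H; destruct H as [d [Hd H]].
  exists d; split; [easy|]; intros p q Hp Hq _; simpl; rewrite !H; easy.
Qed.

(** Differentiation under the integral sign; the derivative is the integral of [ln t] times Euler's
    integrand. The remainder is the left side of [cexp_strict_le] at [(p - s, q - s)], multiplied by
    the integrand at [s]. *)
Lemma upper_gamma_strict_deriv (s : C) (x : R) :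
  (0 < x)%R -> exists l, strict_deriv (fun z => upper_gamma z x) s l.
Proof.
  intros Hx; assert (Hs := Cmod_ge_0 s).
  (* [Cmod s + 1] bounds the power [t^(s - 1)], and 5 is the exponent in [cexp_strict_le]. *)
  destruct (exp_log_le x (Cmod s + 1 + 5)) as [A [HA0 HA]]; [easy|lra|].
  destruct (tail_int_exists (fun t => RtoC (ln t) * euler_integrand s t) x A)
    as [l Hl]; [apply smooth_pos_ln_euler_integrand|easy| |].
  { intros t Ht; eapply Rle_trans; [|apply HA, Ht].
    rewrite Cmod_mult, Cmod_R.
    replace ((Cmod s + 1 + 5) * Rabs (ln t))%R
      with (5 * Rabs (ln t) + (Cmod s + 1) * Rabs (ln t))%R by ring.
    rewrite exp_plus, Rmult_assoc; apply Rmult_le_compat;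
      [apply Rabs_pos|apply Cmod_ge_0| |apply Cmod_euler_integrand_le; lra].
    eapply Rle_trans; [apply le_exp_self|]; apply exp_le.
    generalize (Rabs_pos (ln t)); lra. }
  exists l; intros e He.
  (* [144 = 4 * 18 * 2]: 4 from [tail_int_le], 18 from [cexp_strict_le], and 2 because [p] and [q]
     both lie within the radius of [s]. *)
  exists (Rmin 1 (e / (144 * A + 1))); split.
  { apply Rmin_pos; [lra|]; apply Rdiv_lt_0_compat; lra. }
  intros p q Hp Hq Hpq; simpl.
  assert (R1 := Rmin_l 1 (e / (144 * A + 1))); assert (R2 := Rmin_r 1 (e / (144 * A + 1))).
  assert (Hn : p - q <> 0) by (apply Cminus_eq_contra, Hpq).
  assert (K : (Cmod (upper_gamma p x - upper_gamma q x - (p - q) * l) <=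
    4 * (18 * Cmod (p - q) * (Cmod (p - s) + Cmod (q - s)) * A))%R).
  { apply (tail_int_le (fun t => euler_integrand p t - euler_integrand q t
      - (p - q) * (RtoC (ln t) * euler_integrand s t)) x); [easy| |].
    - apply tail_int_minus; [|apply tail_int_scal, Hl].
      apply tail_int_minus; apply tail_int_upper_gamma; easy.
    - intros t Ht; assert (Ht0 : (0 < t)%R) by lra.
      replace (euler_integrand p t - euler_integrand q t
        - (p - q) * (RtoC (ln t) * euler_integrand s t))
        with ((cexp ((p - s) * RtoC (ln t)) - cexp ((q - s) * RtoC (ln t))
          - ((p - s) - (q - s)) * RtoC (ln t)) * euler_integrand s t).
      2: { unfold euler_integrand.
           replace (p - 1) with ((s - 1) + (p - s)) by ring.
           replace (q - 1) with ((s - 1) + (q - s)) by ring.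
           rewrite !cpow_plus, !(cpow_pos _ (_ - s)) by easy; ring. }
      rewrite Cmod_mult.
      assert (X := cexp_strict_le (p - s) (q - s) (ln t) ltac:(lra) ltac:(lra)).
      replace (Cmod (p - s - (q - s))) with (Cmod (p - q)) in X by (f_equal; ring).
      assert (Y := Cmod_euler_integrand_le s t Ht0).
      specialize (HA t Ht).
      replace ((Cmod s + 1 + 5) * Rabs (ln t))%R
        with (5 * Rabs (ln t) + (Cmod s + 1) * Rabs (ln t))%R in HA by ring.
      rewrite exp_plus in HA.
      set (E5 := exp (5 * Rabs (ln t))) in *.
      set (K := (18 * Cmod (p - q) * (Cmod (p - s) + Cmod (q - s)))%R) in *.
      assert (HK : (0 <= K)%R).
      { unfold K; generalize (Cmod_ge_0 (p - q)) (Cmod_ge_0 (p - s)) (Cmod_ge_0 (q - s)).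
        intros; apply Rmult_le_pos; lra. }
      eapply Rle_trans;
        [apply Rmult_le_compat; [apply Cmod_ge_0|apply Cmod_ge_0|exact X|exact Y]|].
      apply (Rmult_le_compat_l K) in HA; [lra|easy]. }
  assert (Hd : (0 < Cmod (p - q))%R) by (apply Cmod_gt_0, Hn).
  replace ((upper_gamma p x - upper_gamma q x) / (p - q) - l)
    with ((upper_gamma p x - upper_gamma q x - (p - q) * l) / (p - q)) by (field; easy).
  rewrite Cmod_div by easy.
  apply Rmult_lt_reg_r with (Cmod (p - q)); [easy|].
  unfold Rdiv; rewrite Rmult_assoc, Rinv_l, Rmult_1_r by lra.
  eapply Rle_lt_trans; [exact K|].
  assert (S1 : (Cmod (p - s) + Cmod (q - s) <= 2 * (e / (144 * A + 1)))%R) by lra.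
  apply Rle_lt_trans with (72 * A * (2 * (e / (144 * A + 1))) * Cmod (p - q))%R.
  - replace (4 * (18 * Cmod (p - q) * (Cmod (p - s) + Cmod (q - s)) * A))%R
      with (72 * A * (Cmod (p - s) + Cmod (q - s)) * Cmod (p - q))%R by ring.
    apply Rmult_le_compat_r; [lra|]; apply Rmult_le_compat_l; [lra|easy].
  - apply Rmult_lt_compat_r; [easy|].
    apply Rmult_lt_reg_r with (144 * A + 1)%R; [lra|].
    replace (72 * A * (2 * (e / (144 * A + 1))) * (144 * A + 1))%R
      with (144 * A * e)%R by (field; lra).
    nra.
Qed.

(** * The Gamma function *)

Lemma Re_plus_INR_pos (s : C) (n : nat) :
  (0 < Re s)%R -> s + INR n <> 0.
Proof.
  intros Hs H; apply (f_equal Re) in H.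
  change (Re s + INR n = 0)%R in H; generalize (pos_INR n); lra.
Qed.

Lemma nonpole_add (s : C) (n : nat) : ~ nonpos_integer s -> s + INR n <> 0.
Proof.
  intros Hs H; apply Hs; exists n.
  replace s with (s + INR n - INR n) by ring; rewrite H; ring.
Qed.

Lemma nonpole_neq_0 (s : C) : ~ nonpos_integer s -> s <> 0.
Proof.
  intros Hs H; apply Hs; exists O; rewrite H; simpl; ring.
Qed.

Lemma nonpole_plus_INR (s : C) (n : nat) :
  ~ nonpos_integer s -> ~ nonpos_integer (s + INR n).
Proof.
  intros Hs [m Hm]; apply Hs; exists (n + m)%nat.
  rewrite plus_INR, RtoC_plus.
  replace s with (s + INR n - INR n) by ring; rewrite Hm; ring.
Qed.

Lemma nonpole_plus_1 (s : C) : ~ nonpos_integer s -> ~ nonpos_integer (s + 1).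
Proof. exact (nonpole_plus_INR s 1). Qed.

Lemma nonpole_Re_pos (s : C) : (0 < Re s)%R -> ~ nonpos_integer s.
Proof.
  intros Hs [n Hn]; apply (Re_plus_INR_pos s n Hs); rewrite Hn; ring.
Qed.

(** The linear growth in [n] serves twice: termwise for [1 / (s + n)], and multiplied up to bound
    Pochhammer products below by [d^n n!]. Finitely many [n] are handled by a minimum. *)
Lemma pole_distance (s : C) :
  ~ nonpos_integer s ->
  exists d : R, (0 < d)%R /\ forall n, (d * INR (S n) <= Cmod (s + INR n))%R.
Proof.
  intros Hs.
  assert (Hfin : forall J, exists d : R, (0 < d)%R /\
    forall n, (n < J)%nat -> (d * INR (S n) <= Cmod (s + INR n))%R).
  { induction J as [|J [d [Hd IH]]]; [exists 1%R; split; [lra|intros; lia]|].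
    assert (HJ : (0 < Cmod (s + INR J))%R) by (apply Cmod_gt_0, nonpole_add, Hs).
    assert (HS : (0 < INR (S J))%R) by (apply lt_0_INR; lia).
    set (c := (Cmod (s + INR J) / INR (S J))%R).
    assert (Hc : (0 < c)%R) by (apply Rdiv_lt_0_compat; easy).
    exists (Rmin d c); split; [apply Rmin_pos; easy|]; intros n Hn.
    assert (Hn0 := pos_INR (S n)).
    destruct (Nat.eq_dec n J) as [->|Hne].
    - apply Rle_trans with (c * INR (S J))%R.
      + apply Rmult_le_compat_r; [easy|apply Rmin_r].
      + unfold c; right; field; lra.
    - eapply Rle_trans; [|apply IH; lia].
      apply Rmult_le_compat_r; [easy|apply Rmin_l]. }
  (* For [n >= 2 |s| + 1] one has [|s + n| >= n - |s| >= (n + 1) / 2]. *)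
  destruct (INR_unbounded (2 * Cmod s + 1)) as [J HJ].
  destruct (Hfin J) as [d [Hd H]].
  exists (Rmin d (1 / 2)); split; [apply Rmin_pos; lra|]; intros n.
  assert (Hn0 := pos_INR (S n)).
  destruct (le_lt_dec J n) as [Hn|Hn].
  - apply Rle_trans with (1 / 2 * INR (S n))%R.
    { apply Rmult_le_compat_r; [easy|apply Rmin_r]. }
    apply le_INR in Hn.
    assert (X := Cmod_ge_dist (s + INR n) (RtoC (INR n))).
    replace (s + INR n - INR n) with s in X by ring.
    rewrite Cmod_R, Rabs_pos_eq in X by apply pos_INR.
    rewrite S_INR; lra.
  - eapply Rle_trans; [|apply H, Hn].
    apply Rmult_le_compat_r; [easy|apply Rmin_l].
Qed.

(** Moving [s] by less than [d / 2] costs at most half of [d (n + 1)], so one constant serves a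
    whole disc. This is the uniformity that majorants need. *)
Lemma pole_distance_nearby (s : C) :
  ~ nonpos_integer s ->
  exists d : R, (0 < d)%R /\ forall w, (Cmod (w - s) < d)%R ->
  forall n, (d * INR (S n) <= Cmod (w + INR n))%R.
Proof.
  intros Hs; destruct (pole_distance s Hs) as [d [Hd H]].
  exists (d / 2)%R; split; [lra|]; intros w Hw n; specialize (H n).
  assert (X := Cmod_ge_dist (w + INR n) (s + INR n)).
  replace (w + INR n - (s + INR n)) with (w - s) in X by ring.
  assert (Y := pos_INR n); rewrite S_INR in *; nra.
Qed.

Lemma nonpole_of_distance (w : C) (d : R) :
  (0 < d)%R -> (forall n, (d * INR (S n) <= Cmod (w + INR n))%R) ->
  ~ nonpos_integer w.
Proof.
  intros Hd H [n Hn]; specialize (H n); rewrite Hn in H.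
  replace (- INR n + INR n) with (RtoC 0) in H by ring.
  rewrite Cmod_0 in H; assert (X : (0 < INR (S n))%R) by (apply lt_0_INR; lia).
  nra.
Qed.

Lemma nonpole_nearby (s : C) :
  ~ nonpos_integer s ->
  C_near s (fun w => ~ nonpos_integer w).
Proof.
  intros Hs; destruct (pole_distance_nearby s Hs) as [d [Hd H]].
  apply locally_C_ball; exists d; split; [easy|]; intros w Hw.
  apply (nonpole_of_distance w d Hd), H, Hw.
Qed.

(* [x ^ s * gamma_series s (- x)] is the lower incomplete gamma function. *)
Definition gamma_series (s : C) (t : R) : C :=
  CSeries (fun n => RtoC (t ^ n / INR (fact n)) / (s + INR n)).

Lemma gamma_series_term_le (s : C) (t d : R) (n : nat) :
  (0 < d)%R -> (forall k, (d * INR (S k) <= Cmod (s + INR k))%R) ->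
  (Cmod (RtoC (t ^ n / INR (fact n)) / (s + INR n)) <=
    / d * (Rabs t ^ n / INR (fact n)))%R.
Proof.
  intros Hd H.
  assert (Hf : (0 < INR (fact n))%R) by apply INR_fact_lt_0.
  assert (H1 : (d <= Cmod (s + INR n))%R).
  { eapply Rle_trans; [|apply H]; assert (Y := pos_INR n); rewrite S_INR; nra. }
  rewrite Cmod_div, Cmod_R by (apply Cmod_gt_0; lra).
  unfold Rdiv; rewrite Rabs_mult, Rabs_inv, (Rabs_pos_eq (INR (fact n))), <- RPow_abs by lra.
  rewrite Rmult_comm; apply Rmult_le_compat_r.
  - apply Rmult_le_pos; [apply pow_le, Rabs_pos|left; apply Rinv_0_lt_compat, Hf].
  - apply Rinv_le_contravar; easy.
Qed.

Lemma asum_gamma_series (s : C) (t : R) :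
  ~ nonpos_integer s ->
  asum (fun n => RtoC (t ^ n / INR (fact n)) / (s + INR n)).
Proof.
  intros Hs; destruct (pole_distance s Hs) as [d [Hd H]].
  eapply asum_le; [intros n; apply (gamma_series_term_le s t d n Hd H)|].
  apply ex_series_exp_bound.
Qed.

(** The terms [c n * x ^ n] tend to 0 for every [x], which a finite radius of convergence excludes
    outside the disk. *)
Lemma CV_radius_entire (c : nat -> R) (A : R) :
  (forall n, Rabs (c n) <= A / INR (fact n))%R -> CV_radius c = p_infty.
Proof.
  intros H.
  assert (Hlim : forall x, is_lim_seq (fun n => c n * x ^ n)%R 0).
  { intros x; apply ex_series_lim_0.
    apply (ex_series_le (K := R_AbsRing) (V := R_CompleteNormedModule) _
      (fun n => A * (Rabs x ^ n / INR (fact n)))%R); [|apply ex_series_exp_bound].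
    intros n; change (Rabs (c n * x ^ n) <= A * (Rabs x ^ n / INR (fact n)))%R.
    rewrite Rabs_mult, <- RPow_abs.
    replace (A * (Rabs x ^ n / INR (fact n)))%R
      with (A / INR (fact n) * Rabs x ^ n)%R by (unfold Rdiv; ring).
    apply Rmult_le_compat_r; [apply pow_le, Rabs_pos|apply H]. }
  assert (H0 := CV_radius_ge_0 c).
  destruct (CV_radius c) as [r| |] eqn:E; [exfalso|easy|easy].
  simpl in H0; apply (CV_disk_outside c (r + 1)); [|apply Hlim].
  rewrite E; simpl; rewrite Rabs_pos_eq; lra.
Qed.

Lemma dC_power_series (c : nat -> C) (A t : R) :
  (forall n, Cmod (c n) <= A / INR (fact n))%R ->
  dC (fun u => CSeries (fun n => RtoC (u ^ n) * c n)) t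
    (CSeries (fun n => RtoC (t ^ n) * (RtoC (INR (S n)) * c (S n)))).
Proof.
  intros H.
  assert (K : forall b : nat -> R, (forall n, Rabs (b n) <= Cmod (c n))%R ->
    is_derive (PSeries b) t (PSeries (PS_derive b) t)).
  { intros b Hb; apply is_derive_PSeries; rewrite (CV_radius_entire b A); [exact I|].
    intros n; eapply Rle_trans; [apply Hb|apply H]. }
  split.
  - evar_last.
    + refine (is_derive_ext _ _ _ _ _ (K (fun n => Re (c n)) (fun n => re_le_Cmod _))).
      intros u; apply Series_ext; intros n; rewrite re_scal_l; ring.
    + apply Series_ext; intros n; unfold PS_derive; rewrite !re_scal_l; ring.
  - evar_last.
    + refine (is_derive_ext _ _ _ _ _ (K (fun n => Im (c n)) (fun n => Im_le_Cmod _))).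
      intros u; apply Series_ext; intros n; rewrite im_scal_l; ring.
    + apply Series_ext; intros n; unfold PS_derive; rewrite !im_scal_l; ring.
Qed.

(** Termwise: [n t^(n-1) / (n! (s + n))] becomes [t^m / (m! (s + 1 + m))] for [m = n - 1]. *)
Lemma dC_gamma_series (s : C) (t : R) :
  ~ nonpos_integer s -> dC (gamma_series s) t (gamma_series (s + 1) t).
Proof.
  intros Hs; destruct (pole_distance s Hs) as [d [Hd H]].
  set (c := fun n => / INR (fact n) / (s + INR n)).
  assert (Hfc : forall n, RtoC (INR (fact n)) <> 0).
  { intros n Hn; apply RtoC_inj in Hn; revert Hn; apply INR_fact_neq_0. }
  assert (X := dC_power_series c (/ d) t).
  replace (gamma_series (s + 1) t)
    with (CSeries (fun n => RtoC (t ^ n) * (RtoC (INR (S n)) * c (S n)))).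
  - apply dC_ext_loc with (fun u => CSeries (fun n => RtoC (u ^ n) * c n)).
    + apply filter_forall; intros u; apply CSeries_ext; intros n; unfold c.
      rewrite RtoC_div by apply INR_fact_neq_0.
      field; split; [apply Hfc|apply nonpole_add, Hs].
    + apply X; intros n.
      assert (Y := gamma_series_term_le s 1 d n Hd H).
      rewrite pow1, Rabs_R1, pow1, RtoC_div in Y by apply INR_fact_neq_0.
      unfold c; replace (/ INR (fact n)) with (RtoC 1 / INR (fact n))
        by (field; apply Hfc).
      unfold Rdiv in *; rewrite Rmult_1_l in Y; easy.
  - apply CSeries_ext; intros n; unfold c.
    rewrite RtoC_div by apply INR_fact_neq_0.
    change (fact (S n)) with (S n * fact n)%nat; rewrite mult_INR, RtoC_mult.
    assert (Hn : RtoC (INR (S n)) <> 0).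
    { intros Hn; apply RtoC_inj in Hn; revert Hn; apply not_0_INR; lia. }
    replace (s + INR (S n)) with (s + 1 + INR n)
      by (rewrite S_INR, RtoC_plus; ring).
    field; repeat split; try easy; apply nonpole_add, nonpole_plus_1, Hs.
Qed.

Lemma asum_exp (t : R) : asum (fun n => RtoC (t ^ n / INR (fact n))).
Proof.
  eapply asum_le; [|apply (ex_series_exp_bound 1 (Rabs t))].
  intros n; rewrite Cmod_R, Rmult_1_l; unfold Rdiv.
  rewrite Rabs_mult, Rabs_inv, (Rabs_pos_eq (INR (fact n))), <- RPow_abs by apply pos_INR.
  lra.
Qed.

Lemma CSeries_exp (t : R) :
  CSeries (fun n => RtoC (t ^ n / INR (fact n))) = RtoC (exp t).
Proof.
  unfold CSeries; apply C_ext; simpl.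
  - apply is_series_unique; generalize (is_exp_Reals t); apply is_series_ext.
    intros n; rewrite pow_n_pow; reflexivity.
  - rewrite (Series_ext _ (fun _ => 0 * 0)%R) by (intros; ring).
    rewrite Series_scal_l; ring.
Qed.

(** Termwise this is [s / (s + n) + n / (s + n) = 1]; the second part, whose term at [n = 0]
    vanishes, is the shifted series times [t]. *)
Lemma gamma_series_recurrence (s : C) (t : R) :
  ~ nonpos_integer s ->
  s * gamma_series s t + RtoC t * gamma_series (s + 1) t = RtoC (exp t).
Proof.
  intros Hs; rewrite <- CSeries_exp.
  assert (A0 := asum_gamma_series s t Hs).
  assert (A1 := asum_gamma_series (s + 1) t (nonpole_plus_1 s Hs)).
  assert (A2 : asum (fun n => RtoC (t ^ n / INR (fact n)) * INR n
    / (s + INR n))).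
  { eapply asum_ext;
      [|apply (asum_plus _ _ (asum_exp t) (asum_scal (- s) _ A0))].
    intros n; simpl; field; apply nonpole_add, Hs. }
  replace (RtoC t * gamma_series (s + 1) t) with
    (CSeries (fun n => RtoC (t ^ n / INR (fact n)) * INR n
      / (s + INR n))).
  - unfold gamma_series.
    rewrite <- (CSeries_scal s _ A0), <- (CSeries_plus _ _ (asum_scal s _ A0) A2).
    apply CSeries_ext; intros n; field; apply nonpole_add, Hs.
  - rewrite CSeries_S by easy; simpl INR at 2.
    replace (RtoC (t ^ 0 / INR (fact 0)) * 0 / (s + INR 0)) with (RtoC 0)
      by (unfold Cdiv; rewrite Cmult_0_r, Cmult_0_l; reflexivity).
    rewrite Cplus_0_l; unfold gamma_series; rewrite <- CSeries_scal by easy.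
    apply CSeries_ext; intros n.
    replace (s + INR (S n)) with (s + 1 + INR n)
      by (rewrite S_INR, RtoC_plus; ring).
    replace (RtoC (t ^ S n / INR (fact (S n))) * INR (S n))
      with (RtoC t * RtoC (t ^ n / INR (fact n))).
    + field; apply nonpole_add, nonpole_plus_1, Hs.
    + rewrite <- !RtoC_mult; f_equal.
      change (fact (S n)) with (S n * fact n)%nat; rewrite mult_INR; simpl pow.
      field; split; [apply INR_fact_neq_0|apply not_0_INR; lia].
Qed.

(** [k = -1] yields Euler's integrand, [k = x] that of [gamma(nu, - x)]. The recurrence recombines
    the two terms of the product rule. *)
Lemma dC_cpow_gamma_series (s : C) (k t : R) :
  ~ nonpos_integer s -> (0 < t)%R ->
  dC (fun u : R => cpow u s * gamma_series s (k * u)) t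
    (cpow t (s - 1) * RtoC (exp (k * t))).
Proof.
  intros Hs Ht; rewrite <- (gamma_series_recurrence s (k * t) Hs).
  assert (X : dC (fun u => gamma_series s (k * u)) t
    (RtoC k * gamma_series (s + 1) (k * t))).
  { apply (dC_comp_real (gamma_series s) (fun u => k * u)%R);
      [apply dC_gamma_series, Hs|auto_derive; [easy|ring]]. }
  assert (Y := dC_mult _ _ _ _ _ (dC_cpow s t Ht) X); cbv beta in Y.
  replace (cpow t (s - 1) * (s * gamma_series s (k * t) +
    RtoC (k * t) * gamma_series (s + 1) (k * t))) with
    (s * cpow t (s - 1) * gamma_series s (k * t) +
      cpow t s * (RtoC k * gamma_series (s + 1) (k * t))); [exact Y|].
  replace (cpow t s) with (cpow t (s - 1) * RtoC t).
  - rewrite RtoC_mult; ring.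
  - rewrite <- (cpow_1 t Ht) at 2; rewrite <- cpow_plus by easy; f_equal; ring.
Qed.

Lemma dC_lower (s : C) (t : R) :
  ~ nonpos_integer s -> (0 < t)%R ->
  dC (fun u : R => cpow u s * gamma_series s (- u)) t (euler_integrand s t).
Proof.
  intros Hs Ht; assert (X := dC_cpow_gamma_series s (-1) t Hs Ht).
  unfold euler_integrand; rewrite cexp_opp_RtoC.
  replace (- t)%R with (-1 * t)%R by ring; revert X; apply dC_ext_loc.
  apply filter_forall; intros u; do 2 f_equal; ring.
Qed.

Lemma clim_cpow_0 (s : C) :
  (0 < Re s)%R -> clim (at_right 0) (fun t : R => cpow t s) 0.
Proof.
  intros Hs e He; exists (mkposreal _ (exp_pos (ln e / Re s))); intros t Ht Ht0.
  change (Rabs (t - 0) < exp (ln e / Re s))%R in Ht.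
  rewrite Rminus_0_r, Rabs_pos_eq in Ht by lra.
  replace (cpow t s - 0) with (cpow t s) by ring.
  rewrite Cmod_cpow by easy.
  rewrite <- (exp_ln e He); apply exp_increasing.
  apply ln_increasing in Ht; [|easy]; rewrite ln_exp in Ht.
  apply (Rmult_lt_compat_l (Re s)) in Ht; [|easy].
  replace (Re s * (ln e / Re s))%R with (ln e) in Ht by (field; lra); easy.
Qed.

Lemma clim_cpow_gamma_series_0 (s : C) (k : R) :
  (0 < Re s)%R ->
  clim (at_right 0) (fun t : R => cpow t s * gamma_series s (k * t)) 0.
Proof.
  intros Hs; replace (RtoC 0) with (0 * gamma_series s (k * 0)) by ring.
  apply clim_mult; [apply clim_cpow_0, Hs|].
  assert (X : dC (fun u => gamma_series s (k * u)) 0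
    (RtoC k * gamma_series (s + 1) (k * 0))).
  { apply (dC_comp_real (gamma_series s) (fun u => k * u)%R);
      [apply dC_gamma_series, nonpole_Re_pos, Hs|auto_derive; [easy|ring]]. }
  intros e He; generalize (dC_clim _ _ _ X e He).
  intros [d Hd]; exists d; intros t Ht _; apply Hd, Ht.
Qed.

Lemma clim_lower_infty (s : C) (x : R) :
  ~ nonpos_integer s -> (0 < x)%R ->
  clim (Rbar_locally p_infty) (fun t : R => cpow t s * gamma_series s (- t))
    (cpow x s * gamma_series s (- x) + upper_gamma s x).
Proof.
  intros Hs Hx; destruct (euler_integrand_bound s x Hx) as [A HA].
  set (G := fun t : R => cpow t s * gamma_series s (- t)).
  assert (HG : forall t, (0 < t)%R -> dC G t (euler_integrand s t))
    by exact (fun t Ht => dC_lower s t Hs Ht).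
  destruct (antiderivative_tail_cvg _ G x A HG Hx HA) as [L HL].
  assert (E : upper_gamma s x = L - G x).
  { apply (tail_int_unique (euler_integrand s) x); try easy;
      [apply tail_int_upper_gamma, Hx|].
    split; [apply smooth_pos_euler_integrand|]; exists G, L; easy. }
  change (clim (Rbar_locally p_infty) G (G x + upper_gamma s x)).
  rewrite E; replace (G x + (L - G x)) with L by ring; easy.
Qed.

(** The antiderivative [t^s h s (- t)] vanishes at [0+], and its limit at infinity has already been
    expressed through any cut point [x]. *)
Lemma Gamma_integral_split (s : C) (x : R) :
  (0 < Re s)%R -> (0 < x)%R ->
  Gamma_integral s = cpow x s * gamma_series s (- x) + upper_gamma s x.
Proof.
  intros Hs Hx; assert (Hn := nonpole_Re_pos s Hs).
  unfold Gamma_integral, CRInt_gen.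
  apply (is_RInt_gen_unique (V := C_R_CompleteNormedModule)).
  rewrite <- (Cplus_0_r (_ + _)), <- Copp_0.
  apply (CRInt_gen_antiderivative (euler_integrand s)
    (fun t : R => cpow t s * gamma_series s (- t))).
  - apply at_right_proper_filter.
  - apply Rbar_locally_filter.
  - apply smooth_pos_euler_integrand.
  - intros t Ht; apply dC_lower; easy.
  - apply at_right_pos.
  - apply p_infty_pos.
  - eapply clim_ext; [|apply (clim_cpow_gamma_series_0 s (-1) Hs)].
    apply filter_forall; intros t; do 2 f_equal; ring.
  - apply clim_lower_infty; easy.
Qed.

(** Integration by parts: [- t^s e^(-t)] has derivative [t^s e^(-t) - s t^(s-1) e^(-t)]. *)
Lemma upper_gamma_recurrence (s : C) (x : R) :
  (0 < x)%R ->
  upper_gamma (s + 1) x = s * upper_gamma s x + cpow x s * cexp (- RtoC x).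
Proof.
  intros Hx.
  assert (H : upper_gamma (s + 1) x - s * upper_gamma s x =
    0 - (- (1)) * euler_integrand (s + 1) x).
  - apply (tail_int_unique
      (fun t => euler_integrand (s + 1) t - s * euler_integrand s t) x); [easy| |].
    + apply tail_int_minus; [|apply tail_int_scal]; apply tail_int_upper_gamma, Hx.
    + split.
      * intros t Ht; destruct (smooth_pos_euler_integrand (s + 1) t Ht) as [a Ha].
        destruct (smooth_pos_euler_integrand s t Ht) as [b Hb].
        exists (a - s * b); apply dC_minus; [|apply dC_scal]; easy.
      * exists (fun t => (- (1)) * euler_integrand (s + 1) t), 0.
        split; [|split; [|easy]].
        -- intros t Ht.
           assert (X := dC_mult _ _ _ _ _ (dC_cpow (s + 1 - 1) t Ht) (dC_cexp_opp t)).
           cbv beta in X; apply (dC_scal (- (1))) in X.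
           replace (euler_integrand (s + 1) t - s * euler_integrand s t)
             with (- (1) * ((s + 1 - 1) * cpow t (s + 1 - 1 - 1) *
               cexp (- RtoC t) + cpow t (s + 1 - 1) * - cexp (- RtoC t)));
             [exact X|].
           unfold euler_integrand; replace (s + 1 - 1) with s by ring; ring.
        -- replace (RtoC 0) with (- (1) * 0) by ring.
           apply clim_mult; [apply clim_const|].
           destruct (euler_integrand_bound (s + 1) x Hx) as [A HA]; intros e He.
           assert (HA0 := bound_coef_nonneg _ _ _ (HA x (Rle_refl x))).
           exists (Rmax x (-2 * ln (e / (A + 1))))%R; intros t Ht.
           assert (R1 := Rmax_l x (-2 * ln (e / (A + 1)))).
           assert (R2 := Rmax_r x (-2 * ln (e / (A + 1)))).
           replace (euler_integrand (s + 1) t - 0) with (euler_integrand (s + 1) t) by ring.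
           eapply Rle_lt_trans; [apply HA; lra|].
           assert (Hp : (0 < e / (A + 1))%R) by (apply Rdiv_lt_0_compat; lra).
           assert (X : (exp (- t / 2) < e / (A + 1))%R).
           { rewrite <- (exp_ln _ Hp); apply exp_increasing; lra. }
           apply Rle_lt_trans with (A * (e / (A + 1)))%R; [nra|].
           apply Rmult_lt_reg_r with (A + 1)%R; [lra|].
           replace (A * (e / (A + 1)) * (A + 1))%R with (A * e)%R by (field; lra); nra.
  - unfold euler_integrand in H; replace (s + 1 - 1) with s in H by ring.
    replace (upper_gamma (s + 1) x) with
      (upper_gamma (s + 1) x - s * upper_gamma s x + s * upper_gamma s x) by ring.
    rewrite H; ring.
Qed.

Lemma lower_plus_upper_recurrence (s : C) (x : R) :
  ~ nonpos_integer s -> (0 < x)%R ->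
  cpow x (s + 1) * gamma_series (s + 1) (- x) + upper_gamma (s + 1) x =
  s * (cpow x s * gamma_series s (- x) + upper_gamma s x).
Proof.
  intros Hs Hx; rewrite upper_gamma_recurrence, cpow_plus, cpow_1, cexp_opp_RtoC by easy.
  rewrite <- (gamma_series_recurrence s (- x) Hs), RtoC_opp; ring.
Qed.

Lemma rising_neq_0 (s : C) (n : nat) : ~ nonpos_integer s -> rising s n <> 0.
Proof.
  intros Hs; induction n as [|n IH]; simpl; [apply C1_nz|].
  apply Cmult_neq_0; [easy|apply nonpole_add, Hs].
Qed.

Lemma Gamma_shift_spec (z : C) : (0 < Re (z + INR (Gamma_shift z)))%R.
Proof.
  change (0 < Re z + INR (Gamma_shift z))%R; unfold Gamma_shift.
  destruct (archimed (- Re z)) as [H _].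
  destruct (Z_le_gt_dec 0 (up (- Re z))) as [Hz|Hz].
  - rewrite INR_IZR_INZ, Z2Nat.id by easy; lra.
  - assert (X : (IZR (up (- Re z)) <= 0)%R) by (apply IZR_le; lia).
    generalize (pos_INR (Z.to_nat (up (- Re z)))); lra.
Qed.

(** The right side obeys the recurrence of Gamma off the poles. At the shifted point it is Euler's
    integral, and dividing by [rising] brings it back to [z]. *)
Lemma Gamma_split (z : C) (x : R) :
  ~ nonpos_integer z -> (0 < x)%R ->
  Gamma z = cpow x z * gamma_series z (- x) + upper_gamma z x.
Proof.
  intros Hz Hx; unfold Gamma.
  rewrite (Gamma_integral_split _ x (Gamma_shift_spec z) Hx).
  set (g := fun s => cpow x s * gamma_series s (- x) + upper_gamma s x).
  assert (H : forall n, g (z + INR n) = rising z n * g z).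
  { induction n as [|n IH]; [simpl; rewrite Cplus_0_r; ring|].
    rewrite S_INR, RtoC_plus, Cplus_assoc; unfold g at 1.
    rewrite lower_plus_upper_recurrence by (try apply nonpole_plus_INR; easy).
    fold (g (z + INR n)); rewrite IH; simpl; ring. }
  change (g (z + INR (Gamma_shift z)) / rising z (Gamma_shift z) = g z).
  rewrite H; field; apply rising_neq_0, Hz.
Qed.

Lemma Gamma_recurrence (z : C) : ~ nonpos_integer z -> Gamma (z + 1) = z * Gamma z.
Proof.
  intros Hz; rewrite (Gamma_split z 1), (Gamma_split (z + 1) 1)
    by (try apply nonpole_plus_1; easy || lra).
  apply lower_plus_upper_recurrence; [easy|lra].
Qed.

Lemma Gamma_plus_INR (z : C) (n : nat) :
  ~ nonpos_integer z -> Gamma (z + INR n) = rising z n * Gamma z.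
Proof.
  intros Hz; induction n as [|n IH]; [simpl; rewrite Cplus_0_r; ring|].
  rewrite S_INR, RtoC_plus, Cplus_assoc, Gamma_recurrence
    by (apply nonpole_plus_INR, Hz).
  rewrite IH; simpl; ring.
Qed.

Lemma clim_offdiag_fst (s : C) : clim (offdiag s) (fun pq => fst pq) s.
Proof. intros e He; exists e; split; [easy|]; intros p q Hp _ _; exact Hp. Qed.

Lemma clim_offdiag_snd (s : C) : clim (offdiag s) (fun pq => snd pq) s.
Proof. intros e He; exists e; split; [easy|]; intros p q _ Hq _; exact Hq. Qed.

(** The quotient of [1 / (s + n)] over a pair is exactly [- 1 / ((p + n) (q + n))], which [tannery]
    sums in the limit. *)
Lemma gamma_series_strict_deriv (s : C) (t : R) :
  ~ nonpos_integer s -> exists l, strict_deriv (fun z => gamma_series z t) s l.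
Proof.
  intros Hs; destruct (pole_distance_nearby s Hs) as [d [Hd H]].
  exists (CSeries (fun n => - (RtoC (t ^ n / INR (fact n))
    / ((s + INR n) * (s + INR n))))).
  eapply clim_ext with (f := fun pq => CSeries (fun n => - (RtoC (t ^ n / INR (fact n))
    / ((fst pq + INR n) * (snd pq + INR n))))).
  { exists d; split; [easy|]; intros p q Hp Hq Hpq; simpl.
    assert (Np := nonpole_of_distance p d Hd (H p Hp)).
    assert (Nq := nonpole_of_distance q d Hd (H q Hq)).
    unfold gamma_series; rewrite <- CSeries_minus by (apply asum_gamma_series; easy).
    unfold Cdiv at 2; rewrite Cmult_comm, <- CSeries_scal.
    - apply CSeries_ext; intros n; field.
      repeat split; try (apply nonpole_add; easy).
      apply Cminus_eq_contra, Hpq.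
    - eapply asum_ext; [|exact (asum_plus _ _ (asum_gamma_series p t Np)
        (asum_scal (- (1)) _ (asum_gamma_series q t Nq)))].
      intros n; simpl; ring. }
  apply tannery with (fun n => / d * / d * (Rabs t ^ n / INR (fact n)))%R.
  - intros n; apply clim_opp, clim_div.
    + apply Cmult_neq_0; apply nonpole_add, Hs.
    + apply clim_const.
    + apply clim_mult; apply clim_plus; try apply clim_const;
        [apply clim_offdiag_fst|apply clim_offdiag_snd].
  - exists d; split; [easy|]; intros p q Hp Hq _ n; simpl fst; simpl snd.
    assert (Np := nonpole_of_distance p d Hd (H p Hp)).
    assert (Nq := nonpole_of_distance q d Hd (H q Hq)).
    rewrite Cmod_opp.
    replace (RtoC (t ^ n / INR (fact n)) / ((p + INR n) * (q + INR n)))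
      with (/ (p + INR n) * (RtoC (t ^ n / INR (fact n)) / (q + INR n)))
      by (field; split; apply nonpole_add; easy).
    rewrite Cmod_mult, Rmult_assoc.
    apply Rmult_le_compat; try apply Cmod_ge_0.
    + rewrite Cmod_inv by (apply nonpole_add; easy).
      apply Rinv_le_contravar; [easy|].
      eapply Rle_trans; [|apply (H p Hp n)].
      assert (Y := pos_INR n); rewrite S_INR; nra.
    + apply gamma_series_term_le; auto.
  - apply ex_series_exp_bound.
Qed.

Lemma Gamma_strict_deriv (z : C) :
  ~ nonpos_integer z -> exists l, strict_deriv Gamma z l.
Proof.
  (* The cut point is 1 because the power [1^z] is constantly 1 there. *)
  intros Hz; destruct (gamma_series_strict_deriv z (Ropp 1) Hz) as [l Hl].
  destruct (upper_gamma_strict_deriv z 1 ltac:(lra)) as [m Hm].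
  exists (l + m); eapply strict_deriv_ext_loc; [|apply (strict_deriv_plus _ _ _ _ _ Hl Hm)].
  generalize (nonpole_nearby z Hz); apply filter_imp; intros w Hw.
  rewrite (Gamma_split w 1) by (easy || lra).
  rewrite cpow_pos, ln_1, Cmult_0_r, cexp_0 by lra; ring.
Qed.

(** * Nonvanishing of Gamma *)

Lemma square_le_cosh (y : R) : (y * y <= exp y - 2 + exp (- y))%R.
Proof.
  (* Two integrations from 0, starting at [e^t + e^(-t) >= 2]; negative [y] follow by symmetry. *)
  assert (H : forall z, (0 <= z)%R -> (z * z <= exp z - 2 + exp (- z))%R).
  { assert (H1 : forall z, (0 <= z)%R -> (2 * z <= exp z - exp (- z))%R).
    { intros z Hz.
      assert (X := real_increment_le (fun t => 2 * t)%R (fun t => exp t - exp (- t))%R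
        (fun _ => 2)%R (fun t => exp t + exp (- t))%R 0 z Hz).
      cbv beta in X; rewrite Ropp_0, exp_0 in X.
      cut (2 * z - 2 * 0 <= exp z - exp (- z) - (1 - 1))%R; [lra|]; apply X.
      - intros t _; auto_derive; [easy|ring].
      - intros t _; auto_derive; [easy|ring].
      - intros t _; rewrite exp_Ropp; assert (P := exp_pos t).
        apply Rmult_le_reg_r with (exp t); [easy|].
        replace ((exp t + / exp t) * exp t)%R with (exp t * exp t + 1)%R by (field; lra).
        assert (Sq := Rle_0_sqr (exp t - 1)); unfold Rsqr in Sq; lra. }
    intros z Hz.
    assert (X := real_increment_le (fun t => t * t)%R (fun t => exp t - 2 + exp (- t))%R
      (fun t => 2 * t)%R (fun t => exp t - exp (- t))%R 0 z Hz).
    cbv beta in X; rewrite Ropp_0, exp_0 in X.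
    cut (z * z - 0 * 0 <= exp z - 2 + exp (- z) - (1 - 2 + 1))%R; [lra|]; apply X.
    - intros t _; auto_derive; [easy|ring].
    - intros t _; auto_derive; [easy|ring].
    - intros t Ht; apply H1; lra. }
  destruct (Rle_dec 0 y) as [Hy|Hy]; [apply H, Hy|].
  assert (X := H (- y)%R ltac:(lra)); rewrite Ropp_involutive in X; lra.
Qed.

Lemma cexp_imaginary_sub_1_le (y : R) :
  (Cmod (cexp (Ci * RtoC y) - 1) <= 2 * Rabs y)%R.
Proof.
  assert (X := dC_increment_le (fun u => cexp (RtoC u * (Ci * RtoC y)))
    (fun u => Ci * RtoC y * cexp (RtoC u * (Ci * RtoC y)))
    (fun u => Rabs y * u)%R (fun u => Rabs y)%R 0 1 ltac:(lra)).
  cbv beta in X.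
  replace (RtoC 0 * (Ci * RtoC y)) with (RtoC 0) in X by ring.
  replace (RtoC 1 * (Ci * RtoC y)) with (Ci * RtoC y) in X by ring.
  rewrite cexp_0 in X; eapply Rle_trans; [apply X|lra].
  - intros u _; apply dC_cexp_line.
  - intros u _; auto_derive; [easy|ring].
  - intros u _; rewrite !Cmod_mult, Cmod_Ci, Cmod_R, Cmod_cexp.
    replace (Re (RtoC u * (Ci * RtoC y))) with 0%R by (simpl; ring).
    rewrite exp_0; lra.
Qed.

Definition lower_series (s : C) (t : R) : C := cpow t s * gamma_series s (- t).

Lemma clim_lower_series_0 (s : C) :
  (0 < Re s)%R -> clim (at_right 0) (lower_series s) 0.
Proof.
  intros Hs; eapply clim_ext; [|apply (clim_cpow_gamma_series_0 s (-1) Hs)].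
  apply filter_forall; intros t; unfold lower_series; do 2 f_equal; ring.
Qed.

Lemma clim_lower_series_infty (s : C) :
  (0 < Re s)%R -> clim (Rbar_locally p_infty) (lower_series s) (Gamma s).
Proof.
  intros Hs; rewrite (Gamma_split s 1) by (try apply nonpole_Re_pos; easy || lra).
  apply clim_lower_infty; [apply nonpole_Re_pos; easy|lra].
Qed.

Lemma euler_integrand_real (s t : R) :
  (0 < t)%R -> euler_integrand (RtoC s) t = RtoC (exp ((s - 1) * ln t) * exp (- t)).
Proof.
  intros Ht; unfold euler_integrand; rewrite cpow_pos, cexp_opp_RtoC by easy.
  rewrite <- RtoC_minus, <- RtoC_mult, cexp_RtoC, <- RtoC_mult; reflexivity.
Qed.

Lemma clim_le {T : Type} {F : (T -> Prop) -> Prop} {FF : ProperFilter F}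
  (f g : T -> C) (l m : C) :
  clim F f l -> clim F g m -> F (fun p => Cmod (f p) <= Re (g p))%R ->
  (Cmod l <= Re m)%R.
Proof.
  intros Hf Hg H; apply Rnot_lt_le; intros Hn.
  assert (He : (0 < (Cmod l - Re m) / 2)%R) by lra.
  destruct (filter_ex _ (filter_and _ _ H (filter_and _ _ (Hf _ He) (Hg _ He))))
    as [p [H1 [H2 H3]]].
  assert (X := Cmod_ge_dist (f p) l).
  assert (Z := re_le_Cmod (g p - m)); apply Rabs_le_between in Z.
  change (Re (g p - m)) with (Re (g p) - Re m)%R in Z; lra.
Qed.

Lemma clim_increment (f : R -> C) (la lb : C) :
  clim (at_right 0) f la -> clim (Rbar_locally p_infty) f lb ->
  clim (filter_prod (at_right 0) (Rbar_locally p_infty))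
    (fun ab => f (snd ab) - f (fst ab)) (lb - la).
Proof.
  intros Ha Hb; apply clim_minus.
  - apply (clim_comp (G := Rbar_locally p_infty) snd f); [apply filterlim_snd|easy].
  - apply (clim_comp (G := at_right 0) fst f); [apply filterlim_fst|easy].
Qed.

(** The bounds 1 and 2 guarantee that [[a, b]] contains [[1, 2]], where [Gamma_real_pos] finds its
    positive mass. *)
Lemma filter_prod_half_line (P : R * R -> Prop) :
  (forall a b, (0 < a < 1)%R -> (2 < b)%R -> P (a, b)) ->
  filter_prod (at_right 0) (Rbar_locally p_infty) P.
Proof.
  apply (Filter_prod _ _ _ (fun a => 0 < a < 1)%R (fun b => 2 < b)%R).
  - exists (mkposreal 1 Rlt_0_1); intros t Ht Ht0.
    change (Rabs (t - 0) < 1)%R in Ht; apply Rabs_def2 in Ht; lra.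
  - exists 2%R; easy.
Qed.

(** The integrand is positive, and on [[1, 2]] it is at least [e^(-2)] since [s >= 1] gives
    [t^(s-1) >= 1] there. *)
Lemma Gamma_real_pos (s : R) : (1 <= s)%R -> (0 < Re (Gamma (RtoC s)))%R.
Proof.
  intros Hs; assert (Hs0 : (0 < Re (RtoC s))%R) by (simpl; lra).
  set (f := lower_series (RtoC s)).
  assert (Hf : forall t, (0 < t)%R ->
    is_derive (fun u => Re (f u)) t (exp ((s - 1) * ln t) * exp (- t))%R).
  { intros t Ht; assert (X := dC_lower (RtoC s) t (nonpole_Re_pos _ Hs0) Ht).
    rewrite euler_integrand_real in X by easy; apply X. }
  assert (Mono : forall a b, (0 < a <= b)%R -> (Re (f a) <= Re (f b))%R).
  { intros a b Hab.
    assert (X := real_increment_le (fun _ => 0)%R (fun u => Re (f u)) (fun _ => 0)%R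
      (fun t => exp ((s - 1) * ln t) * exp (- t))%R a b); cbv beta in X.
    cut (0 - 0 <= Re (f b) - Re (f a))%R; [lra|]; apply X; [lra| | |].
    - intros t _; auto_derive; easy.
    - intros t Ht; apply Hf; lra.
    - intros t _; apply Rmult_le_pos; left; apply exp_pos. }
  assert (G12 : (exp (- 2) <= Re (f 2) - Re (f 1))%R).
  { assert (X := real_increment_le (fun u => exp (- 2) * u)%R (fun u => Re (f u))
      (fun _ => exp (- 2))%R (fun t => exp ((s - 1) * ln t) * exp (- t))%R 1 2).
    cbv beta in X.
    cut (exp (- 2) * 2 - exp (- 2) * 1 <= Re (f 2) - Re (f 1))%R; [lra|].
    apply X; [lra| | |].
    - intros t _; auto_derive; [easy|ring].
    - intros t Ht; apply Hf; lra.
    - intros t Ht; rewrite <- (Rmult_1_l (exp (- 2))).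
      apply Rmult_le_compat; [lra|left; apply exp_pos| |apply exp_le; lra].
      rewrite <- exp_0 at 1; apply exp_le; apply Rmult_le_pos; [lra|].
      rewrite <- ln_1; apply ln_le; lra. }
  assert (E2 := exp_pos (- 2)).
  apply Rlt_le_trans with (Cmod (RtoC (exp (- 2)))).
  { rewrite Cmod_R, Rabs_pos_eq; lra. }
  replace (Gamma (RtoC s)) with (Gamma (RtoC s) - 0) by ring.
  apply (clim_le (F := filter_prod (at_right 0) (Rbar_locally p_infty))
    (fun _ => RtoC (exp (- 2))) (fun ab => f (snd ab) - f (fst ab))).
  - apply clim_const.
  - apply clim_increment; [apply clim_lower_series_0|apply clim_lower_series_infty]; easy.
  - apply filter_prod_half_line; intros a b Ha Hb.
    rewrite Cmod_R, Rabs_pos_eq by lra.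
    change (exp (- 2) <= Re (f b) - Re (f a))%R.
    generalize (Mono a 1%R ltac:(lra)) (Mono 2%R b ltac:(lra)); lra.
Qed.

(* With [w = sigma + i tau], the integrand of [sigma^(- i tau) Gamma w] differs
   from that of [Gamma sigma] by a factor [e^(i tau y)], [y = ln (t / sigma)],
   and [|e^(i tau y) - 1| <= 2 |tau y| <= 1/4 + 4 tau^2 (e^y - 2 + e^(-y))]
   integrates to [Gamma sigma * (1/4 + 4 tau^2 / (sigma - 1))]. *)
Lemma Gamma_neq_0_right (w : C) :
  (1 + 16 * (Im w * Im w) < Re w)%R -> Gamma w <> 0.
Proof.
  set (s := Re w); set (y := Im w); intros Hw H0.
  assert (Hy2 : (0 <= y * y)%R) by (generalize (Rle_0_sqr y); unfold Rsqr; lra).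
  assert (Ew : w = RtoC s + Ci * RtoC y)
    by (unfold s, y; destruct w; apply C_ext; simpl; ring).
  set (c := cexp (- (Ci * RtoC y) * RtoC (ln s))).
  assert (P0 : (0 < Re (RtoC s))%R) by (simpl; lra).
  assert (P1 : (0 < Re (RtoC (s + 1)))%R) by (simpl; lra).
  assert (P2 : (0 < Re (RtoC (s - 1)))%R) by (simpl; lra).
  (* The integral of the majorant, as a combination of Gamma at [s + 1], [s], [s - 1]: multiplying
     the integrand by [t] or [1 / t] shifts the parameter by one. *)
  set (lin := fun a b d : C =>
    / 4 * b + RtoC (4 * (y * y)) * (/ RtoC s * a + - (2) * b + RtoC s * d)).
  set (g := fun t => lin (lower_series (RtoC (s + 1)) t) (lower_series (RtoC s) t)
    (lower_series (RtoC (s - 1)) t)).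
  set (f := fun t => c * lower_series w t - lower_series (RtoC s) t).
  set (df := fun t => c * euler_integrand w t - euler_integrand (RtoC s) t).
  set (E := fun t => (exp ((s - 1) * ln t) * exp (- t))%R).
  set (dg := fun t => (E t * (/ 4 + 4 * (y * y) * (t / s - 2 + s / t)))%R).
  assert (Hdf : forall t, (0 < t)%R -> dC f t (df t)).
  { intros t Ht; apply dC_minus; [apply dC_scal|]; apply dC_lower; try easy;
      apply nonpole_Re_pos; easy. }
  assert (Hdg : forall t, (0 < t)%R -> is_derive (fun u => Re (g u)) t (dg t)).
  { intros t Ht.
    assert (X : dC g t (lin (euler_integrand (RtoC (s + 1)) t)
      (euler_integrand (RtoC s) t) (euler_integrand (RtoC (s - 1)) t))).
    { unfold g, lin; apply dC_plus; apply dC_scal.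
      - apply dC_lower; [apply nonpole_Re_pos|]; easy.
      - apply dC_plus; [apply dC_plus|]; apply dC_scal; apply dC_lower; try easy;
          apply nonpole_Re_pos; easy. }
    replace (dg t) with (Re (lin (euler_integrand (RtoC (s + 1)) t)
      (euler_integrand (RtoC s) t) (euler_integrand (RtoC (s - 1)) t))); [apply X|].
    rewrite !euler_integrand_real by easy.
    replace ((s + 1 - 1) * ln t)%R with ((s - 1) * ln t + ln t)%R by ring.
    replace ((s - 1 - 1) * ln t)%R with ((s - 1) * ln t + - ln t)%R by ring.
    rewrite !exp_plus, (exp_Ropp (ln t)), exp_ln by easy.
    unfold lin, dg; rewrite <- !RtoC_inv, <- !RtoC_opp by lra.
    rewrite <- !RtoC_mult, <- !RtoC_plus, <- !RtoC_mult, <- !RtoC_plus.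
    rewrite re_RtoC; unfold E; field; lra. }
  assert (Hle : forall t, (0 < t)%R -> (Cmod (df t) <= dg t)%R).
  { intros t Ht; unfold df, dg.
    replace (c * euler_integrand w t - euler_integrand (RtoC s) t) with
      (euler_integrand (RtoC s) t * (cexp (Ci * RtoC (y * (ln t - ln s))) - 1)).
    2: { unfold euler_integrand; rewrite Ew.
         replace (RtoC s + Ci * RtoC y - 1) with (RtoC s - 1 + Ci * RtoC y) by ring.
         rewrite cpow_plus, (cpow_pos t (Ci * RtoC y)) by easy.
         replace (cexp (Ci * RtoC (y * (ln t - ln s))))
           with (c * cexp (Ci * RtoC y * RtoC (ln t))); [ring|].
         unfold c; rewrite <- cexp_plus; f_equal.
         rewrite RtoC_mult, RtoC_minus; ring. }
    assert (HE : (0 < E t)%R) by (apply Rmult_lt_0_compat; apply exp_pos).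
    rewrite euler_integrand_real, Cmod_mult, Cmod_R by easy; fold (E t).
    rewrite Rabs_pos_eq by lra; apply Rmult_le_compat_l; [lra|].
    eapply Rle_trans; [apply cexp_imaginary_sub_1_le|].
    (* Replaces a squared logarithm by [t / s - 2 + s / t], whose integral is explicit. *)
    assert (X := square_le_cosh (ln t - ln s)).
    assert (Ee : (exp (ln t - ln s) = t / s)%R).
    { unfold Rminus; rewrite exp_plus, exp_Ropp, !exp_ln by lra; reflexivity. }
    rewrite exp_Ropp, Ee in X; replace (/ (t / s))%R with (s / t)%R in X by (field; lra).
    set (v := (ln t - ln s)%R) in *.
    rewrite Rabs_mult.
    assert (Sq := Rle_0_sqr (/ 2 - 2 * (Rabs y * Rabs v))); unfold Rsqr in Sq.
    assert (Y1 : (Rabs y * Rabs y = y * y)%R) by (rewrite <- Rabs_mult, Rabs_pos_eq; easy).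
    assert (Y2 : (Rabs v * Rabs v = v * v)%R).
    { rewrite <- Rabs_mult, Rabs_pos_eq; [easy|].
      generalize (Rle_0_sqr v); unfold Rsqr; lra. }
    assert (Y3 : (4 * (Rabs y * Rabs v * (Rabs y * Rabs v)) = 4 * (y * y) * (v * v))%R)
      by (rewrite <- Y1, <- Y2; ring).
    assert (Y4 : (4 * (y * y) * (v * v) <= 4 * (y * y) * (t / s - 2 + s / t))%R)
      by (apply Rmult_le_compat_l; lra).
    lra. }
  assert (Hs := Gamma_real_pos s ltac:(lra)).
  assert (Es1 : Gamma (RtoC (s + 1)) = RtoC s * Gamma (RtoC s)).
  { rewrite RtoC_plus; apply Gamma_recurrence, nonpole_Re_pos, P0. }
  assert (Es2 : Gamma (RtoC s) = RtoC (s - 1) * Gamma (RtoC (s - 1))).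
  { rewrite <- Gamma_recurrence by (apply nonpole_Re_pos, P2).
    f_equal; rewrite RtoC_minus; ring. }
  assert (K : (Cmod (c * Gamma w - Gamma (RtoC s) - (c * 0 - 0)) <=
    Re (2 * (lin (Gamma (RtoC (s + 1))) (Gamma (RtoC s)) (Gamma (RtoC (s - 1)))
      - lin 0 0 0)))%R).
  { apply (clim_le (F := filter_prod (at_right 0) (Rbar_locally p_infty))
      (fun ab => f (snd ab) - f (fst ab)) (fun ab => 2 * (g (snd ab) - g (fst ab)))).
    - apply clim_increment; (apply clim_minus; [apply clim_mult; [apply clim_const|]|]);
        (apply clim_lower_series_0 || apply clim_lower_series_infty); easy.
    - apply clim_mult; [apply clim_const|]; apply clim_increment; unfold g, lin;
        repeat first [apply clim_lower_series_0; easy | apply clim_lower_series_infty; easy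
          | apply clim_const | apply clim_plus | apply clim_mult].
    - apply filter_prod_half_line.
      intros a b Ha Hb; simpl fst; simpl snd.
        replace (Re (2 * (g b - g a))) with (2 * (Re (g b) - Re (g a)))%R
          by (rewrite re_scal_l; reflexivity).
        apply (dC_increment_le f df (fun t => Re (g t)) dg); [lra| | |];
          intros t Ht; [apply Hdf|apply Hdg|apply Hle]; lra. }
  rewrite H0 in K.
  replace (c * 0 - Gamma (RtoC s) - (c * 0 - 0)) with (- Gamma (RtoC s)) in K by ring.
  rewrite Cmod_opp in K.
  assert (Hns : RtoC (s - 1) <> 0) by (intros X; apply RtoC_inj in X; lra).
  assert (Hns0 : RtoC s <> 0) by (intros X; apply RtoC_inj in X; lra).
  replace (2 * (lin (Gamma (RtoC (s + 1))) (Gamma (RtoC s)) (Gamma (RtoC (s - 1)))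
      - lin 0 0 0)) with (RtoC (/ 2 + 8 * (y * y) / (s - 1)) * Gamma (RtoC s)) in K.
  - rewrite re_scal_l in K.
    assert (X := re_le_Cmod (Gamma (RtoC s))); apply Rabs_le_between in X.
    (* [dC_increment_le] has doubled the bound to [1/2 + 8 y^2 / (s - 1)]; the hypothesis keeps it
       below 1, so [|Gamma s| < Gamma s], a contradiction. *)
    assert (Y : (8 * (y * y) / (s - 1) < / 2)%R).
    { apply Rmult_lt_reg_r with (s - 1)%R; [lra|].
      unfold Rdiv; rewrite Rmult_assoc, Rinv_l, Rmult_1_r by lra; lra. }
    nra.
  - replace (Gamma (RtoC (s - 1))) with (Gamma (RtoC s) / RtoC (s - 1))
      by (rewrite Es2; field; easy).
    rewrite Es1; unfold lin, Rdiv.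
    rewrite RtoC_plus, !RtoC_mult, !RtoC_inv, RtoC_minus by lra.
    rewrite RtoC_minus in Hns; field; easy.
Qed.

(** A zero would propagate to every [z + n] by the recurrence, while large [n] enters the region of
    [Gamma_neq_0_right] because the imaginary part stays fixed. *)
Lemma Gamma_neq_0 (z : C) : ~ nonpos_integer z -> Gamma z <> 0.
Proof.
  intros Hz H0.
  destruct (INR_unbounded (1 + 16 * (Im z * Im z) - Re z)) as [n Hn].
  apply (Gamma_neq_0_right (z + INR n)).
  - change (Im (z + INR n)) with (Im z + 0)%R.
    change (Re (z + INR n)) with (Re z + INR n)%R; rewrite Rplus_0_r; lra.
  - rewrite Gamma_plus_INR, H0 by easy; ring.
Qed.

(** Cancelling [Gamma a] is where nonvanishing is used; from here on all Pochhammer symbols are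
    finite products. *)
Lemma pochhammer_rising (a : C) (n : nat) : pochhammer a n = rising a n.
Proof.
  unfold pochhammer; destruct excluded_middle_informative as [|Ha]; [easy|].
  rewrite Gamma_plus_INR by easy; field; apply Gamma_neq_0, Ha.
Qed.

Lemma rGamma_nonpole (z : C) : ~ nonpos_integer z -> rGamma z = / Gamma z.
Proof.
  intros Hz; unfold rGamma; destruct excluded_middle_informative; easy.
Qed.

Lemma rGamma_pole (z : C) : nonpos_integer z -> rGamma z = 0.
Proof.
  intros Hz; unfold rGamma; destruct excluded_middle_informative; easy.
Qed.

(** Valid at the poles as well: at [z = 0] the factor [z] vanishes, and for any other pole [z + 1]
    is again one. At [a - nu] it exposes the simple zero of [1 / Gamma(a - nu)]. *)
Lemma rGamma_recurrence (z : C) : rGamma z = z * rGamma (z + 1).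
Proof.
  destruct (excluded_middle_informative (nonpos_integer z)) as [Hz|Hz].
  - rewrite (rGamma_pole z Hz); destruct Hz as [[|n] ->].
    + simpl; ring.
    + rewrite rGamma_pole; [ring|]; exists n; rewrite S_INR, RtoC_plus; ring.
  - rewrite !rGamma_nonpole, Gamma_recurrence by (try apply nonpole_plus_1; easy).
    field; split; [apply Gamma_neq_0, Hz|apply nonpole_neq_0, Hz].
Qed.

Lemma rGamma_rising (z : C) (n : nat) : rGamma z = rising z n * rGamma (z + INR n).
Proof.
  induction n as [|n IH]; [simpl; rewrite Cplus_0_r; ring|].
  rewrite IH, rGamma_recurrence, S_INR, RtoC_plus, Cplus_assoc; simpl; ring.
Qed.

Lemma upper_gamma_1 (x : R) : (0 < x)%R -> upper_gamma 1 x = RtoC (exp (- x)).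
Proof.
  intros Hx; apply (tail_int_unique (euler_integrand 1) x); [easy| |].
  - apply tail_int_upper_gamma, Hx.
  - split; [apply smooth_pos_euler_integrand|].
    exists (fun t => (- (1)) * cexp (- RtoC t)), 0; split; [|split].
    + intros t Ht; assert (X := dC_scal (- (1)) _ _ _ (dC_cexp_opp t)).
      unfold euler_integrand; replace (1 - 1) with (RtoC 0) by ring.
      rewrite cpow_0_r by easy.
      replace (1 * cexp (- RtoC t)) with (- (1) * - cexp (- RtoC t)) by ring; easy.
    + intros e He; exists (- ln e)%R; intros t Ht.
      replace (- (1) * cexp (- RtoC t) - 0) with (- cexp (- RtoC t)) by ring.
      rewrite Cmod_opp, cexp_opp_RtoC, Cmod_R, Rabs_pos_eq by (left; apply exp_pos).
      rewrite <- (exp_ln e He); apply exp_increasing; lra.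
    + rewrite cexp_opp_RtoC; ring.
Qed.

(** The cut point of [Gamma_split] is sent to [0+]: the lower part vanishes and
    [Gamma(1, x) = e^(-x)] tends to 1. *)
Lemma Gamma_1 : Gamma 1 = 1.
Proof.
  assert (H1 : (0 < Re 1)%R) by (simpl; lra).
  apply (clim_unique (F := at_right 0) (fun _ => Gamma 1)); [apply clim_const|].
  apply clim_ext with (fun x => lower_series 1 x + RtoC (exp (- x))).
  - generalize at_right_pos; apply filter_imp; intros x Hx.
    rewrite (Gamma_split 1 x), upper_gamma_1 by (try apply nonpole_Re_pos; easy).
    reflexivity.
  - cut (clim (at_right 0) (fun x => lower_series 1 x + RtoC (exp (- x)))
      (0 + RtoC (exp (- 0)))); [rewrite Ropp_0, exp_0, Cplus_0_l; easy|].
    apply clim_plus; [apply clim_lower_series_0, H1|].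
    assert (X : dC (fun x => RtoC (exp (- x))) 0 (RtoC (- exp (- 0)))).
    { apply dC_RtoC; auto_derive; [easy|ring]. }
    intros e He; destruct (dC_clim _ _ _ X e He) as [d Hd]; exists d.
    intros t Ht _; apply Hd, Ht.
Qed.

(** * Series expansions *)

Lemma RtoC_neq_0 (r : R) : r <> 0%R -> RtoC r <> 0.
Proof. intros Hr H; apply Hr, RtoC_inj, H. Qed.

Lemma RtoC_fact_neq_0 (n : nat) : RtoC (INR (fact n)) <> 0.
Proof. apply RtoC_neq_0, INR_fact_neq_0. Qed.

Lemma RtoC_S_neq_0 (n : nat) : RtoC (INR (S n)) <> 0.
Proof. apply RtoC_neq_0, not_0_INR; lia. Qed.

Lemma RtoC_fact_S (n : nat) :
  RtoC (INR (fact (S n))) = RtoC (INR (S n)) * INR (fact n).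
Proof.
  change (fact (S n)) with (S n * fact n)%nat; rewrite mult_INR, RtoC_mult; easy.
Qed.

Lemma rising_plus (a : C) (n m : nat) :
  rising a (n + m) = rising a n * rising (a + INR n) m.
Proof.
  induction m as [|m IH]; [rewrite Nat.add_0_r; simpl; ring|].
  rewrite Nat.add_succ_r; simpl; rewrite IH, plus_INR, RtoC_plus; ring.
Qed.

Lemma rising_S_l (a : C) (n : nat) : rising a (S n) = a * rising (a + 1) n.
Proof.
  change (S n) with (1 + n)%nat; rewrite rising_plus; simpl; ring.
Qed.

Lemma rising_fact (m n : nat) :
  RtoC (INR (fact m)) * rising (INR (S m)) n = RtoC (INR (fact (m + n))).
Proof.
  induction n as [|n IH]; [rewrite Nat.add_0_r; simpl; ring|].
  rewrite Nat.add_succ_r, RtoC_fact_S, <- IH.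
  change (rising (INR (S m)) (S n))
    with (rising (INR (S m)) n * (RtoC (INR (S m)) + INR n)).
  replace (RtoC (INR (S (m + n)))) with (RtoC (INR (S m)) + INR n)
    by (rewrite <- RtoC_plus, <- plus_INR; reflexivity).
  ring.
Qed.

Lemma rising_ge (w : C) (d : R) (n : nat) :
  (0 < d)%R -> (forall k, (d * INR (S k) <= Cmod (w + INR k))%R) ->
  (d ^ n * INR (fact n) <= Cmod (rising w n))%R.
Proof.
  intros Hd H; induction n as [|n IH]; [simpl; rewrite Cmod_1; lra|].
  change (fact (S n)) with (S n * fact n)%nat; rewrite mult_INR; simpl rising.
  rewrite Cmod_mult; simpl pow.
  replace (d * d ^ n * (INR (S n) * INR (fact n)))%R
    with (d ^ n * INR (fact n) * (d * INR (S n)))%R by ring.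
  apply Rmult_le_compat; auto.
  - apply Rmult_le_pos; [apply pow_le; lra|apply pos_INR].
  - apply Rmult_le_pos; [lra|apply pos_INR].
Qed.

(** [1 / (c)_(m+1)] has residue [(-1)^k / (k! (m-k)!)] at [c = - k]. In the induction,
    [m + 1 = (m + 1 - k) + k] turns [m + 1] times the sum into the difference of the shorter sums at
    [c] and [c + 1], and [1 / (c)_(m+1) - 1 / (c+1)_(m+1) = (m + 1) / (c)_(m+2)]. *)
Lemma alternating_partial_fractions (m : nat) (c : C) :
  ~ nonpos_integer c ->
  csum (fun k => RtoC ((-1) ^ k) /
    (RtoC (INR (fact k)) * INR (fact (m - k)) * (c + INR k))) (S m) =
  / rising c (S m).
Proof.
  revert c; induction m as [|m IH]; intros c Hc.
  { simpl; field; apply nonpole_neq_0, Hc. }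
  assert (Hc1 := nonpole_plus_1 c Hc).
  set (u := fun k => RtoC ((-1) ^ k) /
    (RtoC (INR (fact k)) * INR (fact (S m - k)) * (c + INR k))).
  assert (E : RtoC (INR (S m)) * csum u (S (S m)) =
    / rising c (S m) - / rising (c + 1) (S m)).
  { rewrite <- IH, <- (IH (c + 1)) by easy; rewrite <- csum_scal.
    rewrite (csum_ext _ (fun k => RtoC (INR (S m - k)) * u k + INR k * u k)).
    2: { intros k Hk; rewrite minus_INR, RtoC_minus by lia; ring. }
    rewrite csum_plus.
    change (csum (fun k => RtoC (INR (S m - k)) * u k) (S (S m)))
      with (csum (fun k => RtoC (INR (S m - k)) * u k) (S m)
        + INR (S m - S m) * u (S m)).
    rewrite (csum_S (fun k => RtoC (INR k) * u k)), Nat.sub_diag.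
    simpl INR at 2 3; rewrite !Cmult_0_l, Cplus_0_l, Cplus_0_r.
    unfold Cminus; f_equal.
    - apply csum_ext; intros k Hk; unfold u.
      replace (S m - k)%nat with (S (m - k)) by lia; rewrite RtoC_fact_S.
      field; repeat split; try apply RtoC_fact_neq_0; try apply RtoC_S_neq_0.
      apply nonpole_add, Hc.
    - match goal with |- _ = - ?z => replace (- z) with (- (1) * z) by ring end.
      rewrite <- csum_scal; apply csum_ext; intros k Hk; unfold u.
      replace (S m - S k)%nat with (m - k)%nat by lia; rewrite RtoC_fact_S.
      replace (c + INR (S k)) with (c + 1 + INR k)
        by (rewrite S_INR, RtoC_plus; ring).
      replace (RtoC ((-1) ^ S k)) with (- RtoC ((-1) ^ k))
        by (rewrite <- RtoC_opp; f_equal; simpl; ring).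
      field; repeat split; try apply RtoC_fact_neq_0; try apply RtoC_S_neq_0.
      apply nonpole_add, Hc1. }
  assert (R1 := rising_neq_0 (c + 1) m Hc1).
  assert (R2 := nonpole_neq_0 c Hc); assert (R3 := RtoC_S_neq_0 m).
  assert (R4 := nonpole_add (c + 1) m Hc1).
  replace (csum u (S (S m))) with (RtoC (INR (S m)) * csum u (S (S m)) / INR (S m))
    by (field; easy).
  rewrite E, (rising_S_l c (S m)), (rising_S_l c m); simpl rising.
  rewrite S_INR, RtoC_plus in *.
  field; easy.
Qed.

(* [seriesS] is the derivative of [1F1(c; 1 - nu; x)] in [c] at [c = 0], and
   [seriesT] is [x / nu * 2F2(1, 1; 2, 1 + nu; - x)]. *)
Definition seriesS (nu : C) (x : R) : C :=
  CSeries (fun n => RtoC (x ^ S n / INR (S n)) / rising (1 - nu) (S n)).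

Definition seriesT (nu : C) (x : R) : C :=
  CSeries (fun n => RtoC ((-1) ^ n) * (RtoC (x ^ S n / INR (S n)) / rising nu (S n))).

Lemma inv_rising_term_le (w : C) (x d : R) (n : nat) :
  (0 < x)%R -> (0 < d)%R -> (forall k, (d * INR (S k) <= Cmod (w + INR k))%R) ->
  (Cmod (RtoC (x ^ S n / INR (S n)) / rising w (S n)) <=
    x / d * ((x / d) ^ n / INR (fact n)))%R.
Proof.
  intros Hx Hd H; assert (G := rising_ge w d (S n) Hd H).
  assert (Hn : (1 <= INR (S n))%R) by (rewrite S_INR; generalize (pos_INR n); lra).
  assert (Hf : (0 < INR (fact n))%R) by apply INR_fact_lt_0.
  assert (Hp : (0 < d ^ S n)%R) by (apply pow_lt, Hd).
  assert (Hxp : (0 < x ^ S n)%R) by (apply pow_lt, Hx).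
  change (fact (S n)) with (S n * fact n)%nat in G; rewrite mult_INR in G.
  assert (G2 : (d ^ S n * INR (fact n) <= d ^ S n * (INR (S n) * INR (fact n)))%R).
  { apply Rmult_le_compat_l; [lra|]; nra. }
  assert (Hq : (0 < d ^ S n * INR (fact n))%R) by (apply Rmult_lt_0_compat; easy).
  rewrite Cmod_div, Cmod_R, Rabs_pos_eq by
    (apply Cmod_gt_0; lra) || (left; apply Rdiv_lt_0_compat; lra).
  replace (x / d * ((x / d) ^ n / INR (fact n)))%R
    with (x ^ S n / (d ^ S n * INR (fact n)))%R.
  2: { unfold Rdiv; rewrite Rpow_mult_distr, pow_inv; simpl pow; field.
       repeat split; try lra; apply pow_nonzero; lra. }
  unfold Rdiv; apply Rmult_le_compat.
  - apply Rmult_le_pos; [lra|left; apply Rinv_0_lt_compat; lra].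
  - left; apply Rinv_0_lt_compat; lra.
  - rewrite <- (Rmult_1_r (x ^ S n)) at 2; apply Rmult_le_compat_l; [lra|].
    rewrite <- Rinv_1; apply Rinv_le_contravar; lra.
  - apply Rinv_le_contravar; lra.
Qed.

Lemma asum_seriesS (nu : C) (x : R) :
  (0 < x)%R -> ~ nonpos_integer (1 - nu) ->
  asum (fun n => RtoC (x ^ S n / INR (S n)) / rising (1 - nu) (S n)).
Proof.
  intros Hx Hn; destruct (pole_distance _ Hn) as [d [Hd H]].
  eapply asum_le; [intros n; apply (inv_rising_term_le _ x d n Hx Hd H)|].
  apply ex_series_exp_bound.
Qed.

Lemma seriesT_term_le (nu : C) (x d : R) (n : nat) :
  (0 < x)%R -> (0 < d)%R -> (forall k, (d * INR (S k) <= Cmod (nu + INR k))%R) ->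
  (Cmod (RtoC ((-1) ^ n) * (RtoC (x ^ S n / INR (S n)) / rising nu (S n))) <=
    x / d * ((x / d) ^ n / INR (fact n)))%R.
Proof.
  intros Hx Hd H; rewrite Cmod_mult, Cmod_R, pow_1_abs, Rmult_1_l.
  apply inv_rising_term_le; easy.
Qed.

Lemma asum_seriesT (nu : C) (x : R) :
  (0 < x)%R -> ~ nonpos_integer nu ->
  asum (fun n => RtoC ((-1) ^ n) * (RtoC (x ^ S n / INR (S n)) / rising nu (S n))).
Proof.
  intros Hx Hn; destruct (pole_distance _ Hn) as [d [Hd H]].
  eapply asum_le; [intros n; apply (seriesT_term_le _ x d n Hx Hd H)|].
  apply ex_series_exp_bound.
Qed.

(* The n-th Cauchy product coefficient splits by
   1/((1-nu+k)(nu+n-k)) = (1/(1-nu+k) + 1/(nu+n-k)) / (n+1). *)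
Lemma gamma_series_product (nu : C) (x : R) :
  (0 < x)%R -> ~ nonpos_integer nu -> ~ nonpos_integer (1 - nu) ->
  RtoC x * (gamma_series (1 - nu) (- x) * gamma_series nu x) =
  seriesS nu x + seriesT nu x.
Proof.
  intros Hx Hn Hm.
  assert (A1 := asum_gamma_series (1 - nu) (- x) Hm).
  assert (A2 := asum_gamma_series nu x Hn).
  assert (A3 := asum_plus _ _ (asum_seriesS nu x Hx Hm) (asum_seriesT nu x Hx Hn)).
  unfold gamma_series, seriesS, seriesT.
  rewrite (CSeries_Cauchy_product _ _ A1 A2).
  rewrite <- (CSeries_plus _ _ (asum_seriesS nu x Hx Hm) (asum_seriesT nu x Hx Hn)).
  set (v := fun n => csum (fun k => RtoC ((- x) ^ k / INR (fact k)) / (1 - nu + INR k)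
    * (RtoC (x ^ (n - k) / INR (fact (n - k))) / (nu + INR (n - k)))) (S n)).
  assert (Hv : forall n, v n = / RtoC x * (RtoC (x ^ S n / INR (S n)) / rising (1 - nu) (S n)
    + RtoC ((-1) ^ n) * (RtoC (x ^ S n / INR (S n)) / rising nu (S n)))).
  { intros n; assert (Hn1 := RtoC_S_neq_0 n).
    assert (Hx0 : RtoC x <> 0) by (apply RtoC_neq_0; lra).
    set (p := csum (fun k => RtoC ((-1) ^ k) / (RtoC (INR (fact k)) *
      RtoC (INR (fact (n - k))) * (1 - nu + INR k))) (S n)).
    set (q := csum (fun k => RtoC ((-1) ^ k) / (RtoC (INR (fact k)) *
      RtoC (INR (fact (n - k))) * (nu + INR k))) (S n)).
    assert (Ev : v n = RtoC (x ^ n) / INR (S n) * (p + RtoC ((-1) ^ n) * q)).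
    (* Reversing the order in [q] makes [nu + (n - k)] its denominator, as in the Cauchy product. *)
    { unfold q; rewrite csum_rev; unfold v, p.
      rewrite <- csum_scal, <- csum_plus, <- csum_scal.
      apply csum_ext; intros k Hk.
      replace (S n - S k)%nat with (n - k)%nat by lia.
      replace (n - (n - k))%nat with k by lia.
      assert (E1 : RtoC (x ^ n) = RtoC (x ^ k) * RtoC (x ^ (n - k))).
      { rewrite <- RtoC_mult, <- pow_add; do 2 f_equal; lia. }
      assert (E2 : RtoC ((- x) ^ k) = RtoC ((-1) ^ k) * RtoC (x ^ k)).
      { rewrite <- RtoC_mult, <- Rpow_mult_distr; do 2 f_equal; ring. }
      assert (E3 : RtoC ((-1) ^ n) * RtoC ((-1) ^ (n - k)) = RtoC ((-1) ^ k)).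
      { rewrite <- RtoC_mult, <- pow_add; f_equal.
        replace (n + (n - k))%nat with (k + 2 * (n - k))%nat by lia.
        rewrite pow_add, pow_1_even; ring. }
      rewrite !RtoC_div by apply INR_fact_neq_0.
      rewrite E1, E2, S_INR.
      assert (D1 := nonpole_add _ k Hm); assert (D2 := nonpole_add _ (n - k) Hn).
      assert (F1 := RtoC_fact_neq_0 k); assert (F2 := RtoC_fact_neq_0 (n - k)).
      replace (RtoC ((-1) ^ n) * (RtoC ((-1) ^ (n - k)) / (RtoC (INR (fact (n - k))) *
        RtoC (INR (fact k)) * (nu + INR (n - k)))))
        with (RtoC ((-1) ^ k) / (RtoC (INR (fact (n - k))) *
          RtoC (INR (fact k)) * (nu + INR (n - k))))
        by (rewrite <- E3; field; easy).
      rewrite S_INR, RtoC_plus in Hn1; rewrite RtoC_plus.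
      rewrite minus_INR, RtoC_minus in * by lia.
      field; easy. }
    rewrite Ev; unfold p, q; rewrite !alternating_partial_fractions by easy.
    rewrite RtoC_div by (apply not_0_INR; lia).
    assert (G1 := rising_neq_0 _ (S n) Hm); assert (G2 := rising_neq_0 _ (S n) Hn).
    change (x ^ S n)%R with (x * x ^ n)%R; rewrite RtoC_mult.
    field; easy. }
  rewrite (CSeries_ext v _ Hv), CSeries_scal by easy.
  field; apply RtoC_neq_0; lra.
Qed.

(** The right side is what differentiating Tricomi's formula produces, with [Gamma(1 - nu)] and [S]
    both singular at positive integers [nu]. On the left every term is regular there, which is why
    the final formula covers those values. *)
Lemma seriesS_upper_gamma (nu : C) (x : R) :
  (0 < x)%R -> ~ nonpos_integer nu -> ~ nonpos_integer (1 - nu) ->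
  seriesT nu x + upper_gamma (1 - nu) x * (cpow x nu * gamma_series nu x) =
  Gamma (1 - nu) * (cpow x nu * gamma_series nu x) - seriesS nu x.
Proof.
  intros Hx Hn Hm; assert (X := gamma_series_product nu x Hx Hn Hm).
  rewrite (Gamma_split (1 - nu) x Hm Hx).
  assert (E : cpow x (1 - nu) * cpow x nu = RtoC x).
  { rewrite <- cpow_plus by easy; rewrite <- (cpow_1 x Hx) at 2; f_equal; ring. }
  replace (seriesT nu x) with (RtoC x * (gamma_series (1 - nu) (- x) * gamma_series nu x)
    - seriesS nu x) by (rewrite X; ring).
  set (p := cpow x nu) in *; set (q := cpow x (1 - nu)) in *.
  rewrite <- E; ring.
Qed.

(** [(1)_n = n!] and [(2)_n = (n + 1)!] leave [1 / (n + 1)], and the prefactor uses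
    [nu (1 + nu)_n = (nu)_(n+1)]. *)
Lemma hypergeometric_seriesT (nu : C) (x : R) :
  (0 < x)%R -> ~ nonpos_integer nu ->
  RtoC x / nu * hypergeometric (RtoC 1 :: RtoC 1 :: nil) (RtoC 2 :: 1 + nu :: nil)
    (- RtoC x) = seriesT nu x.
Proof.
  intros Hx Hn; assert (Hn0 := nonpole_neq_0 _ Hn).
  assert (Hx0 : RtoC x <> 0) by (apply RtoC_neq_0; lra).
  assert (E : forall n, Cprod (map (fun c => pochhammer c n) (RtoC 1 :: RtoC 1 :: nil)) /
    Cprod (map (fun c => pochhammer c n) (RtoC 2 :: 1 + nu :: nil)) *
    ((- RtoC x) ^ n / INR (fact n)) =
    nu / RtoC x * (RtoC ((-1) ^ n) * (RtoC (x ^ S n / INR (S n)) / rising nu (S n)))).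
  { intros n; unfold Cprod; simpl map; simpl fold_right.
    rewrite !pochhammer_rising, rising_S_l.
    replace (1 + nu) with (nu + 1) by ring.
    assert (R1 := rising_fact 0 n); assert (R2 := rising_fact 1 n).
    simpl (INR (fact 0)) in R1; simpl (INR 1) in R1.
    simpl (INR (fact 1)) in R2; replace (INR 2) with 2%R in R2 by (simpl; ring).
    rewrite Cmult_1_l in R1, R2; rewrite R1, R2.
    change (0 + n)%nat with n; change (1 + n)%nat with (S n); rewrite RtoC_fact_S.
    replace ((- RtoC x) ^ n) with (RtoC ((-1) ^ n) * RtoC (x ^ n))
      by (rewrite <- RtoC_mult, <- Rpow_mult_distr, RtoC_pow; f_equal;
          rewrite <- RtoC_opp; f_equal; ring).
    rewrite RtoC_div by (apply not_0_INR; lia).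
    change (x ^ S n)%R with (x * x ^ n)%R; rewrite RtoC_mult.
    assert (R3 := rising_neq_0 _ n (nonpole_plus_1 _ Hn)).
    assert (F1 := RtoC_fact_neq_0 n); assert (F2 := RtoC_S_neq_0 n).
    field; easy. }
  unfold hypergeometric; rewrite (CSeries_ext _ _ E), CSeries_scal
    by (apply asum_seriesT; easy).
  fold (seriesT nu x); field; easy.
Qed.

(** * The lower incomplete gamma function at a negative argument *)

Lemma cpow_mult_pos (s t : R) (a : C) :
  (0 < s)%R -> (0 < t)%R ->
  cpow (RtoC (s * t)) a = cpow s a * cpow t a.
Proof.
  intros Hs Ht; rewrite !cpow_pos, ln_mult, RtoC_plus, <- cexp_plus
    by (try apply Rmult_lt_0_compat; easy).
  f_equal; ring.
Qed.

Lemma cexp_Ci_PI : cexp (Ci * RtoC PI) = - (1).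
Proof.
  assert (X := cexp_Ci_PI_INR 1); simpl in X; rewrite Cmult_1_l, Cmult_1_r in X; easy.
Qed.

(** Along [t = - s x] the integrand is a constant times [s^(nu - 1) e^(x s)], integrated by
    [dC_cpow_gamma_series] with [k = x]. The series branch of the definition gives the same
    expression. *)
Lemma lower_gamma_neg (nu : C) (x : R) :
  (0 < x)%R -> ~ nonpos_integer nu ->
  lower_gamma nu (- RtoC x) =
  cexp (nu * (Ci * RtoC PI)) * (cpow x nu * gamma_series nu x).
Proof.
  intros Hx Hn; unfold lower_gamma; destruct Rlt_dec as [Hr|Hr].
  - set (K := cexp (nu * (Ci * RtoC PI)) * cpow x nu).
    set (f := fun s : R => cpow (RtoC s * - RtoC x) (nu - 1) *
      cexp (- (RtoC s * - RtoC x)) * - RtoC x).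
    set (G := fun s : R => K * (cpow s nu * gamma_series nu (x * s))).
    assert (Ef : forall s, (0 < s)%R ->
      K * (cpow s (nu - 1) * RtoC (exp (x * s))) = f s).
    { intros s Hs; unfold f, K.
      replace (RtoC s * - RtoC x) with (- RtoC (s * x)) by (rewrite RtoC_mult; ring).
      replace (- - RtoC (s * x)) with (RtoC (x * s)) by (rewrite !RtoC_mult; ring).
      rewrite cpow_neg, cpow_mult_pos, cexp_RtoC by (try apply Rmult_lt_0_compat; easy).
      (* The line element [- x ds] supplies the sign turning [e^(i pi (nu - 1))] into
         [e^(i pi nu)]. *)
      replace nu with (nu - 1 + 1) at 1 by ring.
      rewrite Cmult_plus_distr_r, cexp_plus, Cmult_1_l, cexp_Ci_PI.
      replace (cpow x nu) with (cpow x (nu - 1) * RtoC x).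
      - ring.
      - rewrite <- (cpow_1 x Hx) at 2; rewrite <- cpow_plus by easy; f_equal; ring. }
    unfold CRInt_gen; fold f.
    apply (is_RInt_gen_unique (V := C_R_CompleteNormedModule)).
    replace (cexp (nu * (Ci * RtoC PI)) * (cpow x nu * gamma_series nu x))
      with (G 1%R - K * 0).
    2: { unfold G, K; rewrite (cpow_pos 1), ln_1, Rmult_1_r, (Cmult_0_r nu), cexp_0 by lra; ring. }
    apply (CRInt_gen_antiderivative f G).
    + apply at_right_proper_filter.
    + apply at_point_proper.
    + intros t Ht; eexists; apply dC_ext_loc with
        (fun s : R => K * (cpow s (nu - 1) * RtoC (exp (x * s)))).
      * exists (mkposreal t Ht); intros s Hs; apply Ef.
        change (Rabs (s - t) < t)%R in Hs; apply Rabs_def2 in Hs; lra.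
      * apply dC_scal, dC_mult; [apply dC_cpow; easy|apply dC_RtoC_exp].
    + intros t Ht; rewrite <- Ef by easy; apply dC_scal, dC_cpow_gamma_series; easy.
    + apply at_right_pos.
    + unfold at_point; lra.
    + apply clim_mult; [apply clim_const|]; apply clim_cpow_gamma_series_0, Hr.
    + apply clim_at_point.
  - unfold gamma_series; rewrite Cmult_assoc, <- CSeries_scal
      by (apply asum_gamma_series; easy).
    apply CSeries_ext; intros n.
    rewrite cpow_neg, Cmult_plus_distr_r, cexp_plus, cexp_Ci_PI_INR by easy.
    rewrite cpow_plus, cpow_INR by easy.
    replace (RtoC ((-1) ^ n) * (cexp (nu * (Ci * RtoC PI)) * (- (1)) ^ n *
      (cpow x nu * RtoC x ^ n))) with
      (RtoC ((-1) ^ n) * (- (1)) ^ n * cexp (nu * (Ci * RtoC PI)) *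
      (cpow x nu * RtoC x ^ n)) by ring.
    (* The sign of the series cancels the phase [e^(i pi n)] of [(- x)^(nu + n)]. *)
    replace (RtoC ((-1) ^ n) * (- (1)) ^ n) with (RtoC 1).
    2: { rewrite <- RtoC_opp, <- RtoC_pow, <- RtoC_mult, <- Rpow_mult_distr.
         replace (-1 * - (1))%R with 1%R by ring; rewrite pow1; easy. }
    rewrite RtoC_div, RtoC_pow by apply INR_fact_neq_0.
    field; split; [apply RtoC_fact_neq_0|apply nonpole_add, Hn].
Qed.

(** * The parameter derivative of the Tricomi function *)

Definition kummer (a b : C) (x : R) : C :=
  CSeries (fun n => rising a n / rising b n * RtoC (x ^ n / INR (fact n))).

Lemma hypergeometric_kummer (a b : C) (x : R) :
  hypergeometric (a :: nil) (b :: nil) (RtoC x) = kummer a b x.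
Proof.
  unfold hypergeometric, kummer; apply CSeries_ext; intros n.
  unfold Cprod; simpl map; simpl fold_right.
  rewrite !pochhammer_rising, !Cmult_1_r, RtoC_div, RtoC_pow by apply INR_fact_neq_0.
  reflexivity.
Qed.

Lemma tricomiU_nonint_kummer (a nu : C) (x : R) :
  tricomiU_nonint a (1 + nu) x =
  Gamma (- nu) * rGamma (a - nu) * kummer a (1 + nu) x +
  Gamma nu * rGamma a * cpow x (- nu) * kummer (a - nu) (1 - nu) x.
Proof.
  unfold tricomiU_nonint; rewrite !hypergeometric_kummer.
  replace (1 - (1 + nu)) with (- nu) by ring.
  replace (a - (1 + nu) + 1) with (a - nu) by ring.
  replace (1 + nu - 1) with nu by ring.
  replace (2 - (1 + nu)) with (1 - nu) by ring; reflexivity.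
Qed.

Lemma Cmod_rising_le (a : C) (A : R) (n : nat) :
  (Cmod a <= A)%R -> (Cmod (rising a n) <= (A + 1) ^ n * INR (fact n))%R.
Proof.
  intros Ha; assert (HA : (0 <= A)%R) by (generalize (Cmod_ge_0 a); lra).
  induction n as [|n IH]; [simpl; rewrite Cmod_1; lra|].
  change (fact (S n)) with (S n * fact n)%nat; rewrite mult_INR; simpl rising.
  rewrite Cmod_mult; simpl pow.
  replace ((A + 1) * (A + 1) ^ n * (INR (S n) * INR (fact n)))%R
    with ((A + 1) ^ n * INR (fact n) * ((A + 1) * INR (S n)))%R by ring.
  apply Rmult_le_compat; try apply Cmod_ge_0; [easy|].
  eapply Rle_trans; [apply Cmod_triangle|].
  rewrite Cmod_R, Rabs_pos_eq by apply pos_INR; rewrite S_INR.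
  generalize (pos_INR n); nra.
Qed.

Lemma Cmod_rising_div_le (a b : C) (A d : R) (n : nat) :
  (Cmod a <= A)%R -> (0 < d)%R ->
  (forall k, (d * INR (S k) <= Cmod (b + INR k))%R) ->
  (Cmod (rising a n / rising b n) <= ((A + 1) / d) ^ n)%R.
Proof.
  intros Ha Hd H; assert (G := rising_ge b d n Hd H); assert (F := Cmod_rising_le a A n Ha).
  assert (Hf := INR_fact_lt_0 n); assert (Hp := pow_lt d n Hd).
  assert (Hq : (0 < d ^ n * INR (fact n))%R) by (apply Rmult_lt_0_compat; easy).
  rewrite Cmod_div by (apply Cmod_gt_0; lra).
  replace (((A + 1) / d) ^ n)%R
    with ((A + 1) ^ n * INR (fact n) / (d ^ n * INR (fact n)))%R.
  - unfold Rdiv; apply Rmult_le_compat; [apply Cmod_ge_0| |easy|].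
    + left; apply Rinv_0_lt_compat; lra.
    + apply Rinv_le_contravar; easy.
  - unfold Rdiv; rewrite Rpow_mult_distr, pow_inv; field; lra.
Qed.

Lemma clim_rising {T : Type} {F : (T -> Prop) -> Prop} {FF : Filter F}
  (f : T -> C) (l : C) (n : nat) :
  clim F f l -> clim F (fun p => rising (f p) n) (rising l n).
Proof.
  intros H; induction n as [|n IH]; simpl; [apply clim_const|].
  apply clim_mult; [easy|]; apply clim_plus; [easy|apply clim_const].
Qed.

Lemma Cmod_kummer_term_le (a b : C) (x A d : R) (n : nat) :
  (0 < x)%R -> (Cmod a <= A)%R -> (0 < d)%R ->
  (forall k, (d * INR (S k) <= Cmod (b + INR k))%R) ->
  (Cmod (rising a n / rising b n * RtoC (x ^ n / INR (fact n))) <=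
    1 * (((A + 1) / d * x) ^ n / INR (fact n)))%R.
Proof.
  intros Hx Ha Hd H; rewrite Cmod_mult, Cmod_R, Rabs_pos_eq, Rmult_1_l.
  - rewrite Rpow_mult_distr.
    replace (((A + 1) / d) ^ n * x ^ n / INR (fact n))%R
      with (((A + 1) / d) ^ n * (x ^ n / INR (fact n)))%R by (unfold Rdiv; ring).
    apply Rmult_le_compat_r; [|apply Cmod_rising_div_le; easy].
    left; apply Rdiv_lt_0_compat; [apply pow_lt, Hx|apply INR_fact_lt_0].
  - left; apply Rdiv_lt_0_compat; [apply pow_lt, Hx|apply INR_fact_lt_0].
Qed.

Lemma asum_kummer (a b : C) (x : R) :
  (0 < x)%R -> ~ nonpos_integer b ->
  asum (fun n => rising a n / rising b n * RtoC (x ^ n / INR (fact n))).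
Proof.
  intros Hx Hb; destruct (pole_distance b Hb) as [d [Hd H]].
  eapply asum_le; [intros n; apply (Cmod_kummer_term_le a b x (Cmod a) d n); try easy; lra|].
  apply ex_series_exp_bound.
Qed.

Lemma clim_bounded {T : Type} {F : (T -> Prop) -> Prop} {FF : Filter F}
  (f : T -> C) (l : C) : clim F f l -> F (fun p => (Cmod (f p) <= Cmod l + 1)%R).
Proof.
  intros H; generalize (H 1%R Rlt_0_1); apply filter_imp; intros p Hp.
  generalize (Cmod_le_dist (f p) l); lra.
Qed.

Lemma clim_nonpole_distance {T : Type} {F : (T -> Prop) -> Prop} {FF : Filter F}
  (f : T -> C) (l : C) :
  ~ nonpos_integer l -> clim F f l ->
  exists d, (0 < d)%R /\
    F (fun p => forall k, (d * INR (S k) <= Cmod (f p + INR k))%R).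
Proof.
  intros Hl Hf; destruct (pole_distance_nearby l Hl) as [d [Hd H]].
  exists d; split; [easy|]; generalize (Hf d Hd); apply filter_imp.
  intros p Hp; apply H, Hp.
Qed.

Lemma clim_kummer {T : Type} {F : (T -> Prop) -> Prop} {FF : ProperFilter F}
  (f g : T -> C) (a b : C) (x : R) :
  (0 < x)%R -> ~ nonpos_integer b -> clim F f a -> clim F g b ->
  clim F (fun p => kummer (f p) (g p) x) (kummer a b x).
Proof.
  intros Hx Hb Hf Hg; destruct (clim_nonpole_distance g b Hb Hg) as [d [Hd H]].
  unfold kummer; apply tannery with
    (fun n => 1 * (((Cmod a + 1 + 1) / d * x) ^ n / INR (fact n)))%R.
  - intros n; apply clim_mult; [|apply clim_const].
    apply clim_div; [apply rising_neq_0, Hb|apply clim_rising, Hf|apply clim_rising, Hg].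
  - generalize (filter_and _ _ (clim_bounded f a Hf) H); apply filter_imp.
    intros p [H1 H2] n; apply Cmod_kummer_term_le; easy.
  - apply ex_series_exp_bound.
Qed.

(** [(nu)_n / (nu + 1)_n] telescopes to [nu / (nu + n)]. *)
Lemma kummer_shifted (nu : C) (x : R) :
  (0 < x)%R -> ~ nonpos_integer nu -> kummer nu (1 + nu) x = nu * gamma_series nu x.
Proof.
  intros Hx Hn; unfold kummer, gamma_series.
  rewrite <- CSeries_scal by (apply asum_gamma_series, Hn).
  apply CSeries_ext; intros n; replace (1 + nu) with (nu + 1) by ring.
  assert (E : nu * rising (nu + 1) n = rising nu n * (nu + INR n))
    by (rewrite <- rising_S_l; reflexivity).
  assert (R1 := rising_neq_0 _ n (nonpole_plus_1 _ Hn)).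
  assert (R2 := nonpole_add nu n Hn).
  apply Ceq_minus.
  replace (rising nu n / rising (nu + 1) n * RtoC (x ^ n / INR (fact n)) -
    nu * (RtoC (x ^ n / INR (fact n)) / (nu + INR n))) with
    ((rising nu n * (nu + INR n) - nu * rising (nu + 1) n) *
      RtoC (x ^ n / INR (fact n)) / (rising (nu + 1) n * (nu + INR n)))
    by (field; easy).
  rewrite E; unfold Cminus, Cdiv; rewrite Cplus_opp_r; ring.
Qed.

(** [(1F1(c; b; x) - 1) / c], with the division carried out termwise so that [c = 0] is allowed; its
    value there is the derivative in [c]. *)
Definition kummer_quotient (c b : C) (x : R) : C :=
  CSeries (fun n => rising (c + 1) n / rising b (S n) * RtoC (x ^ S n / INR (fact (S n)))).

Lemma kummer_quotient_term_le (c b : C) (x A d : R) (n : nat) :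
  (0 < x)%R -> ~ nonpos_integer b -> (Cmod (c + 1) <= A)%R -> (0 < d)%R ->
  (forall k, (d * INR (S k) <= Cmod (b + 1 + INR k))%R) ->
  (Cmod (rising (c + 1) n / rising b (S n) * RtoC (x ^ S n / INR (fact (S n)))) <=
    Cmod (RtoC x / b) * (((A + 1) / d * x) ^ n / INR (fact n)))%R.
Proof.
  intros Hx Hb Hc Hd H.
  assert (R1 := rising_neq_0 _ n (nonpole_plus_1 b Hb)); assert (Hb0 := nonpole_neq_0 b Hb).
  replace (rising (c + 1) n / rising b (S n) * RtoC (x ^ S n / INR (fact (S n)))) with
    (RtoC x / b * (rising (c + 1) n / rising (b + 1) n * RtoC (x ^ n / INR (fact n)) *
      / INR (S n))).
  - rewrite Cmod_mult; apply Rmult_le_compat_l; [apply Cmod_ge_0|].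
    assert (X := Cmod_kummer_term_le (c + 1) (b + 1) x A d n Hx Hc Hd H).
    assert (Y : (Cmod (/ INR (S n)) <= 1)%R).
    { rewrite Cmod_inv, Cmod_R, Rabs_pos_eq by (apply RtoC_S_neq_0 || apply pos_INR).
      rewrite <- Rinv_1; apply Rinv_le_contravar; [lra|].
      rewrite S_INR; generalize (pos_INR n); lra. }
    rewrite Cmod_mult; rewrite Rmult_1_l in X; eapply Rle_trans; [|exact X].
    rewrite <- Rmult_1_r; apply Rmult_le_compat_l; [apply Cmod_ge_0|exact Y].
  - rewrite rising_S_l, !RtoC_div, RtoC_fact_S by apply INR_fact_neq_0.
    change (x ^ S n)%R with (x * x ^ n)%R; rewrite RtoC_mult.
    field; repeat split; try easy; [apply RtoC_fact_neq_0|apply RtoC_S_neq_0].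
Qed.

Lemma asum_kummer_quotient (c b : C) (x : R) :
  (0 < x)%R -> ~ nonpos_integer b ->
  asum (fun n => rising (c + 1) n / rising b (S n) * RtoC (x ^ S n / INR (fact (S n)))).
Proof.
  intros Hx Hb; destruct (pole_distance _ (nonpole_plus_1 b Hb)) as [d [Hd H]].
  eapply asum_le; [|apply ex_series_exp_bound].
  intros n; apply (kummer_quotient_term_le c b x _ d n Hx Hb (Rle_refl _) Hd H).
Qed.

Lemma kummer_quotient_spec (c b : C) (x : R) :
  (0 < x)%R -> ~ nonpos_integer b -> kummer c b x = 1 + c * kummer_quotient c b x.
Proof.
  intros Hx Hb; unfold kummer; rewrite CSeries_S by (apply asum_kummer; easy).
  f_equal.
  - simpl; rewrite Rdiv_1_r; field; apply C1_nz.
  - unfold kummer_quotient; rewrite <- CSeries_scal by (apply asum_kummer_quotient; easy).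
    apply CSeries_ext; intros n; rewrite rising_S_l; unfold Cdiv; ring.
Qed.

Lemma clim_kummer_quotient {T : Type} {F : (T -> Prop) -> Prop} {FF : ProperFilter F}
  (f : T -> C) (c b : C) (x : R) :
  (0 < x)%R -> ~ nonpos_integer b -> clim F f c ->
  clim F (fun p => kummer_quotient (f p) b x) (kummer_quotient c b x).
Proof.
  intros Hx Hb Hf.
  destruct (pole_distance _ (nonpole_plus_1 b Hb)) as [d [Hd H]].
  assert (Hf1 := clim_plus _ _ _ _ Hf (clim_const (RtoC 1))).
  unfold kummer_quotient; apply tannery with (fun n => Cmod (RtoC x / b) *
    (((Cmod (c + 1) + 1 + 1) / d * x) ^ n / INR (fact n)))%R.
  - intros n; apply clim_mult; [|apply clim_const].
    apply clim_mult; [apply clim_rising, Hf1|apply clim_const].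
  - generalize (clim_bounded _ _ Hf1); apply filter_imp; intros p Hp n.
    apply kummer_quotient_term_le; easy.
  - apply ex_series_exp_bound.
Qed.

Lemma kummer_quotient_0 (nu : C) (x : R) : kummer_quotient 0 (1 - nu) x = seriesS nu x.
Proof.
  unfold kummer_quotient, seriesS; apply CSeries_ext; intros n.
  rewrite Cplus_0_l; assert (R1 := rising_fact 0 n).
  simpl (INR (fact 0)) in R1; simpl (INR 1) in R1; rewrite Cmult_1_l in R1.
  rewrite R1; simpl plus.
  rewrite !RtoC_div, RtoC_fact_S by (apply INR_fact_neq_0 || (apply not_0_INR; lia)).
  assert (F1 := RtoC_fact_neq_0 n); assert (F2 := RtoC_S_neq_0 n).
  unfold Cdiv; generalize (/ rising (1 - nu) (S n)); intros r.
  change (0 + n)%nat with n; field; easy.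
Qed.

Lemma clim_locally_derive {f : C -> C} {s l : C} :
  strict_deriv f s l -> clim (C_near s) f (f s).
Proof. intros H; apply (derive_clim f s l), strict_deriv_derive, H. Qed.

Lemma clim_continuous_comp {T : Type} {F : (T -> Prop) -> Prop} {FF : Filter F}
  (f : C -> C) (g : T -> C) (s : C) :
  clim (C_near s) f (f s) -> clim F g s ->
  clim F (fun p => f (g p)) (f s).
Proof.
  intros Hf Hg e He; destruct (proj1 (locally_C_ball _ _) (Hf e He)) as [d [Hd H]].
  generalize (Hg d Hd); apply filter_imp; intros p Hp; apply H, Hp.
Qed.

Lemma clim_locally' (s : C) : clim (C_near' s) (fun w => w) s.
Proof. intros e He; apply locally'_C_ball; exists e; split; easy. Qed.

Lemma Gamma_continuous (z : C) :
  ~ nonpos_integer z -> clim (C_near z) Gamma (Gamma z).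
Proof.
  intros Hz; destruct (Gamma_strict_deriv z Hz) as [l Hl]; exact (clim_locally_derive Hl).
Qed.

Lemma rGamma_strict_deriv (z l : C) :
  ~ nonpos_integer z -> strict_deriv Gamma z l ->
  strict_deriv rGamma z (- l / (Gamma z * Gamma z)).
Proof.
  intros Hz Hl.
  apply strict_deriv_ext_loc with (fun w => / Gamma w).
  { generalize (nonpole_nearby z Hz); apply filter_imp; intros w Hw.
    symmetry; apply rGamma_nonpole, Hw. }
  assert (Gz := Gamma_neq_0 z Hz); assert (Gc := Gamma_continuous z Hz).
  destruct (proj1 (locally_C_ball _ _) (nonpole_nearby z Hz)) as [d [Hd Hnp]].
  eapply clim_ext with (f := fun pq => - ((Gamma (fst pq) - Gamma (snd pq)) /
    (fst pq - snd pq)) / (Gamma (fst pq) * Gamma (snd pq))).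
  - exists d; split; [easy|]; intros p q Hp Hq Hpq; simpl.
    field; repeat split; try (apply Gamma_neq_0, Hnp; easy).
    apply Cminus_eq_contra, Hpq.
  - apply clim_div; [apply Cmult_neq_0; easy|apply clim_opp, Hl|].
    apply clim_mult; apply clim_continuous_comp; try easy;
      [apply clim_offdiag_fst|apply clim_offdiag_snd].
Qed.

Lemma rGamma_continuous (z : C) :
  ~ nonpos_integer z -> clim (C_near z) rGamma (rGamma z).
Proof.
  intros Hz; destruct (Gamma_strict_deriv z Hz) as [l Hl].
  exact (clim_locally_derive (rGamma_strict_deriv z l Hz Hl)).
Qed.

Lemma digamma_strict_deriv (z l : C) : strict_deriv Gamma z l -> digamma z = l / Gamma z.
Proof.
  intros Hl; unfold digamma, C_derive; f_equal.
  apply C_lim_clim, strict_deriv_derive, Hl.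
Qed.

Lemma rGamma_1 : rGamma 1 = 1.
Proof.
  rewrite rGamma_nonpole, Gamma_1 by (apply nonpole_Re_pos; simpl; lra).
  field; apply C1_nz.
Qed.

(** Product rule at a point where both [Gamma nu / Gamma a] and [1 + (a - nu) L a] equal 1. Shared
    by both cases: [L] is the full quotient series when [nu] is not an integer, a finite sum
    otherwise. *)
Lemma clim_quotient_product (nu : C) (L : C -> C) (l : C) :
  ~ nonpos_integer nu -> clim (C_near' nu) L l ->
  clim (C_near' nu)
    (fun a => (Gamma nu * rGamma a * (1 + (a - nu) * L a) - 1) / (a - nu))
    (- digamma nu + l).
Proof.
  intros Hn HL; destruct (Gamma_strict_deriv nu Hn) as [g Hg].
  assert (Gn := Gamma_neq_0 nu Hn).
  rewrite (digamma_strict_deriv nu g Hg).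
  assert (Hr := strict_deriv_derive _ _ _ (rGamma_strict_deriv nu g Hn Hg)).
  assert (Ern := rGamma_nonpole nu Hn).
  replace (- (g / Gamma nu) + l) with
    (Gamma nu * (- g / (Gamma nu * Gamma nu)) + Gamma nu * rGamma nu * l)
    by (rewrite Ern; field; easy).
  eapply clim_ext with (f := fun a => Gamma nu * ((rGamma a - rGamma nu) / (a - nu))
    + Gamma nu * rGamma a * L a).
  - apply locally'_C_ball; exists 1%R; split; [lra|]; intros a Ha _.
    rewrite Ern; field; split; [apply Cminus_eq_contra, Ha|easy].
  - apply clim_plus; [apply clim_mult; [apply clim_const|easy]|].
    apply clim_mult; [|easy]; apply clim_mult; [apply clim_const|].
    apply clim_continuous_comp; [apply rGamma_continuous, Hn|apply clim_locally'].
Qed.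

(** The limit is written in the terms that stay regular at positive integers, so that both cases
    prove the same statement. *)
Definition tricomiU_deriv_at (nu : C) (x : R) : Prop :=
  clim (C_near' nu)
    (fun a => (tricomiU a (1 + nu) x - tricomiU nu (1 + nu) x) / (a - nu))
    (- cpow x (- nu) * (digamma nu + seriesT nu x +
      upper_gamma (1 - nu) x * (cpow x nu * gamma_series nu x))).

Lemma nonpole_of_nonint (z : C) :
  ~ (exists m : Z, z = RtoC (IZR m)) -> ~ nonpos_integer z.
Proof.
  intros Hz [n Hn]; apply Hz; exists (- Z.of_nat n)%Z.
  rewrite opp_IZR, <- INR_IZR_INZ, RtoC_opp; exact Hn.
Qed.

Lemma tricomiU_deriv_nonint (nu : C) (x : R) :
  (0 < x)%R -> ~ (exists m : Z, 1 + nu = RtoC (IZR m)) -> tricomiU_deriv_at nu x.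
Proof.
  intros Hx Hnu.
  assert (N1 : ~ nonpos_integer nu).
  { apply nonpole_of_nonint; intros [m Hm]; apply Hnu; exists (1 + m)%Z.
    rewrite plus_IZR, RtoC_plus, <- Hm; reflexivity. }
  assert (N2 : ~ nonpos_integer (- nu)).
  { apply nonpole_of_nonint; intros [m Hm]; apply Hnu; exists (1 - m)%Z.
    rewrite minus_IZR, RtoC_minus, <- Hm; ring. }
  assert (N3 : ~ nonpos_integer (1 - nu)).
  { replace (1 - nu) with (- nu + 1) by ring; apply nonpole_plus_1, N2. }
  assert (N4 : ~ nonpos_integer (1 + nu)).
  { replace (1 + nu) with (nu + 1) by ring; apply nonpole_plus_1, N1. }
  assert (EU : forall a, tricomiU a (1 + nu) x =
    tricomiU_nonint a (1 + nu) x).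
  { intros a; unfold tricomiU; destruct excluded_middle_informative; easy. }
  set (p := cpow x (- nu)).
  (* With [1 / Gamma(a - nu) = (a - nu) / Gamma(a - nu + 1)] the first summand contributes just its
     cofactor at [a = nu]. *)
  assert (Hform : forall a, tricomiU a (1 + nu) x =
    (a - nu) * (Gamma (- nu) * rGamma (a - nu + 1) * kummer a (1 + nu) x) +
    p * (Gamma nu * rGamma a * (1 + (a - nu) * kummer_quotient (a - nu) (1 - nu) x))).
  { intros a; rewrite EU, tricomiU_nonint_kummer, (kummer_quotient_spec (a - nu)) by easy.
    rewrite (rGamma_recurrence (a - nu)); fold p; ring. }
  assert (Hval : tricomiU nu (1 + nu) x = p).
  { rewrite Hform, (rGamma_nonpole nu) by easy; replace (nu - nu) with (RtoC 0) by ring.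
    field; apply Gamma_neq_0, N1. }
  unfold tricomiU_deriv_at; rewrite Hval; fold p.
  replace (- p * (digamma nu + seriesT nu x +
      upper_gamma (1 - nu) x * (cpow x nu * gamma_series nu x))) with
    (Gamma (- nu) * 1 * kummer nu (1 + nu) x + p * (- digamma nu + seriesS nu x)).
  (* [Gamma(1 - nu) = - nu Gamma(- nu)] matches the cofactor [Gamma(- nu) nu h nu x]. *)
  2: { rewrite <- Cplus_assoc, seriesS_upper_gamma, kummer_shifted by easy.
       replace (1 - nu) with (- nu + 1) by ring; rewrite Gamma_recurrence by easy.
       assert (Hp : p * cpow x nu = 1).
       { unfold p; rewrite <- cpow_plus by easy.
         replace (- nu + nu) with (RtoC 0) by ring; apply cpow_0_r, Hx. }
       replace (- p * (digamma nu + (- nu * Gamma (- nu) *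
         (cpow x nu * gamma_series nu x) - seriesS nu x)))
         with (p * cpow x nu * (nu * Gamma (- nu) * gamma_series nu x)
           + p * (- digamma nu + seriesS nu x)) by ring.
       rewrite Hp; ring. }
  eapply clim_ext with (f := fun a => Gamma (- nu) * rGamma (a - nu + 1) *
    kummer a (1 + nu) x + p * ((Gamma nu * rGamma a *
      (1 + (a - nu) * kummer_quotient (a - nu) (1 - nu) x) - 1) / (a - nu))).
  - apply locally'_C_ball; exists 1%R; split; [lra|]; intros a Ha _.
    rewrite Hform; field; apply Cminus_eq_contra, Ha.
  - assert (Hc : clim (C_near' nu) (fun a => a - nu) 0).
    { replace (RtoC 0) with (nu - nu) by ring.
      apply clim_minus; [apply clim_locally'|apply clim_const]. }
    apply clim_plus; apply clim_mult; try apply clim_const.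
    + apply clim_mult; [apply clim_const|].
      assert (X : clim (C_near' nu)
        (fun a => rGamma (a - nu + 1)) (rGamma 1)).
      { apply clim_continuous_comp.
        - apply rGamma_continuous, nonpole_Re_pos; simpl; lra.
        - assert (Y := clim_plus _ _ _ _ Hc (clim_const (RtoC 1))).
          rewrite Cplus_0_l in Y; exact Y. }
      rewrite rGamma_1 in X; exact X.
    + apply clim_kummer; try easy; [apply clim_locally'|apply clim_const].
    + apply clim_quotient_product; [easy|].
      rewrite <- kummer_quotient_0; apply clim_kummer_quotient; easy.
Qed.

(** * Integer parameters *)

Lemma small_nonint (e : C) (m : Z) : e <> 0 -> (Cmod e < 1)%R -> e <> RtoC (IZR m).
Proof.
  intros He H E; rewrite E, Cmod_R, <- abs_IZR in H.
  apply lt_IZR in H; assert (Hm : m = 0%Z) by lia.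
  apply He; rewrite E, Hm; reflexivity.
Qed.

Lemma nonpole_IZR_plus (m : Z) (e : C) :
  e <> 0 -> (Cmod e < 1)%R -> ~ nonpos_integer (RtoC (IZR m) + e).
Proof.
  intros He H [n Hn]; apply (small_nonint e (- Z.of_nat n - m) He H).
  rewrite minus_IZR, opp_IZR, <- INR_IZR_INZ, RtoC_minus, RtoC_opp, <- Hn; ring.
Qed.

Lemma nonpole_IZR_minus (m : Z) (e : C) :
  e <> 0 -> (Cmod e < 1)%R -> ~ nonpos_integer (RtoC (IZR m) - e).
Proof.
  intros He H; apply (nonpole_IZR_plus m (- e)); [|rewrite Cmod_opp; easy].
  intros E; apply He; replace e with (- - e) by ring; rewrite E; ring.
Qed.

(** The factors of the left product, in reverse order, are the negatives of those of [(e)_n]. *)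
Lemma rising_reflect (e : C) (n : nat) :
  rising (1 - INR n - e) n = RtoC ((-1) ^ n) * rising e n.
Proof.
  induction n as [|n IH]; [simpl; ring|].
  rewrite rising_S_l.
  replace (1 - INR (S n) - e + 1) with (1 - INR n - e)
    by (rewrite S_INR, RtoC_plus; ring).
  rewrite IH; simpl rising; rewrite S_INR, RtoC_plus; simpl pow.
  rewrite RtoC_mult; replace (RtoC (-1)) with (- (1)) by (rewrite <- RtoC_opp; f_equal; ring).
  ring.
Qed.

Lemma sign_square (n : nat) : RtoC ((-1) ^ n) * RtoC ((-1) ^ n) = 1.
Proof.
  rewrite <- RtoC_mult, <- Rpow_mult_distr; replace (-1 * -1)%R with 1%R by ring.
  rewrite pow1; reflexivity.
Qed.

(** For [b = 1 - N - e] the factor [- e] enters [(b)_n] from [n = N] on. Pulling out the whole term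
    ratio at [N] isolates it, and the remaining series is regular at [e = 0]. *)
Lemma kummer_split (c b : C) (x : R) (N : nat) :
  (0 < x)%R -> ~ nonpos_integer b ->
  kummer c b x =
  csum (fun n => rising c n / rising b n * RtoC (x ^ n / INR (fact n))) N +
  RtoC (x ^ N) * (rising c N / rising b N) *
    CSeries (fun k => rising (c + INR N) k / rising (b + INR N) k *
      RtoC (x ^ k / INR (fact (N + k)))).
Proof.
  intros Hx Hb; unfold kummer; rewrite (CSeries_split _ N) by (apply asum_kummer; easy).
  f_equal; rewrite <- CSeries_scal.
  - apply CSeries_ext; intros k; rewrite !rising_plus, pow_add.
    rewrite !RtoC_div, RtoC_mult by apply INR_fact_neq_0.
    field; repeat split; [apply RtoC_fact_neq_0| |];
      apply rising_neq_0; [apply nonpole_plus_INR|]; exact Hb.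
  - eapply asum_le; [|apply (asum_kummer (c + INR N) (b + INR N) x Hx)].
    + intros k; cbv beta; rewrite !Cmod_mult; apply Rmult_le_compat_l;
        [apply Cmod_ge_0|].
      rewrite !Cmod_R; assert (Hxk := pow_lt x k Hx).
      assert (F1 := INR_fact_lt_0 k); assert (F2 := INR_fact_lt_0 (N + k)).
      rewrite !Rabs_pos_eq by (left; apply Rdiv_lt_0_compat; easy).
      apply Rmult_le_compat_l; [lra|]; apply Rinv_le_contravar; [easy|].
      apply le_INR, fact_le; lia.
    + apply nonpole_plus_INR, Hb.
Qed.

(** * Cancellation of the two poles near an integer *)

Section Resonance.
Variables (N : nat) (x : R).
Hypothesis Hx : (0 < x)%R.

(** With [nu = N + e]: the terms of [1F1(a - nu; 1 - nu; x)] from index [N] on, stripped of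
    [x^N (a - nu)_N / (1 - nu)_N]. *)
Definition resonant1 (a e : C) : C :=
  CSeries (fun k => rising (a - e) k / rising (1 - e) k *
    RtoC (x ^ k / INR (fact (N + k)))).

(** [1F1(a; 1 + nu; x) / (1 + e)_N], since [(1 + e)_(N+k) = (1 + e)_N (1 + nu)_k]. *)
Definition resonant2 (a e : C) : C :=
  CSeries (fun k => rising a k / rising (1 + e) (N + k) * RtoC (x ^ k / INR (fact k))).

(* [resonance a e / e] is regular at [e = 0] and carries the logarithmic part
   of the Tricomi function. *)
Definition resonance (a e : C) : C :=
  Gamma (1 + e) * rGamma a * cpow x (- e) * resonant1 a e -
  Gamma (1 - e) * rGamma (a - e) * resonant2 a e.

(** The first [N] terms of [1F1(a - nu; 1 - nu; x)], whose denominators stay away from 0 as [e]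
    tends to 0. *)
Definition regular_head (a e : C) : C :=
  csum (fun n => rising (a - (RtoC (INR N) + e)) n /
    rising (1 - (RtoC (INR N) + e)) n * RtoC (x ^ n / INR (fact n))) N.

Lemma tricomiU_near_integer (a e : C) :
  e <> 0 -> (Cmod e < 1)%R ->
  tricomiU_nonint a (1 + (RtoC (INR N) + e)) (RtoC x) =
  Gamma (RtoC (INR N) + e) * rGamma a * cpow x (- (RtoC (INR N) + e)) *
    regular_head a e +
  RtoC ((-1) ^ N) * rising (a - (RtoC (INR N) + e)) N * (resonance a e / e).
Proof.
  intros He Hs; set (nu := RtoC (INR N) + e).
  assert (Ne : ~ nonpos_integer e).
  { rewrite <- (Cplus_0_l e); apply (nonpole_IZR_plus 0); easy. }
  assert (Nme : ~ nonpos_integer (- e)).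
  { replace (- e) with (RtoC 0 - e) by ring; apply (nonpole_IZR_minus 0); easy. }
  assert (N1e : ~ nonpos_integer (1 + e)) by (apply (nonpole_IZR_plus 1); easy).
  assert (Nmnu : ~ nonpos_integer (- nu)).
  { replace (- nu) with (RtoC (IZR (- Z.of_nat N)) - e)
      by (rewrite opp_IZR, <- INR_IZR_INZ, RtoC_opp; unfold nu; ring).
    apply nonpole_IZR_minus; easy. }
  assert (N1nu : ~ nonpos_integer (1 - nu)).
  { replace (1 - nu) with (- nu + 1) by ring; apply nonpole_plus_1, Nmnu. }
  assert (N1pnu : ~ nonpos_integer (1 + nu)).
  { replace (1 + nu) with (1 + e + INR N) by (unfold nu; ring).
    apply nonpole_plus_INR, N1e. }
  set (s := RtoC ((-1) ^ N)); assert (Hss : s * s = 1) by apply sign_square.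
  assert (Hs0 : s <> 0).
  { intros E; rewrite E, Cmult_0_l in Hss; symmetry in Hss; apply C1_nz, Hss. }
  assert (R1 : rising (1 - nu) N = s * rising e N).
  { unfold s; rewrite <- rising_reflect; f_equal; unfold nu; ring. }
  assert (R2 : rising (- nu) N = s * rising (1 + e) N).
  { unfold s; rewrite <- rising_reflect; f_equal; unfold nu; ring. }
  assert (Q1 := rising_neq_0 e N Ne); assert (Q2 := rising_neq_0 (1 + e) N N1e).
  (* Here and in [G2] the poles surface, with opposite signs: [Gamma(e) = Gamma(1 + e) / e] and
     [Gamma(- e) = - Gamma(1 - e) / e]. *)
  assert (G1 : Gamma nu / rising (1 - nu) N = s * Gamma (1 + e) / e).
  { replace nu with (e + INR N) at 1 by (unfold nu; ring).
    replace (1 + e) with (e + 1) by ring.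
    rewrite R1, Gamma_plus_INR, Gamma_recurrence by easy.
    transitivity (s * s * (Gamma e / s)); [rewrite Hss; field; easy|field; easy]. }
  assert (G2 : Gamma (- nu) * rising (1 + e) N = - (s * Gamma (1 - e) / e)).
  { replace (1 - e) with (- e + 1) by ring; rewrite Gamma_recurrence by easy.
    replace (- e) with (- nu + INR N) at 2 by (unfold nu; ring).
    rewrite Gamma_plus_INR, R2 by easy.
    transitivity (s * s * (Gamma (- nu) * rising (1 + e) N));
      [rewrite Hss; ring|field; easy]. }
  assert (P : cpow x (- nu) * RtoC (x ^ N) = cpow x (- e)).
  { rewrite RtoC_pow, <- cpow_INR, <- cpow_plus by easy; f_equal; unfold nu; ring. }
  assert (R3 : rGamma (a - nu) = rising (a - nu) N * rGamma (a - e)).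
  { rewrite (rGamma_rising _ N); do 2 f_equal; unfold nu; ring. }
  assert (K1 : kummer a (1 + nu) x = rising (1 + e) N * resonant2 a e).
  { unfold kummer, resonant2.
    assert (E : forall k, rising a k / rising (1 + e) (N + k) * RtoC (x ^ k / INR (fact k))
      = / rising (1 + e) N * (rising a k / rising (1 + nu) k *
        RtoC (x ^ k / INR (fact k)))).
    { intros k; rewrite rising_plus.
      replace (1 + e + INR N) with (1 + nu) by (unfold nu; ring).
      field; split; [apply rising_neq_0|]; easy. }
    rewrite (CSeries_ext _ _ E), CSeries_scal by (apply asum_kummer; easy).
    field; easy. }
  assert (K2 : kummer (a - nu) (1 - nu) x = regular_head a e +
    RtoC (x ^ N) * (rising (a - nu) N / rising (1 - nu) N) * resonant1 a e).
  { rewrite (kummer_split _ _ x N) by easy; unfold regular_head, resonant1; fold nu.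
    f_equal; f_equal; apply CSeries_ext; intros k.
    replace (a - nu + INR N) with (a - e) by (unfold nu; ring).
    replace (1 - nu + INR N) with (1 - e) by (unfold nu; ring).
    reflexivity. }
  rewrite tricomiU_nonint_kummer, K1, K2, R3; unfold resonance.
  transitivity (Gamma (- nu) * rising (1 + e) N * rising (a - nu) N * rGamma (a - e) *
      resonant2 a e +
    Gamma nu * rGamma a * cpow x (- nu) * regular_head a e +
    Gamma nu / rising (1 - nu) N * rGamma a * (cpow x (- nu) * RtoC (x ^ N)) *
      rising (a - nu) N * resonant1 a e); [unfold Cdiv; ring|].
  rewrite G1, G2, P; field; easy.
Qed.

End Resonance.

(** * Difference quotients in [e], uniform in [a] *)

Definition punctured (a0 : C) : (C * C -> Prop) -> Prop :=
  nearby a0 0 (fun _ e => e <> 0).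

#[global] Instance punctured_proper (a0 : C) : ProperFilter (punctured a0).
Proof.
  split; [|apply nearby_filter]; intros P [d [Hd HP]].
  destruct (small_shift 0 d Hd) as [w [Hw1 Hw2]].
  exists (a0, w); apply HP; try easy; rewrite Cmod_sub_diag; easy.
Qed.

Lemma clim_punctured_fst (a0 : C) : clim (punctured a0) (fun p => fst p) a0.
Proof. intros d Hd; exists d; split; [easy|]; intros a e Ha _ _; exact Ha. Qed.

Lemma clim_punctured_snd (a0 : C) : clim (punctured a0) (fun p => snd p) 0.
Proof. intros d Hd; exists d; split; [easy|]; intros a e _ He _; exact He. Qed.

Lemma punctured_snd_neq_0 (a0 : C) : punctured a0 (fun p => snd p <> 0).
Proof. exists 1%R; split; [lra|]; intros a e _ _ He; exact He. Qed.

(* Differentiability in the second variable at [e = 0], uniformly for the first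
   variable near [a0]. *)
Definition partial_deriv (a0 : C) (u : C -> C -> C) (d : C) : Prop :=
  clim (punctured a0) (fun p => u (fst p) 0) (u a0 0) /\
  clim (punctured a0) (fun p => (u (fst p) (snd p) - u (fst p) 0) / snd p) d.

Definition ex_partial_deriv (a0 : C) (u : C -> C -> C) : Prop :=
  exists d, partial_deriv a0 u d.

Lemma partial_deriv_clim (a0 : C) (u : C -> C -> C) (d : C) :
  partial_deriv a0 u d -> clim (punctured a0) (fun p => u (fst p) (snd p)) (u a0 0).
Proof.
  intros [H0 H1].
  replace (u a0 0) with (u a0 0 + d * 0) by ring.
  apply clim_ext with (fun p => u (fst p) 0 +
    (u (fst p) (snd p) - u (fst p) 0) / snd p * snd p).
  - generalize (punctured_snd_neq_0 a0); apply filter_imp; intros p Hp; field; easy.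
  - apply clim_plus; [easy|]; apply clim_mult; [easy|apply clim_punctured_snd].
Qed.

Lemma ex_partial_deriv_ext (a0 : C) (u v : C -> C -> C) :
  (forall a e, u a e = v a e) -> ex_partial_deriv a0 u -> ex_partial_deriv a0 v.
Proof.
  intros H [d [H0 H1]]; exists d; split.
  - rewrite <- H; eapply clim_ext; [|exact H0]; apply filter_forall; intros p; apply H.
  - eapply clim_ext; [|exact H1]; apply filter_forall; intros p; rewrite !H; easy.
Qed.

Lemma ex_partial_deriv_mult (a0 : C) (u v : C -> C -> C) :
  ex_partial_deriv a0 u -> ex_partial_deriv a0 v ->
  ex_partial_deriv a0 (fun a e => u a e * v a e).
Proof.
  intros [d Hu] [d' Hv]; exists (d * v a0 0 + u a0 0 * d').
  assert (Hvc := partial_deriv_clim _ _ _ Hv); destruct Hu as [U0 U1], Hv as [V0 V1].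
  split; [apply clim_mult; easy|].
  apply clim_ext with (fun p => (u (fst p) (snd p) - u (fst p) 0) / snd p *
    v (fst p) (snd p) + u (fst p) 0 * ((v (fst p) (snd p) - v (fst p) 0) / snd p)).
  - generalize (punctured_snd_neq_0 a0); apply filter_imp; intros p Hp; field; easy.
  - apply clim_plus; apply clim_mult; easy.
Qed.

Lemma ex_partial_deriv_minus (a0 : C) (u v : C -> C -> C) :
  ex_partial_deriv a0 u -> ex_partial_deriv a0 v ->
  ex_partial_deriv a0 (fun a e => u a e - v a e).
Proof.
  intros [d [U0 U1]] [d' [V0 V1]]; exists (d - d'); split; [apply clim_minus; easy|].
  eapply clim_ext; [|apply (clim_minus _ _ _ _ U1 V1)].
  apply filter_forall; intros p; unfold Cdiv; ring.
Qed.

Lemma ex_partial_deriv_inv (a0 : C) (u : C -> C -> C) :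
  u a0 0 <> 0 -> ex_partial_deriv a0 u -> ex_partial_deriv a0 (fun a e => / u a e).
Proof.
  intros Hn [d Hu]; exists (- (d / (u a0 0 * u a0 0))).
  assert (Huc := partial_deriv_clim _ _ _ Hu); destruct Hu as [U0 U1].
  split; [apply clim_inv; easy|].
  eapply clim_ext with (f := fun p => - ((u (fst p) (snd p) - u (fst p) 0) / snd p /
    (u (fst p) (snd p) * u (fst p) 0))).
  - generalize (filter_and _ _ (punctured_snd_neq_0 a0)
      (filter_and _ _ (clim_neq_0 _ _ Hn U0) (clim_neq_0 _ _ Hn Huc))).
    apply filter_imp; intros p [H1 [H2 H3]]; field; easy.
  - apply clim_opp, clim_div; [apply Cmult_neq_0; easy|easy|apply clim_mult; easy].
Qed.

Lemma ex_partial_deriv_fst (a0 : C) (f : C -> C) :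
  clim (C_near a0) f (f a0) -> ex_partial_deriv a0 (fun a _ => f a).
Proof.
  intros Hf; exists 0; split.
  - apply clim_continuous_comp; [easy|apply clim_punctured_fst].
  - apply clim_ext with (fun _ => 0); [|apply clim_const].
    apply filter_forall; intros p; unfold Cdiv, Cminus; rewrite Cplus_opp_r; ring.
Qed.

Lemma ex_partial_deriv_const (a0 c : C) : ex_partial_deriv a0 (fun _ _ => c).
Proof. apply (ex_partial_deriv_fst a0 (fun _ => c)), clim_const. Qed.

(** The points [g a + k e] and [g a] both move, and form an off-diagonal pair tending to
    [(g a0, g a0)]; convergence along such pairs is strict differentiability. *)
Lemma ex_partial_deriv_strict (a0 k : C) (f g : C -> C) (l : C) :
  k <> 0 -> clim (punctured a0) (fun p => g (fst p)) (g a0) ->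
  strict_deriv f (g a0) l -> ex_partial_deriv a0 (fun a e => f (g a + k * e)).
Proof.
  intros Hk Hg Hf; exists (k * l); split.
  - rewrite Cmult_0_r, Cplus_0_r.
    eapply clim_ext;
      [|apply (clim_continuous_comp f _ (g a0) (clim_locally_derive Hf) Hg)].
    apply filter_forall; intros p; f_equal; ring.
  - apply clim_ext with (fun p => k *
      ((f (g (fst p) + k * snd p) - f (g (fst p))) /
        (g (fst p) + k * snd p - g (fst p)))).
    + generalize (punctured_snd_neq_0 a0); apply filter_imp; intros p Hp.
      rewrite Cmult_0_r, Cplus_0_r; field; split; [easy|].
      replace (g (fst p) + k * snd p - g (fst p)) with (k * snd p) by ring.
      apply Cmult_neq_0; easy.
    + apply clim_mult; [apply clim_const|].
      apply (clim_comp (G := offdiag (g a0))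
        (fun p : C * C => (g (fst p) + k * snd p, g (fst p)))
        (fun pq => (f (fst pq) - f (snd pq)) / (fst pq - snd pq))); [|exact Hf].
      intros P [d [Hd HP]].
      assert (X : clim (punctured a0) (fun p => g (fst p) + k * snd p) (g a0 + k * 0)).
      { apply clim_plus; [easy|]; apply clim_mult;
          [apply clim_const|apply clim_punctured_snd]. }
      replace (g a0 + k * 0) with (g a0) in X by ring.
      unfold filtermap; generalize (filter_and _ _ (punctured_snd_neq_0 a0)
        (filter_and _ _ (Hg d Hd) (X d Hd))).
      apply filter_imp; intros p [H1 [H2 H3]]; apply HP; try easy.
      intros E; apply (Cmult_neq_0 _ _ Hk H1).
      replace (k * snd p) with (g (fst p) + k * snd p - g (fst p)) by ring.
      rewrite E at 1; ring.
Qed.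

Lemma strict_deriv_id (s : C) : strict_deriv (fun z => z) s 1.
Proof.
  eapply clim_ext; [|apply (clim_const 1)].
  exists 1%R; split; [lra|]; intros p q _ _ Hpq; simpl; field.
  apply Cminus_eq_contra, Hpq.
Qed.

Lemma ex_partial_deriv_affine (a0 k : C) (g : C -> C) :
  k <> 0 -> clim (punctured a0) (fun p => g (fst p)) (g a0) ->
  ex_partial_deriv a0 (fun a e => g a + k * e).
Proof.
  intros Hk Hg; apply (ex_partial_deriv_strict a0 k (fun z => z) g 1 Hk Hg).
  apply strict_deriv_id.
Qed.

Lemma ex_partial_deriv_plus_const (a0 c : C) (u : C -> C -> C) :
  ex_partial_deriv a0 u -> ex_partial_deriv a0 (fun a e => u a e + c).
Proof.
  intros H; apply ex_partial_deriv_ext with (fun a e => u a e - - c).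
  - intros a e; ring.
  - apply ex_partial_deriv_minus; [easy|apply ex_partial_deriv_const].
Qed.

Lemma ex_partial_deriv_rising (a0 : C) (u : C -> C -> C) (n : nat) :
  ex_partial_deriv a0 u -> ex_partial_deriv a0 (fun a e => rising (u a e) n).
Proof.
  intros H; induction n as [|n IH]; simpl; [apply ex_partial_deriv_const|].
  apply (ex_partial_deriv_mult _ _ _ IH), ex_partial_deriv_plus_const, H.
Qed.

Lemma opp_1_neq_0 : - (1) <> RtoC 0.
Proof. rewrite <- RtoC_opp; apply RtoC_neq_0; lra. Qed.

Lemma strict_deriv_cpow_0 (x : R) :
  (0 < x)%R -> strict_deriv (cpow x) 0 (RtoC (ln x)).
Proof.
  intros Hx d Hd; set (A := (18 * exp (5 * Rabs (ln x)))%R).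
  assert (HA : (0 < A)%R) by (generalize (exp_pos (5 * Rabs (ln x))); unfold A; lra).
  exists (Rmin 1 (d / (2 * A))); split.
  { apply Rmin_pos; [lra|]; apply Rdiv_lt_0_compat; lra. }
  intros p q Hp Hq Hpq; simpl.
  assert (M1 := Rmin_l 1 (d / (2 * A))); assert (M2 := Rmin_r 1 (d / (2 * A))).
  replace (p - 0) with p in Hp by ring; replace (q - 0) with q in Hq by ring.
  assert (X := cexp_strict_le p q (ln x) ltac:(lra) ltac:(lra)).
  assert (Hn : p - q <> 0) by (apply Cminus_eq_contra, Hpq).
  assert (Hc := proj1 (Cmod_gt_0 _) Hn).
  rewrite !cpow_pos by easy.
  replace ((cexp (p * RtoC (ln x)) - cexp (q * RtoC (ln x))) / (p - q) - RtoC (ln x))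
    with ((cexp (p * RtoC (ln x)) - cexp (q * RtoC (ln x)) - (p - q) * RtoC (ln x))
      / (p - q)) by (field; easy).
  rewrite Cmod_div by easy; apply Rmult_lt_reg_r with (Cmod (p - q)); [easy|].
  unfold Rdiv; rewrite Rmult_assoc, Rinv_l, Rmult_1_r by lra.
  eapply Rle_lt_trans; [exact X|].
  replace (18 * Cmod (p - q) * (Cmod p + Cmod q) * exp (5 * Rabs (ln x)))%R
    with (A * (Cmod p + Cmod q) * Cmod (p - q))%R by (unfold A; ring).
  apply Rmult_lt_compat_r; [easy|].
  apply Rlt_le_trans with (A * (d / (2 * A) + d / (2 * A)))%R.
  - apply Rmult_lt_compat_l; lra.
  - right; field; lra.
Qed.

(** Two uses of [tannery], one for the values at [e = 0] and one for the quotients; hence [M] has to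
    dominate both. *)
Lemma ex_partial_deriv_CSeries (a0 : C) (u : nat -> C -> C -> C) (M : nat -> R) :
  (forall n, ex_partial_deriv a0 (u n)) ->
  punctured a0 (fun p => forall n, (Cmod (u n (fst p) 0) <= M n)%R /\
    (Cmod ((u n (fst p) (snd p) - u n (fst p) 0) / snd p) <= M n)%R) ->
  ex_series M -> ex_partial_deriv a0 (fun a e => CSeries (fun n => u n a e)).
Proof.
  intros Hu HM Hs.
  set (d := fun n => proj1_sig (constructive_indefinite_description _ (Hu n))).
  assert (Hd : forall n, partial_deriv a0 (u n) (d n))
    by (intros n; exact (proj2_sig (constructive_indefinite_description _ (Hu n)))).
  exists (CSeries d); split.
  - apply tannery with M; [intros n; apply Hd| |easy].
    revert HM; apply filter_imp; intros p H n; apply H.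
  - apply clim_ext with
      (fun p => CSeries (fun n => (u n (fst p) (snd p) - u n (fst p) 0) / snd p)).
    + generalize (filter_and _ _ (punctured_snd_neq_0 a0) HM); apply filter_imp.
      intros [a e] [He H]; simpl in He, H |- *.
      assert (A0 : asum (fun n => u n a 0)) by (eapply asum_le; [apply H|easy]).
      assert (A1 : asum (fun n => (u n a e - u n a 0) / e))
        by (eapply asum_le; [apply H|easy]).
      rewrite (CSeries_ext (fun n => u n a e)
        (fun n => u n a 0 + e * ((u n a e - u n a 0) / e))) by (intros n; field; easy).
      rewrite (CSeries_plus _ _ A0 (asum_scal e _ A1)), (CSeries_scal e _ A1).
      field; easy.
    + apply tannery with M; [intros n; apply Hd| |easy].
      revert HM; apply filter_imp; intros p H n; apply H.
Qed.

(** Discrete product rule: each new factor adds a change of the product and a change of the ratio,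
    each at most [rho] times the previous bound, so the growth rate is [2 * rho]. *)
Lemma product_quotient_le (w w0 r r0 : nat -> C) (e : C) (A rho : R) :
  e <> 0 -> (forall k, w (S k) = w k * r k) -> (forall k, w0 (S k) = w0 k * r0 k) ->
  (Cmod (w0 O) <= A)%R -> (Cmod ((w O - w0 O) / e) <= A)%R ->
  (forall k, Cmod (r k) <= rho)%R -> (forall k, Cmod (r0 k) <= rho)%R ->
  (forall k, Cmod ((r k - r0 k) / e) <= rho)%R ->
  forall k, (Cmod (w0 k) <= A * (2 * rho) ^ k)%R /\
    (Cmod ((w k - w0 k) / e) <= A * (2 * rho) ^ k)%R.
Proof.
  intros He Hw Hw0 HA HA' Hr Hr0 Hd.
  assert (P0 : (0 <= A)%R) by (generalize (Cmod_ge_0 (w0 O)); lra).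
  assert (P1 : (0 <= rho)%R) by (generalize (Cmod_ge_0 (r O)) (Hr O); lra).
  induction k as [|k [I0 I1]]; [simpl; lra|].
  assert (P2 : (0 <= A * (2 * rho) ^ k)%R)
    by (apply Rmult_le_pos; [easy|apply pow_le; lra]).
  assert (E : (A * (2 * rho) ^ S k = A * (2 * rho) ^ k * rho + A * (2 * rho) ^ k * rho)%R)
    by (simpl; ring).
  rewrite E; set (B := (A * (2 * rho) ^ k)%R) in *; split.
  - rewrite Hw0, Cmod_mult.
    assert (X : (Cmod (w0 k) * Cmod (r0 k) <= B * rho)%R)
      by (apply Rmult_le_compat; auto using Cmod_ge_0).
    assert (0 <= B * rho)%R by (apply Rmult_le_pos; easy); lra.
  - rewrite Hw, Hw0.
    replace ((w k * r k - w0 k * r0 k) / e) with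
      ((w k - w0 k) / e * r k + w0 k * ((r k - r0 k) / e)) by (field; easy).
    eapply Rle_trans; [apply Cmod_triangle|]; rewrite !Cmod_mult.
    apply Rplus_le_compat; apply Rmult_le_compat; auto using Cmod_ge_0.
Qed.

(** [|1 + e + m| >= m + 1 - 1/2 >= (m + 1) / 2]; this is why [e] is confined to radius [1 / 2]
    below. *)
Lemma Cmod_1_plus_ge (e : C) (m : nat) :
  (Cmod e <= 1 / 2)%R -> (1 / 2 * INR (S m) <= Cmod (1 + e + INR m))%R.
Proof.
  intros He; assert (X := Cmod_ge_dist (1 + e + INR m) (RtoC (INR (S m)))).
  replace (1 + e + INR m - INR (S m)) with e in X
    by (rewrite S_INR, RtoC_plus; ring).
  rewrite Cmod_R, Rabs_pos_eq in X by apply pos_INR.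
  rewrite S_INR in *; generalize (pos_INR m); lra.
Qed.

Lemma Cmod_plus_INR_le (a : C) (A : R) (m : nat) :
  (Cmod a <= A)%R -> (Cmod (a + INR m) <= (A + 1) * INR (S m))%R.
Proof.
  intros Ha; eapply Rle_trans; [apply Cmod_triangle|].
  rewrite Cmod_R, Rabs_pos_eq by apply pos_INR; rewrite S_INR.
  generalize (pos_INR m) (Cmod_ge_0 a); nra.
Qed.

Lemma Cmod_div_le (p q : C) (P Q c : R) :
  (Cmod p <= P)%R -> (Q <= Cmod q)%R -> (0 < Q)%R -> (P <= c * Q)%R ->
  (Cmod (p / q) <= c)%R.
Proof.
  intros HP HQ HQ0 H.
  rewrite Cmod_div by (apply Cmod_gt_0; lra).
  apply Rmult_le_reg_r with (Cmod q); [lra|].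
  unfold Rdiv; rewrite Rmult_assoc, Rinv_l, Rmult_1_r by lra.
  assert (0 <= c)%R by (generalize (Cmod_ge_0 p); nra).
  apply Rle_trans with (c * Q)%R; [lra|apply Rmult_le_compat_l; easy].
Qed.

Lemma Cmod_fact_term_le (z : C) (x B : R) (k m : nat) :
  (0 < x)%R -> (Cmod z <= B)%R ->
  (Cmod (z * RtoC (x ^ k / INR (fact (m + k)))) <= B * (x ^ k / INR (fact k)))%R.
Proof.
  intros Hx HB; assert (Hxk := pow_lt x k Hx).
  assert (F1 := INR_fact_lt_0 k); assert (F2 := INR_fact_lt_0 (m + k)).
  rewrite Cmod_mult, Cmod_R, Rabs_pos_eq by (left; apply Rdiv_lt_0_compat; easy).
  apply Rmult_le_compat; [apply Cmod_ge_0| |easy|].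
  - left; apply Rdiv_lt_0_compat; easy.
  - apply Rmult_le_compat_l; [lra|]; apply Rinv_le_contravar; [easy|].
    apply le_INR, fact_le; lia.
Qed.

Lemma Cdiv_mult_mult (p q r s : C) : q <> 0 -> s <> 0 -> p * r / (q * s) = p / q * (r / s).
Proof. intros; field; easy. Qed.

Lemma quotient_difference (p q p' q' e d : C) :
  q <> 0 -> q' <> 0 -> e <> 0 -> p * q' - p' * q = e * d ->
  (p / q - p' / q') / e = d / (q' * q).
Proof.
  intros Hq Hq' He H.
  transitivity ((p * q' - p' * q) / (e * (q' * q))); [field; easy|].
  rewrite H; field; easy.
Qed.

Lemma punctured_bounds (a0 : C) :
  punctured a0 (fun p => (Cmod (fst p) <= Cmod a0 + 1)%R /\
    (Cmod (snd p) <= 1 / 2)%R /\ snd p <> 0).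
Proof.
  exists (1 / 2)%R; split; [lra|]; intros a e Ha He Hn; simpl.
  replace (e - 0) with e in He by ring.
  repeat split; [|lra|easy]; generalize (Cmod_le_dist a a0); lra.
Qed.

(** For hypergeometric-type series only the ratio of consecutive coefficients needs estimates
    uniform in [k]. Coefficients and their quotients then grow geometrically, which the factorial
    beats. *)
Lemma ex_partial_deriv_ratio_series (a0 : C) (x rho : R) (m : nat)
  (w r : nat -> C -> C -> C) :
  (0 < x)%R -> (forall k, ex_partial_deriv a0 (w k)) ->
  (forall k a e, (Cmod a <= Cmod a0 + 1)%R -> (Cmod e <= 1 / 2)%R ->
    w (S k) a e = w k a e * r k a e /\ (Cmod (r k a e) <= rho)%R /\
    (e <> 0 -> Cmod ((r k a e - r k a 0) / e) <= rho)%R) ->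
  ex_partial_deriv a0
    (fun a e => CSeries (fun k => w k a e * RtoC (x ^ k / INR (fact (m + k))))).
Proof.
  intros Hx Hw Hr; destruct (Hw O) as [d0 [I0 I1]].
  (* Bounds both the zeroth coefficient near [a0] and its quotient in [e], each within 1 of its
     limit. *)
  set (B := (Cmod (w O a0 0) + 1 + (Cmod d0 + 1))%R).
  apply (ex_partial_deriv_CSeries a0
    (fun k a e => w k a e * RtoC (x ^ k / INR (fact (m + k))))
    (fun k => B * ((2 * rho * x) ^ k / INR (fact k)))%R).
  - intros k; apply ex_partial_deriv_mult; [apply Hw|apply ex_partial_deriv_const].
  - generalize (filter_and _ _ (punctured_bounds a0)
      (filter_and _ _ (clim_bounded _ _ I0) (clim_bounded _ _ I1))).
    apply filter_imp; intros [a e] [[Ha [He Hn]] [J0 J1]] k.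
    simpl in Ha, He, Hn, J0, J1 |- *.
    assert (D0 : (Cmod 0 <= 1 / 2)%R) by (rewrite Cmod_0; lra).
    assert (Gd := Cmod_ge_0 d0); assert (Gw := Cmod_ge_0 (w O a0 0)).
    destruct (product_quotient_le (fun k => w k a e) (fun k => w k a 0)
      (fun k => r k a e) (fun k => r k a 0) e B rho) with (k := k) as [X0 X1];
      try (intros j; apply Hr; easy); try (unfold B; lra); [easy|].
    assert (T : (B * ((2 * rho * x) ^ k / INR (fact k)) =
      B * (2 * rho) ^ k * (x ^ k / INR (fact k)))%R).
    { rewrite (Rpow_mult_distr (2 * rho) x); unfold Rdiv; ring. }
    rewrite T; split; [apply Cmod_fact_term_le; easy|].
    replace ((w k a e * RtoC (x ^ k / INR (fact (m + k))) -
      w k a 0 * RtoC (x ^ k / INR (fact (m + k)))) / e)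
      with ((w k a e - w k a 0) / e * RtoC (x ^ k / INR (fact (m + k))))
      by (unfold Cdiv; ring).
    apply Cmod_fact_term_le; easy.
  - apply ex_series_exp_bound.
Qed.

Lemma Cmod_0_le_half : (Cmod 0 <= 1 / 2)%R.
Proof. rewrite Cmod_0; lra. Qed.

Lemma plus_INR_neq_0_of_small (e : C) (m : nat) :
  (Cmod e <= 1 / 2)%R -> 1 + e + INR m <> 0.
Proof.
  intros He; apply Cmod_gt_0; assert (X := Cmod_1_plus_ge e m He).
  assert (Y := lt_0_INR (S m) (Nat.lt_0_succ m)); lra.
Qed.

Lemma rising_neq_0_of_small (e : C) (m : nat) :
  (Cmod e <= 1 / 2)%R -> rising (1 + e) m <> 0.
Proof.
  intros He; induction m as [|m IH]; simpl; [apply C1_nz|].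
  apply Cmult_neq_0; [easy|apply plus_INR_neq_0_of_small, He].
Qed.

(** * Regularity of the resonance at [e = 0] *)

Section Regularity.
Variables (N : nat) (x : R) (a0 : C).
Hypothesis Hx : (0 < x)%R.

Lemma ex_partial_deriv_shift : ex_partial_deriv a0 (fun a e => a - e).
Proof.
  apply ex_partial_deriv_ext with (fun a e => a + (- (1)) * e); [intros; ring|].
  apply (ex_partial_deriv_affine a0 (- (1)) (fun a => a));
    [apply opp_1_neq_0|apply clim_punctured_fst].
Qed.

Lemma ex_partial_deriv_1_minus : ex_partial_deriv a0 (fun a e => 1 - e).
Proof.
  apply ex_partial_deriv_ext with (fun a e => 1 + (- (1)) * e); [intros; ring|].
  apply (ex_partial_deriv_affine a0 (- (1)) (fun _ => 1));
    [apply opp_1_neq_0|apply clim_const].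
Qed.

Lemma ex_partial_deriv_1_plus : ex_partial_deriv a0 (fun a e => 1 + e).
Proof.
  apply ex_partial_deriv_ext with (fun a e => 1 + 1 * e); [intros; ring|].
  apply (ex_partial_deriv_affine a0 1 (fun _ => 1)); [apply C1_nz|apply clim_const].
Qed.

Lemma nonpole_1 : ~ nonpos_integer 1.
Proof. apply nonpole_Re_pos; simpl; lra. Qed.

Lemma ex_partial_deriv_resonant1 : ex_partial_deriv a0 (resonant1 N x).
Proof.
  (* The numerator of the ratio is at most [(|a0| + 3) (k + 1)], the denominator at least
     [(k + 1) / 2]. *)
  apply (ex_partial_deriv_ratio_series a0 x (2 * (Cmod a0 + 3)) N
    (fun k a e => rising (a - e) k / rising (1 - e) k)
    (fun k a e => (a - e + INR k) / (1 - e + INR k))); [easy| |].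
  - intros k; apply ex_partial_deriv_mult;
      [apply ex_partial_deriv_rising, ex_partial_deriv_shift|].
    apply (ex_partial_deriv_inv a0 (fun _ e => rising (1 - e) k)).
    + apply rising_neq_0; replace (1 - 0) with (RtoC 1) by ring; apply nonpole_1.
    + apply ex_partial_deriv_rising, ex_partial_deriv_1_minus.
  - intros k a e Ha He; assert (Ga := Cmod_ge_0 a0).
    assert (Hme : (Cmod (- e) <= 1 / 2)%R) by (rewrite Cmod_opp; easy).
    assert (Z1 : 1 - e + INR k <> 0) by apply (plus_INR_neq_0_of_small (- e) k Hme).
    assert (Dn : (1 / 2 * INR (S k) <= Cmod (1 - e + INR k))%R)
      by apply (Cmod_1_plus_ge (- e) k Hme).
    assert (Y := lt_0_INR (S k) (Nat.lt_0_succ k)).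
    split; [|split; [|intros Hn]].
    + apply Cdiv_mult_mult; [apply (rising_neq_0_of_small (- e) k Hme)|exact Z1].
    + assert (Hae : (Cmod (a - e) <= Cmod a0 + 2)%R)
        by (generalize (Cmod_sub_triangle a e); lra).
      apply (Cmod_div_le _ _ _ _ _ (Cmod_plus_INR_le (a - e) _ k Hae) Dn); [lra|].
      right; field.
    + assert (E0 : 1 - 0 + INR k = RtoC (INR (S k)))
        by (rewrite S_INR, RtoC_plus; ring).
      rewrite (quotient_difference _ _ _ _ e (a - 1))
        by (try easy; rewrite ?E0; try apply RtoC_S_neq_0; rewrite ?S_INR, ?RtoC_plus; ring).
      rewrite E0.
      assert (Y1 : (1 <= INR (S k))%R) by (rewrite S_INR; generalize (pos_INR k); lra).
      assert (Y2 : (1 * (1 / 2 * INR (S k)) <=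
        Cmod (RtoC (INR (S k)) * (1 - e + INR k)))%R).
      { rewrite Cmod_mult; apply Rmult_le_compat; [lra|lra| |exact Dn].
        rewrite Cmod_R, Rabs_pos_eq; lra. }
      assert (Y3 : (Cmod (a - 1) <= Cmod a0 + 2)%R).
      { generalize (Cmod_sub_triangle a 1); rewrite Cmod_1; lra. }
      apply (Cmod_div_le _ _ _ _ _ Y3 Y2); [lra|nra].
Qed.

Lemma ex_partial_deriv_inv_rising :
  forall m, ex_partial_deriv a0 (fun _ e => / rising (1 + e) m).
Proof.
  intros m; apply (ex_partial_deriv_inv a0 (fun _ e => rising (1 + e) m)).
  - apply rising_neq_0; rewrite Cplus_0_r; apply nonpole_1.
  - apply ex_partial_deriv_rising, ex_partial_deriv_1_plus.
Qed.

Lemma ex_partial_deriv_resonant2 : ex_partial_deriv a0 (resonant2 N x).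
Proof.
  apply (ex_partial_deriv_ratio_series a0 x (2 * (Cmod a0 + 3)) 0
    (fun k a e => rising a k / rising (1 + e) (N + k))
    (fun k a e => (a + INR k) / (1 + e + INR (N + k)))); [easy| |].
  - intros k; apply ex_partial_deriv_mult; [|apply ex_partial_deriv_inv_rising].
    apply ex_partial_deriv_rising, (ex_partial_deriv_fst a0 (fun a => a)).
    intros c Hc; apply locally_C_ball; exists c; split; easy.
  - intros k a e Ha He; assert (Ga := Cmod_ge_0 a0).
    assert (Z1 := plus_INR_neq_0_of_small e (N + k) He).
    assert (Z2 := plus_INR_neq_0_of_small 0 (N + k) Cmod_0_le_half).
    assert (Sm : (INR (S k) <= INR (S (N + k)))%R) by (apply le_INR; lia).
    assert (Sp : (1 <= INR (S k))%R) by (rewrite S_INR; generalize (pos_INR k); lra).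
    assert (Rb : (Cmod ((a + INR k) / (1 + e + INR (N + k))) <=
      2 * (Cmod a0 + 3))%R).
    { apply (Cmod_div_le _ _ _ _ _ (Cmod_plus_INR_le a _ k Ha)
        (Cmod_1_plus_ge e (N + k) He)); [lra|nra]. }
    split; [|split; [exact Rb|intros Hn]].
    + rewrite Nat.add_succ_r; apply Cdiv_mult_mult; [|exact Z1].
      apply rising_neq_0_of_small, He.
    (* The quotient is minus the ratio itself divided by [1 + N + k], so the bound on the ratio
       carries over. *)
    + rewrite (quotient_difference _ _ _ _ e (1 * - (a + INR k)))
        by (try easy; ring).
      rewrite Cdiv_mult_mult by easy.
      replace (1 / (1 + 0 + INR (N + k)) * (- (a + INR k) /
        (1 + e + INR (N + k)))) with
        (- ((a + INR k) / (1 + e + INR (N + k))) /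
          (1 + 0 + INR (N + k))) by (unfold Cdiv; ring).
      rewrite <- Cmod_opp in Rb.
      assert (Y2 : (1 <= Cmod (1 + 0 + INR (N + k)))%R).
      { replace (1 + 0 + INR (N + k)) with (RtoC (INR (S (N + k))))
          by (rewrite S_INR, RtoC_plus; ring).
        rewrite Cmod_R, Rabs_pos_eq by apply pos_INR; lra. }
      apply (Cmod_div_le _ _ _ _ _ Rb Y2); lra.
Qed.

Lemma ex_partial_deriv_resonance :
  ~ nonpos_integer a0 -> ex_partial_deriv a0 (resonance N x).
Proof.
  intros Ha; destruct (Gamma_strict_deriv 1 nonpole_1) as [g Hg].
  destruct (Gamma_strict_deriv a0 Ha) as [ga Hga].
  assert (Hr := rGamma_strict_deriv a0 ga Ha Hga).
  apply ex_partial_deriv_minus; apply ex_partial_deriv_mult;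
    [| apply ex_partial_deriv_resonant1 | | apply ex_partial_deriv_resonant2].
  - apply ex_partial_deriv_mult; [apply ex_partial_deriv_mult|].
    + apply ex_partial_deriv_ext with (fun a e => Gamma (1 + 1 * e));
        [intros; do 2 f_equal; ring|].
      apply (ex_partial_deriv_strict a0 1 Gamma (fun _ => 1) g);
        [apply C1_nz|apply clim_const|exact Hg].
    + apply ex_partial_deriv_fst, rGamma_continuous, Ha.
    + apply ex_partial_deriv_ext with (fun a e => cpow x (0 + (- (1)) * e));
        [intros; f_equal; ring|].
      apply (ex_partial_deriv_strict a0 (- (1)) (cpow x) (fun _ => 0) (RtoC (ln x)));
        [apply opp_1_neq_0|apply clim_const|apply strict_deriv_cpow_0, Hx].
  - apply ex_partial_deriv_mult.
    + apply ex_partial_deriv_ext with (fun a e => Gamma (1 + (- (1)) * e));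
        [intros; f_equal; ring|].
      apply (ex_partial_deriv_strict a0 (- (1)) Gamma (fun _ => 1) g);
        [apply opp_1_neq_0|apply clim_const|exact Hg].
    + apply ex_partial_deriv_ext with (fun a e => rGamma (a + (- (1)) * e));
        [intros; f_equal; ring|].
      apply (ex_partial_deriv_strict a0 (- (1)) rGamma (fun a => a)
        (- ga / (Gamma a0 * Gamma a0)));
        [apply opp_1_neq_0|apply clim_punctured_fst|exact Hr].
Qed.

(** At [e = 0] both series have the coefficients [(a)_k / (k! (N + k)!)], and their prefactors are
    both [1 / Gamma(a)]. *)
Lemma resonance_0 (a : C) : resonance N x a 0 = 0.
Proof.
  unfold resonance, resonant1, resonant2.
  replace (- RtoC 0) with (RtoC 0) by ring; rewrite cpow_0_r by easy.
  rewrite Cplus_0_r; replace (a - 0) with a by ring; replace (1 - 0) with (RtoC 1) by ring.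
  rewrite Gamma_1, (CSeries_ext _ (fun k => rising a k / rising 1 (N + k) *
    RtoC (x ^ k / INR (fact k)))); [ring|].
  intros k; assert (R1 := rising_fact 0 k); assert (R2 := rising_fact 0 (N + k)).
  simpl (INR (fact 0)) in R1, R2; simpl (INR 1) in R1, R2.
  rewrite Cmult_1_l in R1, R2; rewrite R1, R2.
  change (0 + k)%nat with k; change (0 + (N + k))%nat with (N + k)%nat.
  rewrite !RtoC_div by apply INR_fact_neq_0.
  field; split; apply RtoC_fact_neq_0.
Qed.

Lemma resonance_clim :
  ~ nonpos_integer a0 ->
  exists d, clim (punctured a0) (fun p => resonance N x (fst p) (snd p) / snd p) d.
Proof.
  intros Ha; destruct (ex_partial_deriv_resonance Ha) as [d [_ H]]; exists d.
  eapply clim_ext; [|exact H]; apply filter_forall; intros p; cbv beta.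
  rewrite resonance_0; unfold Cminus; rewrite Copp_0, Cplus_0_r; reflexivity.
Qed.

End Regularity.

Lemma rising_1_minus_INR_neq_0 (N n : nat) :
  (n < N)%nat -> rising (1 - INR N) n <> 0.
Proof.
  induction n as [|n IH]; intros Hn; simpl; [apply C1_nz|].
  apply Cmult_neq_0; [apply IH; lia|]; intros E.
  apply (not_0_INR (N - S n)); [lia|]; apply RtoC_inj.
  rewrite minus_INR, RtoC_minus, S_INR, RtoC_plus by lia.
  transitivity (- (1 - INR N + INR n)); [ring|rewrite E; ring].
Qed.

Lemma clim_regular_head {T : Type} {F : (T -> Prop) -> Prop} {FF : Filter F}
  (N : nat) (x : R) (f g : T -> C) (a : C) :
  clim F f a -> clim F g 0 ->
  clim F (fun p => regular_head N x (f p) (g p)) (regular_head N x a 0).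
Proof.
  intros Hf Hg; unfold regular_head.
  assert (Hs : clim F (fun p => RtoC (INR N) + g p) (RtoC (INR N) + 0))
    by (apply clim_plus; [apply clim_const|easy]).
  apply clim_csum; intros n Hn; apply clim_mult; [|apply clim_const].
  apply clim_div.
  - rewrite Cplus_0_r; apply rising_1_minus_INR_neq_0, Hn.
  - apply clim_rising, clim_minus; easy.
  - apply clim_rising, clim_minus; [apply clim_const|easy].
Qed.

Lemma clim_cpow_exponent {T : Type} {F : (T -> Prop) -> Prop} {FF : Filter F}
  (x : R) (g : T -> C) (s : C) :
  (0 < x)%R -> clim F g s -> clim F (fun p => cpow x (g p)) (cpow x s).
Proof.
  intros Hx Hg.
  assert (H0 : clim F (fun p => g p - s) 0).
  { replace (RtoC 0) with (s - s) by ring; apply clim_minus; [easy|apply clim_const]. }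
  assert (X := clim_continuous_comp _ _ _ (clim_locally_derive (strict_deriv_cpow_0 x Hx)) H0).
  assert (Y := clim_mult _ _ _ _ (clim_const (cpow x s)) X); cbv beta in Y.
  rewrite cpow_0_r, Cmult_1_r in Y by easy.
  eapply clim_ext; [|exact Y]; apply filter_forall; intros p; cbv beta.
  rewrite <- cpow_plus by easy; f_equal; ring.
Qed.

Lemma nonpole_INR_S (M : nat) : ~ nonpos_integer (RtoC (INR (S M))).
Proof. apply nonpole_Re_pos; exact (lt_0_INR (S M) (Nat.lt_0_succ M)). Qed.

Lemma locally'_comp_punctured (z a0 : C) (f g : C -> C) :
  clim (C_near' z) f a0 ->
  clim (C_near' z) g 0 ->
  C_near' z (fun w => g w <> 0) ->
  filterlim (fun w => (f w, g w)) (C_near' z) (punctured a0).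
Proof.
  intros Hf Hg Hn P [d [Hd HP]]; unfold filtermap.
  generalize (filter_and _ _ Hn (filter_and _ _ (Hf d Hd) (Hg d Hd))).
  apply filter_imp; intros w [H1 [H2 H3]]; apply HP; easy.
Qed.

Lemma locally'_neq (z : C) :
  C_near' z (fun w => w <> z).
Proof. apply locally'_C_ball; exists 1%R; split; [lra|]; easy. Qed.

Lemma locally'_sub_neq_0 (z : C) :
  C_near' z (fun w => w - z <> 0).
Proof.
  generalize (locally'_neq z); apply filter_imp; intros w Hw; apply Cminus_eq_contra, Hw.
Qed.

Lemma clim_locally'_sub (z : C) :
  clim (C_near' z) (fun w => w - z) 0.
Proof.
  replace (RtoC 0) with (z - z) by ring.
  apply clim_minus; [apply clim_locally'|apply clim_const].
Qed.

(** * The derivative at a positive integer *)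

Section IntegerParameter.
Variables (M : nat) (x : R).
Hypothesis Hx : (0 < x)%R.
Let N := S M.
Let n0 := RtoC (INR N).
Let sgn := RtoC ((-1) ^ N).

(** The [D] of the overview, taken along [e] with [a] fixed; [clim_resonance] identifies it with the
    joint limit. *)
Definition resonance_limit (a : C) : C := C_lim (fun e => resonance (S M) x a e / e) 0.

Lemma clim_resonance (a : C) :
  ~ nonpos_integer a ->
  clim (punctured a) (fun p => resonance N x (fst p) (snd p) / snd p) (resonance_limit a).
Proof.
  intros Ha; destruct (resonance_clim N x a Hx Ha) as [d Hd].
  replace (resonance_limit a) with d; [easy|].
  symmetry; apply C_lim_clim.
  apply (clim_comp (G := punctured a) (fun e => (a, e))
    (fun p => resonance N x (fst p) (snd p) / snd p)); [|exact Hd].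
  apply locally'_comp_punctured; [apply clim_const|apply clim_locally'|apply locally'_neq].
Qed.

(** The joint limit keeps [resonance a z / z] within [e / 2] of [D(a0)] for all [a] near [a0] and
    small [z]; letting [z] tend to 0 with [a] fixed bounds [D(a) - D(a0)]. *)
Lemma clim_resonance_limit (a0 : C) :
  ~ nonpos_integer a0 ->
  clim (C_near' a0) resonance_limit (resonance_limit a0).
Proof.
  intros Ha e He; assert (He2 : (0 < e / 2)%R) by lra.
  destruct (clim_resonance a0 Ha (e / 2)%R He2) as [d [Hd H]].
  destruct (proj1 (locally_C_ball _ _) (nonpole_nearby a0 Ha)) as [d' [Hd' Hnp]].
  apply locally'_C_ball; exists (Rmin d d'); split; [apply Rmin_pos; easy|].
  intros a _ Hlt; assert (R1 := Rmin_l d d'); assert (R2 := Rmin_r d d').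
  assert (Ha' : ~ nonpos_integer a) by (apply Hnp; lra).
  apply Rle_lt_trans with (e / 2)%R; [|lra].
  apply (clim_bound (F := C_near' (RtoC 0))
    (fun z => resonance N x a z / z - resonance_limit a0)).
  - apply clim_minus; [|apply clim_const].
    apply (clim_comp (G := punctured a) (fun z => (a, z))
      (fun p => resonance N x (fst p) (snd p) / snd p)); [|apply clim_resonance, Ha'].
    apply locally'_comp_punctured; [apply clim_const|apply clim_locally'|apply locally'_neq].
  - apply locally'_C_ball; exists d; split; [easy|]; intros z Hz1 Hz2; left.
    apply (H a z); [lra|easy|easy].
Qed.

Lemma tricomiU_integer (a : C) :
  ~ nonpos_integer a ->
  tricomiU a (1 + n0) x =
  Gamma n0 * rGamma a * cpow x (- n0) * regular_head N x a 0 +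
  sgn * rising (a - n0) N * resonance_limit a.
Proof.
  intros Ha; unfold tricomiU; destruct excluded_middle_informative as [_|Hn].
  2: { exfalso; apply Hn; exists (1 + Z.of_nat N)%Z.
       rewrite plus_IZR, <- INR_IZR_INZ, RtoC_plus; reflexivity. }
  apply C_lim_clim.
  assert (He := clim_locally'_sub (1 + n0)).
  assert (Hne := locally'_sub_neq_0 (1 + n0)).
  set (e := fun b : C => b - (1 + n0)) in *.
  eapply clim_ext with (f := fun b =>
    Gamma (n0 + e b) * rGamma a * cpow x (- (n0 + e b)) * regular_head N x a (e b) +
    sgn * rising (a - (n0 + e b)) N * (resonance N x a (e b) / e b)).
  - generalize (filter_and _ _ Hne (He 1%R Rlt_0_1)); apply filter_imp.
    intros b [H1 H2]; fold (e b) in H1; symmetry.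
    replace (b - (1 + n0) - 0) with (e b) in H2 by (unfold e; ring).
    replace b with (1 + (n0 + e b)) at 1 by (unfold e; ring).
    apply tricomiU_near_integer; [exact Hx|exact H1|exact H2].
  - assert (Hs : clim (C_near' (1 + n0)) (fun b => n0 + e b) n0).
    { assert (X := clim_plus _ _ _ _ (clim_const n0) He); rewrite Cplus_0_r in X; exact X. }
    apply clim_plus; apply clim_mult.
    + apply clim_mult.
      * apply clim_mult; [|apply clim_const].
        apply clim_continuous_comp; [apply Gamma_continuous, nonpole_INR_S|easy].
      * apply clim_cpow_exponent; [easy|apply clim_opp, Hs].
    + apply clim_regular_head; [apply clim_const|exact He].
    + apply clim_mult; [apply clim_const|].
      apply clim_rising, clim_minus; [apply clim_const|exact Hs].
    + apply (clim_comp (G := punctured a) (fun b => (a, e b))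
        (fun p => resonance N x (fst p) (snd p) / snd p)); [|apply clim_resonance, Ha].
      apply locally'_comp_punctured; [apply clim_const|exact He|exact Hne].
Qed.

(** Finite counterpart of [kummer_quotient]: the head minus its constant term 1, divided by
    [a - n0]. *)
Definition head_quotient (a : C) : C :=
  csum (fun n => rising (a - n0 + 1) n / rising (1 - n0) (S n) *
    RtoC (x ^ S n / INR (fact (S n)))) M.

Lemma regular_head_quotient (a : C) :
  regular_head N x a 0 = 1 + (a - n0) * head_quotient a.
Proof.
  unfold regular_head, head_quotient; unfold N at 3; rewrite csum_S.
  fold n0; rewrite Cplus_0_r; f_equal.
  - simpl; rewrite Rdiv_1_r; field; apply C1_nz.
  - rewrite <- csum_scal; apply csum_ext; intros n _.
    rewrite rising_S_l; unfold Cdiv; ring.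
Qed.

Definition headS (nu : C) : C :=
  csum (fun n => RtoC (x ^ S n / INR (S n)) / rising (1 - nu) (S n)) M.

Lemma head_quotient_headS : head_quotient n0 = headS n0.
Proof.
  unfold head_quotient, headS; apply csum_ext; intros n Hn.
  replace (n0 - n0 + 1) with (RtoC 1) by ring.
  assert (R1 := rising_fact 0 n).
  simpl (INR (fact 0)) in R1; simpl (INR 1) in R1; rewrite Cmult_1_l in R1.
  rewrite R1; change (0 + n)%nat with n.
  rewrite !RtoC_div, RtoC_fact_S by (apply INR_fact_neq_0 || (apply not_0_INR; lia)).
  assert (F1 := RtoC_fact_neq_0 n); assert (F2 := RtoC_S_neq_0 n).
  unfold Cdiv; generalize (/ rising (1 - n0) (S n)); intros r; field; easy.
Qed.

(** On the line [a = nu = N + e] one has [a - e = N]. So [1 / Gamma(a - e)] is [1 / (N-1)!],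
    [resonant1] is up to a factor the tail of [S], and [resonant2] is [h nu x / (1 + e)_(N-1)]. What
    the tail lacks of [S] is [headS]. *)
Lemma resonance_identity (e : C) :
  e <> 0 -> (Cmod e < 1)%R ->
  cpow x (n0 + e) * (sgn * INR (fact M)) * (resonance N x (n0 + e) e / e) =
  - (seriesT (n0 + e) x + upper_gamma (1 - (n0 + e)) x *
      (cpow x (n0 + e) * gamma_series (n0 + e) x)) - headS (n0 + e).
Proof.
  intros He Hs; set (nu := n0 + e).
  assert (Ne : ~ nonpos_integer e).
  { rewrite <- (Cplus_0_l e); apply (nonpole_IZR_plus 0); easy. }
  assert (N1e : ~ nonpos_integer (1 + e)) by (apply (nonpole_IZR_plus 1); easy).
  assert (N1me : ~ nonpos_integer (1 - e)) by (apply (nonpole_IZR_minus 1); easy).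
  assert (Nnu : ~ nonpos_integer nu).
  { unfold nu, n0; rewrite INR_IZR_INZ; apply nonpole_IZR_plus; easy. }
  assert (N1nu : ~ nonpos_integer (1 - nu)).
  { replace (1 - nu) with (RtoC (IZR (1 - Z.of_nat N)) - e).
    - apply nonpole_IZR_minus; easy.
    - rewrite minus_IZR, <- INR_IZR_INZ, RtoC_minus; unfold nu, n0; ring. }
  assert (En0 : n0 = 1 + INR M).
  { unfold n0, N; rewrite S_INR, RtoC_plus; ring. }
  assert (Hss : sgn * sgn = 1) by apply sign_square.
  assert (Hs0 : sgn <> 0).
  { intros E; rewrite E, Cmult_0_l in Hss; symmetry in Hss; apply C1_nz, Hss. }
  assert (Q := rising_neq_0 (1 + e) M N1e).
  assert (Rnu : rising (1 - nu) N = sgn * (e * rising (1 + e) M)).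
  { replace (1 + e) with (e + 1) by ring; rewrite <- rising_S_l; unfold sgn, N.
    rewrite <- rising_reflect; f_equal; unfold nu, n0, N; ring. }
  assert (G1 : Gamma (1 - e) = rising (1 - nu) N * Gamma (1 - nu)).
  { rewrite <- Gamma_plus_INR by easy; f_equal; unfold nu, n0; ring. }
  assert (G1e := Gamma_neq_0 _ N1e).
  assert (G2 : rGamma nu = / (rising (1 + e) M * Gamma (1 + e))).
  { rewrite rGamma_nonpole, <- Gamma_plus_INR by easy; do 2 f_equal.
    unfold nu; rewrite En0; ring. }
  assert (G3 : rGamma (nu - e) = / INR (fact M)).
  { replace (nu - e) with (1 + INR M) by (unfold nu; rewrite En0; ring).
    rewrite rGamma_nonpole, Gamma_plus_INR, Gamma_1 by
      (try apply nonpole_plus_INR; apply nonpole_1).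
    assert (R1 := rising_fact 0 M); simpl (INR (fact 0)) in R1; simpl (INR 1) in R1.
    rewrite Cmult_1_l in R1; rewrite R1, Cmult_1_r; reflexivity. }
  assert (FM := RtoC_fact_neq_0 M).
  assert (A1 := asum_shift _ M (asum_seriesS nu x Hx N1nu)); cbv beta in A1.
  assert (Tl : seriesS nu x = headS nu + RtoC (x ^ N) / rising (1 - nu) N *
    (RtoC (INR (fact M)) * resonant1 N x nu e)).
  { unfold seriesS; rewrite (CSeries_split _ M) by (apply asum_seriesS; easy).
    unfold headS; f_equal.
    assert (E : forall k, rising (nu - e) k / rising (1 - e) k *
        RtoC (x ^ k / INR (fact (N + k))) =
      rising (1 - nu) N / (RtoC (x ^ N) * INR (fact M)) *
      (RtoC (x ^ S (M + k) / INR (S (M + k))) / rising (1 - nu) (S (M + k)))).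
    { intros k; change (S (M + k)) with (N + k)%nat.
      rewrite rising_plus, pow_add.
      replace (1 - nu + INR N) with (1 - e) by (unfold nu, n0; ring).
      replace (nu - e) with (RtoC (INR (S M))) by (unfold nu, n0, N; ring).
      assert (R1 := rising_fact M k).
      replace (rising (INR (S M)) k)
        with (RtoC (INR (fact (M + k))) / INR (fact M))
        by (rewrite <- R1; field; easy).
      rewrite !RtoC_div, RtoC_mult by
        (apply INR_fact_neq_0 || (apply not_0_INR; unfold N; lia)).
      change (N + k)%nat with (S (M + k)); rewrite RtoC_fact_S.
      assert (F1 := RtoC_fact_neq_0 (M + k)); assert (F2 := RtoC_S_neq_0 (M + k)).
      assert (Q2 := rising_neq_0 (1 - e) k N1me).
      assert (Q3 := rising_neq_0 (1 - nu) N N1nu).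
      assert (X0 : RtoC (x ^ N) <> 0) by (apply RtoC_neq_0, pow_nonzero; lra).
      field; easy. }
    unfold resonant1; rewrite (CSeries_ext _ _ E), (CSeries_scal _ _ A1).
    assert (Q3 := rising_neq_0 (1 - nu) N N1nu).
    assert (X0 : RtoC (x ^ N) <> 0) by (apply RtoC_neq_0, pow_nonzero; lra).
    field; easy. }
  assert (K2 : resonant2 N x nu e = / rising (1 + e) M * gamma_series nu x).
  { unfold resonant2, gamma_series; rewrite <- CSeries_scal
      by (apply asum_gamma_series; easy).
    apply CSeries_ext; intros k.
    replace (N + k)%nat with (M + S k)%nat by (unfold N; lia); rewrite rising_plus.
    replace (1 + e + INR M) with nu by (unfold nu; rewrite En0; ring).
    simpl rising; field; repeat split; try easy;
      [apply nonpole_add, Nnu|apply rising_neq_0, Nnu]. }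
  assert (P : cpow x nu * cpow x (- e) = RtoC (x ^ N)).
  { rewrite RtoC_pow, <- cpow_INR, <- cpow_plus by easy; f_equal; unfold nu, n0; ring. }
  rewrite seriesS_upper_gamma, Tl by easy; unfold resonance; rewrite G2, G3, K2, G1, Rnu.
  transitivity (sgn * (RtoC (INR (fact M)) *
      (cpow x nu * cpow x (- e)) * resonant1 N x nu e) / (e * rising (1 + e) M)
    - sgn * sgn * cpow x nu * Gamma (1 - nu) * gamma_series nu x);
    [field; easy|].
  rewrite P, Hss.
  transitivity (sgn * sgn * (RtoC (x ^ N) / (sgn * (e * rising (1 + e) M)) *
    (RtoC (INR (fact M)) * resonant1 N x nu e)) -
    cpow x nu * Gamma (1 - nu) * gamma_series nu x); [field; easy|].
  rewrite Hss; ring.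
Qed.

(** [resonance_identity] as [e] tends to 0: the left side converges because the joint limit holds
    along [(n0 + e, e)], the right side because all its terms are continuous there. *)
Lemma resonance_limit_value :
  cpow x n0 * (sgn * INR (fact M)) * resonance_limit n0 =
  - (seriesT n0 x + upper_gamma (1 - n0) x * (cpow x n0 * gamma_series n0 x))
  - headS n0.
Proof.
  set (F := C_near' (RtoC 0)).
  assert (Hn0 : ~ nonpos_integer n0) by apply nonpole_INR_S.
  assert (He : clim F (fun e => e) 0) by apply clim_locally'.
  assert (Hs : clim F (fun e => n0 + e) n0).
  { assert (X := clim_plus _ _ _ _ (clim_const n0) He); rewrite Cplus_0_r in X; exact X. }
  assert (H1s : clim F (fun e => 1 - (n0 + e)) (1 - n0))
    by (apply clim_minus; [apply clim_const|exact Hs]).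
  apply (clim_unique (F := F) (fun e => cpow x (n0 + e) *
    (sgn * INR (fact M)) * (resonance N x (n0 + e) e / e))).
  - apply clim_mult.
    + apply clim_mult; [|apply clim_const]; apply clim_cpow_exponent; easy.
    + apply (clim_comp (G := punctured n0) (fun e => (n0 + e, e))
        (fun p => resonance N x (fst p) (snd p) / snd p)); [|apply clim_resonance, Hn0].
      apply locally'_comp_punctured; [exact Hs|exact He|apply locally'_neq].
  - eapply clim_ext.
    { apply locally'_C_ball; exists 1%R; split; [lra|]; intros e H1 H2; symmetry.
      replace (e - 0) with e in H2 by ring; apply resonance_identity; easy. }
    apply clim_minus; [apply clim_opp, clim_plus|].
    + destruct (clim_nonpole_distance _ _ Hn0 Hs) as [d [Hd H]].
      unfold seriesT; apply tannery with
        (fun n => x / d * ((x / d) ^ n / INR (fact n)))%R.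
      * intros n; apply clim_mult; [apply clim_const|].
        apply clim_div; [apply rising_neq_0, Hn0|apply clim_const|apply clim_rising, Hs].
      * revert H; apply filter_imp; intros e H n; apply seriesT_term_le; easy.
      * apply ex_series_exp_bound.
    + apply clim_mult; [|apply clim_mult].
      * destruct (upper_gamma_strict_deriv (1 - n0) x Hx) as [l Hl].
        exact (clim_continuous_comp _ _ _ (clim_locally_derive Hl) H1s).
      * apply clim_cpow_exponent; easy.
      * destruct (gamma_series_strict_deriv n0 x Hn0) as [l Hl].
        exact (clim_continuous_comp _ _ _ (clim_locally_derive Hl) Hs).
    + unfold headS; apply clim_csum; intros n Hn; apply clim_div.
      * apply rising_1_minus_INR_neq_0; unfold N; lia.
      * apply clim_const.
      * apply clim_rising, H1s.
Qed.

Lemma tricomiU_deriv_integer : tricomiU_deriv_at n0 x.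
Proof.
  assert (Hn0 : ~ nonpos_integer n0) by apply nonpole_INR_S.
  set (p := cpow x (- n0)).
  (* [(a - n0)_N = (a - n0) (a - n0 + 1)_M] displays the zero; the cofactor is only evaluated, never
     differentiated. *)
  assert (Hform : forall a, ~ nonpos_integer a -> tricomiU a (1 + n0) x =
    p * (Gamma n0 * rGamma a * (1 + (a - n0) * head_quotient a)) +
    (a - n0) * (sgn * rising (a - n0 + 1) M * resonance_limit a)).
  { intros a Ha; rewrite tricomiU_integer, regular_head_quotient by easy; fold p.
    unfold N; rewrite (rising_S_l (a - n0)); ring. }
  assert (Hval : tricomiU n0 (1 + n0) x = p).
  { rewrite Hform, rGamma_nonpole by easy; replace (n0 - n0) with (RtoC 0) by ring.
    field; apply Gamma_neq_0, Hn0. }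
  assert (Hp : p * cpow x n0 = 1).
  { unfold p; rewrite <- cpow_plus by easy.
    replace (- n0 + n0) with (RtoC 0) by ring; apply cpow_0_r, Hx. }
  unfold tricomiU_deriv_at; rewrite Hval; fold p.
  replace (- p * (digamma n0 + seriesT n0 x +
      upper_gamma (1 - n0) x * (cpow x n0 * gamma_series n0 x))) with
    (p * (- digamma n0 + headS n0) + sgn * INR (fact M) * resonance_limit n0).
  (* The [headS] from the product rule cancels the one in [resonance_limit_value]. *)
  2: { transitivity (p * (- digamma n0 + headS n0) + p * cpow x n0 *
         (sgn * INR (fact M) * resonance_limit n0)); [rewrite Hp; ring|].
       replace (p * cpow x n0 * (sgn * INR (fact M) * resonance_limit n0))
         with (p * (cpow x n0 * (sgn * INR (fact M)) * resonance_limit n0))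
         by ring.
       rewrite resonance_limit_value; ring. }
  eapply clim_ext with (f := fun a => p * ((Gamma n0 * rGamma a *
      (1 + (a - n0) * head_quotient a) - 1) / (a - n0)) +
    sgn * rising (a - n0 + 1) M * resonance_limit a).
  - destruct (proj1 (locally_C_ball _ _) (nonpole_nearby n0 Hn0)) as [d [Hd Hnp]].
    apply locally'_C_ball; exists d; split; [easy|]; intros a Ha1 Ha2.
    rewrite Hform by (apply Hnp, Ha2); field; apply Cminus_eq_contra, Ha1.
  - assert (H1 : clim (C_near' n0) (fun a => a - n0 + 1) 1).
    { assert (X := clim_plus _ _ _ _ (clim_locally'_sub n0) (clim_const (RtoC 1))).
      rewrite Cplus_0_l in X; exact X. }
    apply clim_plus; apply clim_mult.
    + apply clim_const.
    + apply clim_quotient_product; [easy|]; rewrite <- head_quotient_headS.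
      unfold head_quotient; apply clim_csum; intros n _.
      apply clim_mult; [|apply clim_const]; apply clim_mult; [|apply clim_const].
      replace (n0 - n0 + 1) with (RtoC 1) by ring; apply clim_rising, H1.
    + apply clim_mult; [apply clim_const|].
      assert (R1 := rising_fact 0 M); simpl (INR (fact 0)) in R1; simpl (INR 1) in R1.
      rewrite Cmult_1_l in R1; change (0 + M)%nat with M in R1.
      rewrite <- R1; apply clim_rising, H1.
    + apply clim_resonance_limit, Hn0.
Qed.

End IntegerParameter.

Lemma tricomiU_deriv (nu : C) (x : R) :
  (0 < x)%R -> ~ nonpos_integer nu -> tricomiU_deriv_at nu x.
Proof.
  intros Hx Hn.
  destruct (excluded_middle_informative (exists m : Z, 1 + nu = RtoC (IZR m)))
    as [[m Hm]|H]; [|apply tricomiU_deriv_nonint; easy].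
  assert (En : nu = RtoC (IZR (m - 1))).
  { rewrite minus_IZR, RtoC_minus, <- Hm; ring. }
  (* For [m <= 1] the parameter [nu = m - 1] would be an excluded nonpositive integer; otherwise
     [nu] is the successor of [m - 2]. *)
  destruct (Z_le_gt_dec m 1) as [Hle|Hgt].
  - exfalso; apply Hn; exists (Z.to_nat (1 - m)).
    rewrite INR_IZR_INZ, Z2Nat.id, <- RtoC_opp, <- opp_IZR, En by lia.
    do 2 f_equal; lia.
  - replace nu with (RtoC (INR (S (Z.to_nat (m - 2))))).
    + apply tricomiU_deriv_integer, Hx.
    + rewrite En, INR_IZR_INZ; do 2 f_equal; lia.
Qed.

(** * From the Tricomi function to the Whittaker function *)

Theorem theorem13 (mu : C) (x : R)
  (hmu : forall n : nat, - (2 * mu) <> RtoC (INR n)) (hx : (0 < x)%R) :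
  is_derive (fun kappa : C => whittakerW kappa mu x) (- mu + 1 / 2)
    (cexp (- (x / 2)) * cpow x (1 / 2 - mu) *
     (digamma (2 * mu)
      + x / (2 * mu) *
        hypergeometric (RtoC 1 :: RtoC 1 :: nil)
                       (RtoC 2 :: 1 + 2 * mu :: nil) (- RtoC x)
      + cexp (- (2 * PI * Ci * mu)) *
        upper_gamma (1 - 2 * mu) x * lower_gamma (2 * mu) (- RtoC x))).
Proof.
  set (nu := 2 * mu).
  assert (Hn : ~ nonpos_integer nu).
  { intros [n Hn]; apply (hmu n); fold nu; rewrite Hn; ring. }
  assert (X := tricomiU_deriv nu x hx Hn).
  rewrite hypergeometric_seriesT, lower_gamma_neg by easy.
  set (k0 := - mu + 1 / 2).
  set (a := fun k : C => 1 / 2 + mu - k).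
  assert (Ha0 : a k0 = nu) by (unfold a, k0, nu; field; easy).
  apply is_derive_clim.
  set (c := cexp (- (x / 2)) * cpow x (mu + 1 / 2)).
  (* [a k - a k0 = - (k - k0)], whence the sign, which cancels the one in [tricomiU_deriv_at]. *)
  apply clim_ext with (fun k => - c *
    ((tricomiU (a k) (1 + nu) x - tricomiU nu (1 + nu) x) / (a k - nu))).
  - generalize (locally'_neq k0); apply filter_imp; intros k Hk.
    unfold whittakerW; fold nu c; fold (a k) (a k0); rewrite Ha0.
    replace (k - k0) with (- (a k - nu)) by (rewrite <- Ha0; unfold a; ring).
    field; intros E; apply (Cminus_eq_contra _ _ Hk); rewrite <- Ha0 in E.
    transitivity (- (a k - a k0)); [unfold a; ring|rewrite E; ring].
  - replace (cexp (- (x / 2)) * cpow x (1 / 2 - mu) * (digamma nu + seriesT nu x +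
      cexp (- (2 * PI * Ci * mu)) * upper_gamma (1 - nu) x *
        (cexp (nu * (Ci * PI)) * (cpow x nu * gamma_series nu x)))) with
      (- c * (- cpow x (- nu) * (digamma nu + seriesT nu x +
        upper_gamma (1 - nu) x * (cpow x nu * gamma_series nu x)))).
    + apply clim_mult; [apply clim_const|].
      apply (clim_comp (G := C_near' nu) a
        (fun w => (tricomiU w (1 + nu) x - tricomiU nu (1 + nu) x) / (w - nu))); [|exact X].
      intros P HP; apply locally'_C_ball in HP; destruct HP as [d [Hd HP]].
      apply locally'_C_ball; exists d; split; [easy|]; intros k Hk1 Hk2; apply HP.
      * intros E; apply Hk1; rewrite <- Ha0 in E.
        transitivity (1 / 2 + mu - a k); [unfold a; ring|rewrite E; unfold a; ring].
      * rewrite <- Ha0, Cmod_sub_sym; replace (a k0 - a k) with (k - k0)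
          by (unfold a; ring); easy.
    (* The factor [e^(-2 pi i mu)] of the formula exactly undoes the phase [e^(i pi nu)] of the
       lower gamma function, since [nu = 2 mu]. *)
    + assert (E1 : cexp (- (2 * PI * Ci * mu)) * cexp (nu * (Ci * PI)) = 1).
      { rewrite <- cexp_plus, <- cexp_0; f_equal; unfold nu; ring. }
      assert (E2 : cpow x (mu + 1 / 2) * cpow x (- nu) = cpow x (1 / 2 - mu)).
      { rewrite <- cpow_plus by easy; f_equal; unfold nu; ring. }
      rewrite <- E2; unfold c.
      transitivity (cexp (- (x / 2)) * (cpow x (mu + 1 / 2) * cpow x (- nu)) *
        (digamma nu + seriesT nu x +
          1 * upper_gamma (1 - nu) x * (cpow x nu * gamma_series nu x))); [ring|].
      rewrite <- E1; ring.
Qed.
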